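(* Let $n\ge 1$ be an integer and let $M_c$, $c\in(0,\infty)$, be the non-totally geodesic rotational minimal hypersurfaces (catenoids) in $\mathbb{H}^{2n+1}$. The renormalized area $\mathcal{A}_R(M_c)$ varies continuously with $c\in(0,\infty)$, from $-\infty$ when $c\to0^+$ (i.e. $\lim_{c\to0^+}\mathcal{A}_R(M_c)=-\infty$), to $$\lim_{c\to\infty}\mathcal{A}_R(M_c)=2\mathcal{A}_R(\mathbb{H}^{2n})=2\,\frac{(-4\pi)^n\,n!}{(2n)!}.$$ Consequently, the renormalized area of hypersurfaces in $\mathbb{H}^{2n+1}$ is not bounded below. Moreover, when $n$ is even, the renormalized area of minimal hypersurfaces in $\mathbb{H}^{2n+1}$ does not have a sign, i.e. there are minimal hypersurfaces with positive renormalized area and minimal hypersurfaces with negative renormalized area.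
   Context: Hyperbolic space is the hyperboloid $\mathbb{H}^{2n+1}=\{(x_1,\dots,x_{2n+1},z)\in\mathbb{R}^{2n+2}: \sum_{i=1}^{2n+1}x_i^2-z^2=-1,\ z>0\}$ with the metric induced by $\sum_i dx_i^2-dz^2$; $\mathbb{H}^{2n}$ denotes the totally geodesic hypersurface $\mathbb{H}^{2n+1}\cap\{x_2=0\}$. Catenoids. A (spherical) rotational hypersurface is a hypersurface invariant under $O(2n)$ acting on $(x_1,\dots,x_{2n})$; non-totally geodesic rotational minimal hypersurfaces are called catenoids and form a one-parameter family $\{M_c\}_{c>0}$ described as follows. Let $Q_{n,c}(u)=-u^{2n}+c^2u+(2n-1)^2$, with unique positive root $\alpha$, and let $u:\mathbb{R}\to(0,\alpha]$ be the non-constant smooth solution of $(u')^2=\frac{4u^2}{(2n-1)^2}Q_{n,c}(u)$ with $u(0)=\alpha$. Put $v(s)=-c\int_0^s\frac{u^{n+1/2}}{c^2u+(2n-1)^2}\,d\sigma$. Then $$M_c=\left\{\frac{1}{c\sqrt{u(s)}}\left((2n-1)\,\omega,\ \sqrt{c^2u(s)+(2n-1)^2}\,\sinh v(s),\ \sqrt{c^2u(s)+(2n-1)^2}\,\cosh v(s)\right): s\in\mathbb{R},\ \omega\in\mathbb{S}^{2n-1}\subset\mathbb{R}^{2n}\right\},$$ where $s$ is the arc length parameter of the generating curve and $\kappa=u^n$ is its curvature. Renormalized area. For a hypersurface $M\subset\mathbb{H}^{2n+1}$ the renormalized area $\mathcal{A}_R(M)$ is the constant term in the expansion, in powers of $\epsilon>0$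 as $\epsilon\to0^+$, of the area of the truncated hypersurface $M_\epsilon=M\cap\{z\le 1/\epsilon\}$. *)

(* Defs.v *)
From mathcomp Require Import all_boot all_order all_algebra.
From mathcomp Require Import all_classical all_reals all_analysis.

Set Implicit Arguments.
Unset Strict Implicit.
Unset Printing Implicit Defensive.

Import Order.TTheory GRing.Theory Num.Theory.
Import numFieldNormedType.Exports.

Local Open Scope classical_set_scope.
Local Open Scope ring_scope.

Definition partial (R : realType) (m p : nat) (i : 'I_m)
    (f : 'rV[R]_m -> 'rV[R]_p) : 'rV[R]_m -> 'rV[R]_p :=
  fun t => 'D_(delta_mx 0 i) f t.

Fixpoint Ck_on (R : realType) (m p k : nat) (U : set 'rV[R]_m)
    (f : 'rV[R]_m -> 'rV[R]_p) : Prop :=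
  match k with
  | 0 => {in U, continuous f}
  | k'.+1 => {in U, continuous f} /\
      forall i : 'I_m,
        (forall t, U t -> derivable f t (delta_mx 0 i)) /\
        Ck_on k' U (partial i f)
  end.

Definition smooth_on (R : realType) (m p : nat) (U : set 'rV[R]_m)
    (f : 'rV[R]_m -> 'rV[R]_p) : Prop :=
  forall k, Ck_on k U f.

Definition borel_set (R : realType) (m : nat) (D : set 'rV[R]_m) : Prop :=
  <<s @open 'rV[R]_m >> D.

(* By Tonelli, for a nonnegative Borel function this iterated integral is its
   integral against m-dimensional Lebesgue measure; it is only used for such
   functions. *)
Fixpoint iterated_integral (R : realType) (m : nat) :
    ('rV[R]_m -> \bar R) -> \bar R :=
  match m with
  | 0 => fun f => f 0
  | m'.+1 => fun f =>
      (\int[@lebesgue_measure R]_x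
        iterated_integral
          (fun t : 'rV[R]_m' => f (row_mx (const_mx x : 'rV[R]_1) t)))%E
  end.

(* On R^{m+1,1}, with z the last coordinate. *)

Definition minkowski (R : realType) (m : nat) (x y : 'rV[R]_m.+2) : R :=
  \sum_(i | i != ord_max) x 0 i * y 0 i - x 0 ord_max * y 0 ord_max.

Definition hyperbolic_space (R : realType) (m : nat) : set 'rV[R]_m.+2 :=
  [set x | minkowski x x = -1 /\ 0 < x 0 ord_max].
Arguments hyperbolic_space : clear implicits.

Definition first_fundamental_form (R : realType) (m : nat)
    (phi : 'rV[R]_m -> 'rV[R]_m.+2) (t : 'rV[R]_m) : 'M[R]_m :=
  \matrix_(i, j) minkowski (partial i phi t) (partial j phi t).

Definition area_element (R : realType) (m : nat)
    (phi : 'rV[R]_m -> 'rV[R]_m.+2) (t : 'rV[R]_m) : R :=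
  Num.sqrt (\det (first_fundamental_form phi t)).

(* [has_area S a]: the m-dimensional Riemannian area of S, a subset of H^{m+1},
   is a. It is computed in a C^1 parametrization of S that is one-to-one off a
   Lebesgue-null set N (as spherical coordinates are). By the area formula, a is
   the m-dimensional Hausdorff measure of S, whichever parametrization is
   chosen. *)
Definition has_area (R : realType) (m : nat) (S : set 'rV[R]_m.+2) (a : R) :
    Prop :=
  exists (phi : 'rV[R]_m -> 'rV[R]_m.+2) (U D N : set 'rV[R]_m),
    [/\ open U, Ck_on 1 U phi & phi @` U `<=` hyperbolic_space R m] /\
    [/\ borel_set D, D `<=` U & phi @` D = S] /\
    [/\ borel_set N, iterated_integral (fun t => (\1_N t)%:E) = 0%E
      & {in D `\` N &, injective phi}] /\
    iterated_integral (fun t => (area_element phi t * \1_D t)%:E) = a%:E.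

Definition truncation (R : realType) (m : nat) (M : set 'rV[R]_m.+2) (eps : R) :
    set 'rV[R]_m.+2 :=
  M `&` [set x | x 0 ord_max <= eps^-1].

(* The polynomial p in eps^-1 collects the divergent terms of the expansion;
   a is then the constant term, the remaining terms being o(1). *)
Definition has_renormalized_area (R : realType) (m : nat)
    (M : set 'rV[R]_m.+2) (a : R) : Prop :=
  exists (A : R -> R) (p : {poly R}),
    [/\ forall eps, 0 < eps -> has_area (truncation M eps) (A eps),
        p.[0] = 0
      & A eps - p.[eps^-1] @[eps --> 0^'+] --> a].

(* A local parametrization of M: an immersion that is a homeomorphism from U
   onto an open subset of M. *)
Definition local_parametrization (R : realType) (m : nat)
    (M : set 'rV[R]_m.+2) (U : set 'rV[R]_m)
    (phi : 'rV[R]_m -> 'rV[R]_m.+2) : Prop :=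
  [/\ open U, smooth_on U phi, {in U &, injective phi},
      forall t, U t -> row_free (\matrix_(i < m) partial i phi t)
    & forall V, V `<=` U -> open V -> exists2 W, open W & phi @` V = M `&` W].

(* Properly embedded (closed), connected smooth hypersurfaces of H^{m+1}. *)
Definition hypersurface (R : realType) (m : nat) (M : set 'rV[R]_m.+2) : Prop :=
  [/\ M `<=` hyperbolic_space R m, M !=set0, closed M, connected M
    & forall x, M x ->
        exists U phi, local_parametrization M U phi /\ (phi @` U) x].

Definition unit_normal (R : realType) (m : nat)
    (phi : 'rV[R]_m -> 'rV[R]_m.+2) (t : 'rV[R]_m) (nu : 'rV[R]_m.+2) : Prop :=
  [/\ minkowski nu nu = 1, minkowski nu (phi t) = 0
    & forall i, minkowski nu (partial i phi t) = 0].

(* The Levi-Civita derivative of H^{m+1} is the tangential part of the flat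
   derivative of R^{m+1,1}, and nu is tangent to H^{m+1}, so the flat second
   derivatives of phi suffice. *)
Definition second_fundamental_form (R : realType) (m : nat)
    (phi : 'rV[R]_m -> 'rV[R]_m.+2) (t : 'rV[R]_m) (nu : 'rV[R]_m.+2) :
    'M[R]_m :=
  \matrix_(i, j) minkowski (partial i (partial j phi) t) nu.

Definition mean_curvature (R : realType) (m : nat)
    (phi : 'rV[R]_m -> 'rV[R]_m.+2) (t : 'rV[R]_m) (nu : 'rV[R]_m.+2) : R :=
  \tr (invmx (first_fundamental_form phi t)
       *m second_fundamental_form phi t nu).

(* The unit normal is unique up to sign, and the mean curvature does not depend
   on the parametrization up to sign. *)
Definition minimal_hypersurface (R : realType) (m : nat)
    (M : set 'rV[R]_m.+2) : Prop :=
  hypersurface M /\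
  forall x, M x -> exists U phi,
    [/\ local_parametrization M U phi, (phi @` U) x
      & forall t, U t ->
          exists2 nu, unit_normal phi t nu & mean_curvature phi t nu = 0].

(* H^{2n} as the hypersurface x_2 = 0 of H^{2n+1}; indices start at 0. *)
Definition totally_geodesic_H2n (R : realType) (n : nat) :
    set 'rV[R]_(2 * n).+2 :=
  hyperbolic_space R (2 * n) `&` [set x | x 0 (inord 1) = 0].
Arguments totally_geodesic_H2n : clear implicits.

Definition catenoid_Q (R : realType) (n : nat) (c u : R) : R :=
  - u ^+ (2 * n) + c ^+ 2 * u + (2 * n - 1)%:R ^+ 2.

(* The positive root of Q_{n,c} is unique, so [xget] picks it; likewise for the
   non-constant solution u below, which is unique because it is smooth (a C^1
   solution could stay at alpha for a while). *)
Definition catenoid_alpha (R : realType) (n : nat) (c : R) : R :=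
  xget 0 [set a | 0 < a /\ catenoid_Q n c a = 0].

Definition is_catenoid_u (R : realType) (n : nat) (c : R) (u : R -> R) : Prop :=
  [/\ forall k s, derivable (derive1n k u) s 1,
      forall s, 0 < u s <= catenoid_alpha n c,
      ~ (exists a, forall s, u s = a),
      forall s, derive1 u s ^+ 2 =
        4 * u s ^+ 2 / (2 * n - 1)%:R ^+ 2 * catenoid_Q n c (u s)
    & u 0 = catenoid_alpha n c].

Definition catenoid_u (R : realType) (n : nat) (c : R) : R -> R :=
  xget (fun=> 0) (is_catenoid_u n c).

(* The two cases give the oriented integral from 0 to s. *)
Definition catenoid_v (R : realType) (n : nat) (c s : R) : R :=
  let f t := catenoid_u n c t `^ (n%:R + 2^-1) /
             (c ^+ 2 * catenoid_u n c t + (2 * n - 1)%:R ^+ 2) in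
  - c * (if 0 <= s then \int[lebesgue_measure]_(t in `[0, s]) f t
         else - \int[lebesgue_measure]_(t in `[s, 0]) f t).

Definition sinh (R : realType) (x : R) : R := (expR x - expR (- x)) / 2.
Definition cosh (R : realType) (x : R) : R := (expR x + expR (- x)) / 2.

Definition catenoid (R : realType) (n : nat) (c : R) :
    set 'rV[R]_(2 * n).+2 :=
  [set x | exists (s : R) (omega : 'rV[R]_(2 * n)),
    let u := catenoid_u n c s in
    let v := catenoid_v n c s in
    let r := Num.sqrt (c ^+ 2 * u + (2 * n - 1)%:R ^+ 2) in
    [/\ \sum_i omega 0 i ^+ 2 = 1,
        forall i : 'I_(2 * n),
          x 0 (inord i) = (c * Num.sqrt u)^-1 * ((2 * n - 1)%:R * omega 0 i),
        x 0 (inord (2 * n)) = (c * Num.sqrt u)^-1 * (r * sinh v)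
      & x 0 ord_max = (c * Num.sqrt u)^-1 * (r * cosh v)]].
Arguments catenoid {R} n c.

(* Main.v *)
(* Let r = (2n-1) / (c sqrt u) be the Euclidean radius of the spherical orbits, r0 = r(0) that
   of the neck, and tau = r0^2; the natural number k below is n - 1. In the arc length s,
   r'^2 = 1 + r^2 - K / r^(4n-2) with K = tau^(2n-1) (1 + tau) = (2n-1)^(4n-2) / c^(4n), and the
   substitution r^2 = tau (1 + w^2) removes the turning point at the neck. In the
   parametrization x |-> (r e^-s x, rho sinh v, rho cosh v), s = ln |x|, rho^2 = 1 + r^2, of
   the catenoid by the punctured R^(2n), the area element is r^(2n-1) / |x|^(2n), whence
   area = const * int r^(2n-1) ds. For the polynomial P with 2 (1 + T) P' + P = T^(n-1),
   r^(2n-1) = d/ds (P(r^2) r' - (1 + tau) Psi(w)), where Psi' = O(1 / w^3). The first term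
   equals, up to o(1), a polynomial without constant term in the truncation height, since v
   converges fast enough; hence A_R(M_c) = - 4 C (1 + tau) Psi(+oo), C = pi^n / (n-1)!.
   As c -> 0+, tau -> +oo and Psi' > 0 gives A_R <= - const sqrt (1 + tau); as c -> +oo,
   tau -> 0 and dominated convergence gives A_R -> - 4 C P(0), twice the value for H^(2n). *)
Require Import Defs.
From mathcomp Require Import all_boot all_order all_algebra.
From mathcomp Require Import all_classical all_reals all_analysis.
From mathcomp Require Import measurable_realfun.
From mathcomp Require Import polyrcf.
From mathcomp Require Import zify ring lra.

Set Implicit Arguments.
Unset Strict Implicit.
Unset Printing Implicit Defensive.

Import Order.TTheory GRing.Theory Num.Theory.
Import numFieldNormedType.Exports.
Import Defs.

Local Open Scope classical_set_scope.
Local Open Scope ring_scope.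

(** * Determinants and smoothness *)

(** The function u in [catenoid] is whatever [xget] picks among the smooth solutions of a first
    order equation whose right side vanishes at the neck, exactly where uniqueness is delicate.
    Smoothness upgrades this to a second order equation with a locally Lipschitz right side, and
    uniqueness there identifies u with the explicit profile N^2 / (c^2 r^2), N = 2n - 1. From then
    on only r, p = r', the flux q = sqrt K / r^N and v occur, tied by p^2 + q^2 = 1 + r^2 = rho^2.
    One chart replaces an atlas of the sphere. It is injective and proper, which gives areas,
    closedness and embeddedness together, and every integral over it involves only the squared norm.
    Minimality, needed for the claim about signs, is read off the derivative of an explicit unit
    normal, whose eigenvalues are q/r, N times, and -N q/r, once. The claim about signs then follows
    from the two limits, (-4)^n being positive for even n. *)

Lemma det_add_mulmx (K : comNzRingType) (m : nat) (u : 'cV[K]_m) (v : 'rV[K]_m) :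
  \det (1%:M + u *m v) = 1 + (v *m u) 0 0.
Proof.
(* Both products are the block matrix with rows (1, v) and (- u, 1), and all four factors are block
   triangular. *)
have E : block_mx 1%:M 0 (- u) 1%:M *m block_mx 1%:M v 0 (1%:M + u *m v) =
    block_mx 1%:M v 0 1%:M *m block_mx (1%:M + v *m u) 0 (- u) 1%:M.
  rewrite !mulmx_block !mul1mx !mulmx1 !mulmx0 !mul0mx !addr0 !add0r.
  by rewrite mulmxN mulNmx addrK [- _ + _]addrC addrK.
have /(congr1 determinant) := E.
rewrite !det_mulmx !det_lblock !det_ublock !det1 !mul1r mulr1 => ->.
by rewrite det_mx11 !mxE.
Qed.

Lemma det_scalar_add_rank1 (K : fieldType) (m : nat) (x : 'rV[K]_m) (a b : K) :
  a != 0 ->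
  \det (a%:M + b *: (x^T *m x)) = a ^+ m * (1 + b / a * \sum_i x 0 i ^+ 2).
Proof.
move=> a0.
have -> : a%:M + b *: (x^T *m x) = a *: (1%:M + ((b / a) *: x^T) *m x).
  by rewrite scalerDr scalemx1 -scalemxAl scalerA mulrCA divff ?mulr1.
rewrite detZ det_add_mulmx; congr (_ * (1 + _)).
rewrite -scalemxAr !mxE; congr (_ * _).
by apply: eq_bigr => i _; rewrite !mxE -expr2.
Qed.

(** Restriction to a line turns a directional derivative into a derivative in one real variable, so
    the one-variable chain rule extends to functions on a normed space with no Frechet
    differentiability assumed. *)
Lemma is_derive_line (R : numFieldType) (V W : normedModType R) (f : V -> W)
    (x v : V) (d : W) :
  is_derive (0 : R) (1 : R) (fun h : R => f (h *: v + x)) d <-> is_derive x v f d.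
Proof.
pose g h := f (h *: v + x).
have E : (fun h : R => h^-1 *: ((g \o shift 0) (h *: (1 : R)) - g 0)) =
    (fun h : R => h^-1 *: ((f \o shift x) (h *: v) - f x)).
  apply/funext => h; rewrite /g /= addr0 scale0r add0r.
  by congr (_ *: (f (_ *: _ + _) - _)); rewrite /GRing.scale /= mulr1.
by split=> -[]; rewrite /derivable /derive -/g ?E => h1 h2; split; rewrite /derivable /derive ?E.
Qed.

Lemma is_derive_comp1 (R : realType) (V : normedModType R) (f : R -> R)
    (l : V -> R) (x v : V) (df dl : R) :
  is_derive x v l dl -> is_derive (l x) 1 f df -> is_derive x v (f \o l) (dl * df).
Proof.
move=> /is_derive_line hl hf; apply/is_derive_line.
have -> : (fun h : R => (f \o l) (h *: v + x)) = f \o (fun h : R => l (h *: v + x)) by [].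
rewrite mulrC; apply: is_derive1_comp.
by rewrite scale0r add0r.
Qed.

Lemma is_derive_mx (R : realFieldType) (V : normedModType R) (m n : nat)
    (f : V -> 'M[R]_(m, n)) (x v : V) (d : 'M[R]_(m, n)) :
  (forall i j, is_derive x v (fun y => f y i j) (d i j)) -> is_derive x v f d.
Proof.
move=> h.
have hf : derivable f x v by apply/derivable_mxP => i j; case: (h i j).
split=> //; rewrite derive_mx//; apply/matrixP => i j; rewrite mxE.
by case: (h i j).
Qed.

Lemma is_derive_coord (R : realFieldType) (m : nat) (x v : 'rV[R]_m) (i : 'I_m) :
  is_derive x v (fun y : 'rV[R]_m => y 0 i) (v 0 i).
Proof.
have h : is_derive x v (@id 'rV[R]_m) v by exact: is_derive_id.
have hd : derivable (@id 'rV[R]_m) x v by case: h.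
split; first by have /derivable_mxP := hd; apply.
by have := derive_mx hd; case: h => _ -> /matrixP /(_ 0 i); rewrite mxE.
Qed.

Section generated_functions.
Variables (R : realType) (V : normedModType R).

(* If the partial derivatives of each element of G lie in the algebra generated by G,
   then every element of this algebra is smooth. *)
Inductive generated (G : set (V -> R)) : (V -> R) -> Prop :=
| generated_cst c : generated G (fun=> c)
| generated_in f : G f -> generated G f
| generated_add f g : generated G f -> generated G g -> generated G (fun x => f x + g x)
| generated_mul f g : generated G f -> generated G g -> generated G (fun x => f x * g x).

Lemma generated_opp (G : set (V -> R)) f : generated G f -> generated G (fun x => - f x).
Proof.
move=> h; have -> : (fun x => - f x) = (fun x => (-1) * f x).
  by apply/funext => x; rewrite mulN1r.
by apply: generated_mul => //; exact: generated_cst.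
Qed.

Lemma generated_exp (G : set (V -> R)) f k :
  generated G f -> generated G (fun x => f x ^+ k).
Proof.
move=> h; elim: k => [|k ih]; first exact: generated_cst.
by under eq_fun do rewrite exprS; exact: generated_mul.
Qed.

Lemma generated_sum (G : set (V -> R)) (I : Type) (s : seq I) (P : pred I)
    (F : I -> V -> R) :
  (forall i, generated G (F i)) -> generated G (fun x => \sum_(i <- s | P i) F i x).
Proof.
move=> h; elim: s => [|i s ih].
  by under eq_fun do rewrite big_nil; exact: generated_cst.
under eq_fun do rewrite big_cons.
by case: (P i) => //; exact: generated_add.
Qed.

Lemma generated_continuous (U : set V) (G : set (V -> R)) f :
  (forall g, G g -> {in U, continuous g}) -> generated G f -> {in U, continuous f}.
Proof.
move=> hG; elim=> [c|g /hG//|g h _ ihg _ ihh|g h _ ihg _ ihh] x Ux.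
- exact: cvg_cst.
- by apply: cvgD; [exact: ihg|exact: ihh].
- by apply: cvgM; [exact: ihg|exact: ihh].
Qed.

Definition generated_derivative (U : set V) (v : V) (G : set (V -> R)) (f : V -> R) :=
  exists2 h, generated G h & forall x, U x -> is_derive x v f (h x).

Lemma generated_is_derive (U : set V) (v : V) (G : set (V -> R)) f :
  (forall g, G g -> generated_derivative U v G g) ->
  generated G f -> generated_derivative U v G f.
Proof.
move=> hG; elim=> [c|g /hG//|g h hg [dg dg1 dg2] hh [dh dh1 dh2]|
                   g h hg [dg dg1 dg2] hh [dh dh1 dh2]].
- by exists (fun=> 0); [exact: generated_cst|move=> x _; exact: is_derive_cst].
- exists (fun x => dg x + dh x); first exact: generated_add.
  by move=> x Ux; apply: is_deriveD; [exact: dg2|exact: dh2].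
- exists (fun x => g x * dh x + h x * dg x).
    by apply: generated_add; apply: generated_mul.
  by move=> x Ux; apply: (is_deriveM (dg2 x Ux) (dh2 x Ux)).
Qed.

End generated_functions.

Lemma generated_derive1n (R : realType) (G : set (R -> R)) (u : R -> R) :
  (forall g, G g -> generated_derivative (setT : set R) (1 : R) G g) -> generated G u ->
  forall k s, derivable (derive1n k u) s 1.
Proof.
move=> hG hu k s; have : generated G (derive1n k u).
  elim: k => [|k ih]; first by rewrite derive1n0.
  have [h h1 h2] := generated_is_derive hG ih.
  suff -> : derive1n k.+1 u = h by [].
  by apply/funext => x; rewrite derive1nS derive1E; case: (h2 x I).
by move=> /(generated_is_derive hG)[h _ /(_ s I)[]].
Qed.

Section generated_smooth.
Variables (R : realType) (m p : nat) (U : set 'rV[R]_m) (G : set ('rV[R]_m -> R)).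
Hypothesis oU : open U.
Hypothesis cG : forall g, G g -> {in U, continuous g}.
Hypothesis dG : forall g (i : 'I_m), G g -> generated_derivative U (delta_mx 0 i) G g.

Let row_continuous (f : 'rV[R]_m -> 'rV[R]_p) :
  (forall j, exists2 h, generated G h & forall x, U x -> f x 0 j = h x) ->
  {in U, continuous f}.
Proof.
move=> hf x /set_mem Ux.
apply/(@cvgrPdist_lt _ _ _ _ (nbhs_filter x)) => e e0.
have near_e j : \forall y \near x, `|f x 0 j - f y 0 j| < e.
  have [h h1 h2] := hf j.
  have /cvgrPdist_lt/(_ _ e0) := generated_continuous cG h1 (mem_set Ux).
  move: (open_nbhs_nbhs (conj oU Ux)) => oUx.
  by apply: (@filterS2 _ (nbhs x) (nbhs_filter x)) oUx => y Uy; rewrite !h2.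
have : \forall y \near x, forall j, `|f x 0 j - f y 0 j| < e.
  exact: (@filter_forall _ _ _ _ (nbhs_filter x)).
apply: (@filterS _ (nbhs x) (nbhs_filter x)) => y hy; rewrite [ltLHS]/Num.Def.normr/= mx_normrE.
by apply/bigmax_ltP; split=> // -[i j] _; rewrite !mxE (ord1 i).
Qed.

(** The hypothesis passes from [f] to [partial i f], so the order of differentiability can be raised
    by induction. Agreement with a generated function on [U] alone is enough, derivatives being
    local and [U] open. *)
Lemma generated_smooth_on (f : 'rV[R]_m -> 'rV[R]_p) :
  (forall j, exists2 h, generated G h & forall x, U x -> f x 0 j = h x) ->
  smooth_on U f.
Proof.
move=> hf k; elim: k f hf => [|k ih] f hf.
  exact: row_continuous.
split=> [|i]; first exact: row_continuous.
have D j : exists2 h, generated G h &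
    forall x, U x -> is_derive x (delta_mx 0 i) (fun y => f y 0 j) (h x).
  have [h h1 h2] := hf j.
  have [g g1 g2] := generated_is_derive (dG ^~ i) h1.
  exists g => // x Ux; apply: near_eq_is_derive (g2 x Ux).
  by move: (open_nbhs_nbhs (conj oU Ux)) => oUx; apply: filterS oUx => y /h2.
have df t : U t -> derivable f t (delta_mx 0 i).
  move=> Ut; apply/derivable_mxP => i0 j; rewrite (ord1 i0).
  by have [h _ /(_ _ Ut)[]] := D j.
split=> //; apply: ih => j; have [h h1 h2] := D j; exists h => // x Ux.
by rewrite /partial derive_mx ?mxE; [case: (h2 x Ux)|exact: df].
Qed.

End generated_smooth.

(* With these hints, [apply] closes the premises [is_derive x v f ?d] with derivatives
   in a shape unrelated to the rules [der_*] below. *)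
#[local] Remove Hints is_derive1_atan is_derive1_comp is_derive1_ln is_derive1_powR
  is_derive1_sqrt is_derive_cos is_derive_cst is_deriveB is_deriveD is_deriveM is_deriveN
  is_deriveNid is_deriveX is_deriveZ is_derive_expR is_derive_id is_derive_poly
  is_derive_sin is_derive_sum : typeclass_instances.

Section derivative_rules.
Variables (R : realType) (V : normedModType R) (x v : V).
Implicit Types f g : V -> R.

Lemma der_cst (c : R) : is_derive x v (fun=> c : R) 0.
Proof. exact: is_derive_cst. Qed.

Lemma der_add f g (a b : R) : is_derive x v f a -> is_derive x v g b ->
  is_derive x v (fun y => f y + g y) (a + b).
Proof. by move=> ? ?; exact: is_deriveD. Qed.

Lemma der_opp f (a : R) : is_derive x v f a -> is_derive x v (fun y => - f y) (- a).
Proof. by move=> ?; exact: is_deriveN. Qed.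

Lemma der_mul f g (a b : R) : is_derive x v f a -> is_derive x v g b ->
  is_derive x v (fun y => f y * g y) (a * g x + f x * b).
Proof.
move=> hf hg; apply: (is_derive_eq (is_deriveM hf hg)).
by rewrite /GRing.scale /= addrC (mulrC a).
Qed.

Lemma der_inv f (a : R) : is_derive x v f a -> f x != 0 ->
  is_derive x v (fun y => (f y)^-1) (- (a / f x ^+ 2)).
Proof.
move=> hf fx; split; first by apply: derivableV => //; case: hf.
by rewrite deriveV//; case: hf => _ ->; rewrite /GRing.scale /= mulNr mulrC.
Qed.

Lemma der_exp f (a : R) k : is_derive x v f a ->
  is_derive x v (fun y => f y ^+ k) (k%:R * f x ^+ k.-1 * a).
Proof.
move=> hf; have -> : (fun y => f y ^+ k) = f ^+ k.
  by apply/funext => y; rewrite fctE.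
exact: is_deriveX.
Qed.

Lemma der_sqrt f (a : R) : is_derive x v f a -> 0 < f x ->
  is_derive x v (fun y => Num.sqrt (f y)) (a / (2 * Num.sqrt (f x))).
Proof. by move=> hf fx; exact: (is_derive_comp1 hf (is_derive1_sqrt fx)). Qed.

Lemma der_exp_real f (a : R) : is_derive x v f a ->
  is_derive x v (fun y => expR (f y)) (a * expR (f x)).
Proof. by move=> hf; exact: (is_derive_comp1 hf (is_derive_expR _)). Qed.

Lemma der_ln f (a : R) : is_derive x v f a -> 0 < f x ->
  is_derive x v (fun y => ln (f y)) (a / f x).
Proof. by move=> hf fx; exact: (is_derive_comp1 hf (is_derive1_ln fx)). Qed.

Lemma der_horner (p : {poly R}) f (a : R) : is_derive x v f a ->
  is_derive x v (fun y => p.[f y]) (a * p^`().[f x]).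
Proof. by move=> hf; exact: (is_derive_comp1 hf (is_derive_poly p _)). Qed.

Lemma der_cosh f (a : R) : is_derive x v f a ->
  is_derive x v (fun y => cosh (f y)) (a * sinh (f x)).
Proof.
move=> hf; apply: (is_derive_eq (der_mul (der_add (der_exp_real hf)
  (der_exp_real (der_opp hf))) (der_cst 2^-1))).
by rewrite /sinh; lra.
Qed.

Lemma der_sinh f (a : R) : is_derive x v f a ->
  is_derive x v (fun y => sinh (f y)) (a * cosh (f x)).
Proof.
move=> hf; apply: (is_derive_eq (der_mul (der_add (der_exp_real hf)
  (der_opp (der_exp_real (der_opp hf)))) (der_cst 2^-1))).
by rewrite /cosh; lra.
Qed.

End derivative_rules.
#[global] Arguments der_cst {R V x v} c.

Lemma cosh2_sinh2 (R : realType) (x : R) : cosh x ^+ 2 - sinh x ^+ 2 = 1.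
Proof.
have h := expRN x; have h0 : expR x != 0 by rewrite gt_eqF ?expR_gt0.
by rewrite /cosh /sinh h; field.
Qed.

Lemma cosh_ge1 (R : realType) (x : R) : 1 <= cosh x.
Proof.
have h := expRN x; have h0 := expR_gt0 x.
have E : expR x * expR (- x) = 1 by rewrite h divff// gt_eqF.
have := sqr_ge0 (expR x - expR (- x)); have := expR_gt0 (- x).
by rewrite /cosh; nra.
Qed.

Lemma coshN (R : realType) (x : R) : cosh (- x) = cosh x.
Proof. by rewrite /cosh opprK addrC. Qed.

Lemma sinh_gt0 (R : realType) (x : R) : 0 < x -> 0 < sinh x.
Proof. by move=> x0; rewrite /sinh divr_gt0// subr_gt0 ltr_expR; lra. Qed.

Lemma sinh_inj (R : realType) : injective (@sinh R).
Proof.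
suff h (x y : R) : x < y -> sinh x < sinh y.
  by move=> x y E; case: (ltgtP x y) => // /h; rewrite E ltxx.
move=> xy; have : expR x < expR y by rewrite ltr_expR.
have : expR (- y) < expR (- x) by rewrite ltr_expR ltrN2.
by rewrite /sinh; lra.
Qed.

(** * Calculus in one real variable *)

Section calculus.
Variable R : realType.
Implicit Types (f df : R -> R) (a b : R).

Lemma is_derive_continuous f (x d : R) : is_derive x 1 f d -> {for x, continuous f}.
Proof. by move=> [h _]; apply/differentiable_continuous/derivable1_diffP. Qed.

Lemma is_derive_within f df a b :
  (forall x : R, is_derive x 1 f (df x)) -> {within `[a, b], continuous f}.
Proof. by move=> h; apply: continuous_subspaceT => x; exact: is_derive_continuous. Qed.

Lemma derive_ge0_le f df a b : (forall x : R, is_derive x 1 f (df x)) ->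
  (forall x, a < x -> x < b -> 0 <= df x) -> a <= b -> f a <= f b.
Proof.
move=> h h0; rewrite le_eqVlt => /predU1P[->//|ab].
have [//|c] := @MVT R f df a b ab (fun x _ => h x); first exact: is_derive_within h.
rewrite in_itv/= => /andP[ac cb] E.
by rewrite -subr_ge0 E mulr_ge0 ?h0// subr_ge0 ltW.
Qed.

Lemma derive_gt0_lt f df a b : (forall x : R, is_derive x 1 f (df x)) ->
  (forall x, a < x -> x < b -> 0 < df x) -> a < b -> f a < f b.
Proof.
move=> h h0 ab.
have [//|c] := @MVT R f df a b ab (fun x _ => h x); first exact: is_derive_within h.
rewrite in_itv/= => /andP[ac cb] E.
by rewrite -subr_gt0 E mulr_gt0 ?h0// subr_gt0.
Qed.

Lemma derive0_eq f (x y : R) : (forall z : R, is_derive z 1 f 0) -> f x = f y.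
Proof. by move=> h; exact: is_derive_0_is_cst. Qed.

Lemma continuous_integrable f a b : continuous f ->
  (@lebesgue_measure R).-integrable `[a, b] (EFin \o f).
Proof.
move=> cf; apply: continuous_compact_integrable; first exact: segment_compact.
exact: continuous_subspaceT.
Qed.

Lemma integral_is_derive f df a b : (forall x : R, is_derive x 1 f (df x)) ->
  continuous df -> a <= b ->
  (\int[lebesgue_measure]_(x in `[a, b]) (df x)%:E)%E = (f b - f a)%:E.
Proof.
move=> h cdf; rewrite le_eqVlt => /predU1P[->|ab].
  by rewrite set_itv1 integral_set1 subrr.
rewrite (@continuous_FTC2 R df f)//.
- exact: continuous_subspaceT.
- split; first by move=> x _; case: (h x).
    exact/cvg_at_right_filter/(is_derive_continuous (h a)).
  exact/cvg_at_left_filter/(is_derive_continuous (h b)).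
- by move=> x _; rewrite derive1E; case: (h x).
Qed.

Lemma Rintegral_is_derive f df a b : (forall x : R, is_derive x 1 f (df x)) ->
  continuous df -> a <= b ->
  \int[lebesgue_measure]_(x in `[a, b]) df x = f b - f a.
Proof. by move=> h cdf ab; rewrite /Rintegral (integral_is_derive h). Qed.

(** The integral from - M to x has derivative f(x) only for x > - M, so the base point must recede
    with x. The difference G M x - G M 0 does not depend on M, hence near x the moving bound |y| + 1
    may be frozen at |x| + 2. *)
Lemma exists_primitive f : continuous f ->
  exists2 F : R -> R, F 0 = 0 & forall x : R, is_derive x 1 F (f x).
Proof.
move=> cf.
pose G (M x : R) : R := \int[lebesgue_measure]_(t in `[- M, x]) f t.
pose F (x : R) : R := G (`|x| + 1) x - G (`|x| + 1) 0.
have dG (M x : R) : - M < x -> is_derive x 1 (G M) (f x).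
  move=> Mx.
  have [] := @continuous_FTC1_closed R f (- M) x (x + 1) _ _ Mx (cf x).
  - by rewrite ltrDl.
  - exact: continuous_integrable.
  - by rewrite derive1E => d1 d2; split.
have indep (M M' x : R) : `|x| < M -> M <= M' -> G M x - G M 0 = G M' x - G M' 0.
  move=> xM MM'; have M0 : 0 < M by exact: le_lt_trans (normr_ge0 x) xM.
  move: xM; rewrite ltr_norml => /andP[xM1 xM2].
  have K (y : R) : - M <= y -> G M' y = G M' (- M) + G M y.
    move=> My; have := @Rintegral_itvB R f (BLeft (- M')) (BRight y) (- M).
    rewrite !bnd_simp => /(_ (continuous_integrable _ _ cf)).
    rewrite lerN2 => /(_ MM' My); rewrite -/(G M' y) -/(G M' (- M)).
    rewrite Rintegral_itv_obnd_cbnd; last first.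
      apply: integrableS (continuous_integrable (- M) y cf) => //.
      exact: subset_itv_oc_cc.
    by rewrite -/(G M y) => <-; rewrite addrC subrK.
  have M0' : - M <= 0 by rewrite oppr_le0 ltW.
  by rewrite (K x (ltW xM1)) (K 0 M0'); lra.
exists F; first by rewrite /F subrr.
move=> x; have xM : `|x| < `|x| + 2 by rewrite ltrDl.
have : is_derive x 1 (fun y => G (`|x| + 2) y - G (`|x| + 2) 0) (f x).
  have Mx : - (`|x| + 2) < x by have := ler_norm (- x); rewrite normrN; lra.
  by apply: (is_derive_eq (der_add (dG _ _ Mx) (der_cst _))); rewrite addr0.
apply: near_eq_is_derive.
near=> y; apply/esym/indep; first by rewrite ltrDl.
have : `|y - x| < 1 by near: y; apply/nbhs_ballP; exists 1 => //= z; rewrite /ball/= distrC.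
have := ler_normD (y - x) x; rewrite subrK; lra.
Unshelve. all: by end_near. Qed.

End calculus.

(** * Areas as iterated integrals *)

Local Open Scope ereal_scope.
Lemma integral_mrestr d (T : measurableType d) (R : realType)
    (m : {measure set T -> \bar R}) (E : set T)
    (mE : measurable E) (f : T -> \bar R) :
  measurable_fun setT f -> (forall x, 0 <= f x) ->
  \int[mrestr m mE]_x f x = \int[m]_(x in E) f x.
Proof.
move=> mf f0; rewrite -(setUv E) ge0_integral_setU//=.
- rewrite [X in _ + X]null_set_integral ?adde0//=.
  + by apply: eq_measure_integral => A mA AE; rewrite /= /mrestr setIidl.
  + exact: measurableC.
  + exact: measurable_funTS.
  + by rewrite /= /mrestr setICl measure0.
- exact: measurableC.
- exact: measurable_funTS.
- by rewrite disj_set2E setICr.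
Qed.

Local Close Scope ereal_scope.

Section uniform_image.
Local Open Scope ereal_scope.
Context d (T : measurableType d) (R : realType).
Local Notation mu := (@lebesgue_measure R).

(** Half-open intervals form a generating family stable under intersection, and each is a difference
    of two rays of finite measure. *)
Lemma ray_measure_unique (m1 m2 : {measure set (measurableTypeR R) -> \bar R}) :
  (forall b : R, m1 `]-oo, b]%classic = m2 `]-oo, b]%classic) ->
  (forall b : R, m1 `]-oo, b]%classic < +oo) ->
  forall A, measurable A -> m1 A = m2 A.
Proof.
move=> m12 fin; move=> A0 mA0; apply: (@measure_unique _ R (measurableTypeR R) (@ocitv R)
  (fun k => `](- k%:R)%R, k%:R%R]%classic) _ _ _ _ m1 m2) => //.
- exact: ocitvI.
- by move=> k; exact: is_ocitv.
- apply/seteqP; split=> // x _; exists (Num.bound `|x|) => //=.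
  have := archi_boundP (normr_ge0 x); rewrite in_itv/= => xb.
  by move: xb; rewrite ltr_norml => /andP[-> /ltW ->].
- move=> A [[a b] _ <-] /=.
  have [ab|ba] := leP a b; last by rewrite set_itv_ge ?measure0// bnd_simp -leNgt ltW.
  have -> : `]a, b]%classic = (`]-oo, b] `\` `]-oo, a])%classic.
    apply/seteqP; split=> x /=; rewrite !in_itv/=.
      by move=> /andP[ax ->]; split=> //; apply/negP; rewrite -ltNge.
    by move=> [-> /negP]; rewrite -ltNge => ->.
  have K (m : {measure set (measurableTypeR R) -> \bar R}) :
      m `]-oo, b]%classic < +oo ->
      m (`]-oo, b] `\` `]-oo, a])%classic = m `]-oo, b]%classic - m `]-oo, a]%classic.
    move=> mb; rewrite measureD//; congr (_ - m _).
    apply/seteqP; split=> x /=; rewrite !in_itv/=; first by case.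
    by move=> xa; split=> //; exact: le_trans ab.
  by rewrite !K ?m12// -m12.
- move=> k; apply: le_lt_trans (fin k%:R); apply: le_measure; rewrite ?inE//.
  by move=> x /=; rewrite !in_itv/= => /andP[].
Qed.

(** A change of variables without Jacobian: the measures of the sublevel sets determine the image of
    [m] under [phi], namely c times Lebesgue measure on the ray from a. It serves both for polar
    coordinates and for translations. *)
Lemma integral_uniform_image (m : {measure set T -> \bar R}) (D : set T)
    (phi : T -> R) (c a : R) (F : R -> \bar R) :
  measurable D -> measurable_fun setT phi -> (0 <= c)%R ->
  (forall b, m (D `&` [set x | (phi x <= b)%R]) = (c * Num.max 0 (b - a))%:E) ->
  measurable_fun setT F -> (forall x, 0 <= F x) ->
  \int[m]_(x in D) F (phi x) = c%:E * \int[mu]_(t in `[a, +oo[) F t.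
Proof.
move=> mD mphi c0 hm mF F0.
have [m1 m1P] : exists m1 : {measure set (measurableTypeR R) -> \bar R},
    m1 = pushforward (mrestr m mD) (phi : T -> measurableTypeR R)
      :> (set (measurableTypeR R) -> \bar R).
  pose m1 := [the measure (measurableTypeR R) R of
    pushforward (mrestr m mD) (phi : T -> measurableTypeR R)].
  by exists (m1 mphi).
have ma : measurable (`[a, +oo[%classic : set (measurableTypeR R)) by exact: measurable_itv.
pose m2 := [the measure (measurableTypeR R) R of mscale (NngNum c0) (mrestr mu ma)].
have mphi' : @measurable_fun _ _ T (measurableTypeR R) setT phi := mphi.
have mF' : @measurable_fun _ _ (measurableTypeR R) _ setT F := mF.
have m1E (b : R) : m1 `]-oo, b]%classic = (c * Num.max 0 (b - a))%:E.
  rewrite m1P /pushforward /mrestr -hm setIC; congr (m _).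
have m12 A : measurable A -> m1 A = m2 A.
  apply: ray_measure_unique => b; rewrite m1E ?ltry//.
  rewrite /m2/= /mscale/= /mrestr EFinM; congr (_ * _).
  have -> : (`]-oo, b] `&` `[a, +oo[ = `[a, b])%classic.
    apply/seteqP; split=> x /=; rewrite !in_itv/= ?andbT; first by case=> -> ->.
    by move=> /andP[].
  rewrite lebesgue_measure_itv/= lte_fin; case: ltP => ab.
    by rewrite -EFinB max_r// subr_ge0 ltW.
  by rewrite max_l// subr_le0.
rewrite -integral_mrestr//; last exact: measurableT_comp.
have := @ge0_integral_pushforward _ _ _ (measurableTypeR R) _ phi mphi' (mrestr m mD) setT F measurableT mF'.
rewrite preimage_setT -m1P => <-//.
transitivity (\int[m2]_y F y).
  by apply: eq_measure_integral => A mA _; exact: m12.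
rewrite ge0_integral_mscale//; congr (_ * _).
exact: (@integral_mrestr _ (measurableTypeR R)).
Qed.

End uniform_image.

Section half_disc.
Variable R : realType.
Implicit Types b x : R.

Let half b x := Num.sqrt (b - x ^+ 2).
(* [atan (x / (sqrt b + sqrt (b - x^2)))] is [asin (x / sqrt b) / 2], but is smooth
   up to the endpoints as far as continuity is concerned. *)
Let prim b x := x * half b x + 2 * b * atan (x / (Num.sqrt b + half b x)).

Let half_ge0 b x : 0 <= half b x. Proof. exact: sqrtr_ge0. Qed.

Let continuous_half b : continuous (half b).
Proof.
move=> x; apply: (@continuous_comp _ _ _ (fun x => b - x ^+ 2) Num.sqrt).
  by apply: cvgB; [exact: cvg_cst|exact: exprn_continuous].
exact: sqrt_continuous.
Qed.

Let continuous_prim b : 0 < b -> continuous (prim b).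
Proof.
move=> b0 x; have d0 : Num.sqrt b + half b x != 0.
  by rewrite gt_eqF// ltr_wpDr// sqrtr_gt0.
apply: cvgD; first by apply: cvgM; [exact: cvg_id|exact: continuous_half].
apply: cvgM; first exact: cvg_cst.
apply: (@continuous_comp _ _ _ (fun x => x / (Num.sqrt b + half b x)) atan).
  apply: cvgM; first exact: cvg_id.
  by apply: cvgV => //; apply: cvgD; [exact: cvg_cst|exact: continuous_half].
exact: continuous_atan.
Qed.

Let der_prim b x : 0 < b -> x ^+ 2 < b -> is_derive x 1 (prim b) (2 * half b x).
Proof.
move=> b0 xb; have q0 : 0 < half b x by rewrite sqrtr_gt0 subr_gt0.
have r0 : 0 < Num.sqrt b by rewrite sqrtr_gt0.
have hq : is_derive x 1 (half b) (- (2 * x) / (2 * half b x)).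
  apply: der_sqrt; last by rewrite subr_gt0.
  apply: (is_derive_eq (der_add (der_cst b) (der_opp (der_exp 2 (is_derive_id x 1))))).
  by rewrite add0r mulr1 expr1.
have hd : is_derive x 1 (fun x => Num.sqrt b + half b x) (- (2 * x) / (2 * half b x)).
  by apply: (is_derive_eq (der_add (der_cst _) hq)); rewrite add0r.
have d0 : Num.sqrt b + half b x != 0 by rewrite gt_eqF// addr_gt0.
have ha := is_derive_comp1 (der_mul (is_derive_id x 1) (der_inv hd d0))
  (is_derive1_atan (x / (Num.sqrt b + half b x))).
apply: (is_derive_eq (der_add (der_mul (is_derive_id x 1) hq)
  (der_mul (der_cst (2 * b)) ha))).
have q2 : half b x ^+ 2 = b - x ^+ 2 by rewrite sqr_sqrtr// subr_ge0 ltW.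
have r2 : Num.sqrt b ^+ 2 = b by rewrite sqr_sqrtr// ltW.
move: (half b x) (Num.sqrt b) q0 r0 q2 r2 d0 {hq hd ha} => q r q0 r0 q2 r2 d0.
have q0' : q != 0 by rewrite gt_eqF.
have r0' : r != 0 by rewrite gt_eqF.
have x2 : x ^+ 2 = r ^+ 2 - q ^+ 2 by rewrite q2 r2 subKr.
have A : 1 + (x / (r + q)) ^+ 2 = 2 * r / (r + q).
  by rewrite expr_div_n x2; field.
rewrite A -r2.
transitivity (q - x ^+ 2 / q + 2 * r ^+ 2 *
    ((1 / (r + q) + x ^+ 2 / (q * (r + q) ^+ 2)) * (2 * r / (r + q))^-1)).
  by field; rewrite d0 q0' r0'.
by rewrite x2; field; rewrite d0 q0' r0'.
Qed.

Lemma integral_half_disc b : 0 < b ->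
  (\int[lebesgue_measure]_(x in `[(- Num.sqrt b)%R, Num.sqrt b])
     (2 * Num.sqrt (b - x ^+ 2))%:E)%E = (pi * b)%:E.
Proof.
move=> b0; have r0 : 0 < Num.sqrt b by rewrite sqrtr_gt0.
have rE : - Num.sqrt b < Num.sqrt b by rewrite gtrN.
have r2 : Num.sqrt b ^+ 2 = b by rewrite sqr_sqrtr// ltW.
have cp := continuous_prim b0.
rewrite (@continuous_FTC2 R (fun x => 2 * half b x) (prim b))//.
- rewrite -EFinB; congr _%:E.
  rewrite /prim /half sqrrN r2 subrr sqrtr0 !mulr0 !addr0 !add0r mulNr divff ?gt_eqF//.
  by rewrite atanN atan1; field.
- apply: continuous_subspaceT => x; apply: cvgM; first exact: cvg_cst.
  exact: continuous_half.
- split; last 2 first.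
  + exact/cvg_at_right_filter/cp.
  + exact/cvg_at_left_filter/cp.
  move=> x; rewrite in_itv/= -ltr_norml => xr.
  have [] // := @der_prim b x b0.
  by rewrite -r2 -(real_normK (num_real x)) ltr_pXn2r// nnegrE ltW.
- move=> x; rewrite in_itv/= -ltr_norml => xr; rewrite derive1E.
  have [] // := @der_prim b x b0.
  by rewrite -r2 -(real_normK (num_real x)) ltr_pXn2r// nnegrE ltW.
Qed.

End half_disc.

Lemma integral_exp_prim (R : realType) (k : nat) (s : R) : 0 <= s ->
  (\int[lebesgue_measure]_(t in `[0%R, s]) (t ^+ k)%:E)%E = (s ^+ k.+1 / k.+1%:R)%:E.
Proof.
have h (t : R) : is_derive t 1 (fun t : R => t ^+ k.+1 / k.+1%:R) (t ^+ k).
  apply: (is_derive_eq (der_mul (der_exp k.+1 (is_derive_id t 1)) (der_cst _))).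
  by rewrite mulr0 addr0 mulr1 mulrAC mulfV ?mul1r// pnatr_eq0.
move=> s0; rewrite (integral_is_derive h)//; last exact: exprn_continuous.
by rewrite expr0n mul0r subr0.
Qed.

Section polar.
Local Open Scope ereal_scope.
Variable R : realType.
Local Notation mu := (@lebesgue_measure R).
Local Notation RR := (measurableTypeR R).

Let sqnorm2 (p : RR * RR) : R := (p.1 ^+ 2 + p.2 ^+ 2)%R.

Let measurable_sqnorm2 : measurable_fun setT sqnorm2.
Proof.
apply: measurable_funD; apply: measurable_funX.
  exact: measurable_fst.
exact: measurable_snd.
Qed.

Let disc_area (b : R) :
  (mu \x mu) [set p | (sqnorm2 p <= b)%R] = (pi * Num.max 0 (b - 0))%:E.
Proof.
rewrite /product_measure1 subr0.
have sec x : (mu \o xsection [set p | (sqnorm2 p <= b)%R]) x =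
    (2 * Num.sqrt (b - x ^+ 2))%:E.
  rewrite /=; set q := (b - x ^+ 2)%R.
  have [q0|q0] := ltP q 0%R.
    rewrite ler0_sqrtr ?ltW// mulr0.
    rewrite (_ : xsection _ _ = set0) ?measure0//.
    apply/seteqP; split=> y //; rewrite xsectionP /= /sqnorm2 /= => h.
    have := sqr_ge0 y; move: q0 h; rewrite /q; lra.
  rewrite (_ : xsection _ _ = `[(- Num.sqrt q)%R, Num.sqrt q]%classic).
    rewrite lebesgue_measure_itv /= lte_fin.
    have := sqrtr_ge0 q; rewrite le_eqVlt => /predU1P[<-|r0].
      by rewrite oppr0 ltxx mulr0.
    by rewrite gtrN// -EFinB; congr _%:E; lra.
  apply/seteqP; split=> y; rewrite xsectionP /= /sqnorm2 /= in_itv/= -ler_norml.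
    by move=> h; rewrite -sqrtr_sqr ler_sqrt//; rewrite /q; lra.
  rewrite -sqrtr_sqr ler_sqrt// /q; lra.
rewrite (eq_integral (fun x : RR => (2 * Num.sqrt (b - (x : R) ^+ 2))%:E)) => [|x _]; last exact: sec.
have [b0|b0] := ltP 0%R b; last first.
  rewrite mulr0 integral0_eq// => x _.
  by rewrite ler0_sqrtr ?mulr0// subr_le0 (le_trans b0)// sqr_ge0.
rewrite -integral_half_disc//.
rewrite [RHS]integral_mkcond; apply: eq_integral => x _; rewrite /patch mem_setE.
case: ifPn => //; rewrite in_itv/= -ler_norml -ltNge => xb.
rewrite ler0_sqrtr ?mulr0// subr_le0 -(sqr_sqrtr (ltW b0)).
by rewrite -(real_normK (num_real x)) ler_pXn2r ?nnegrE// ?ltW// sqrtr_ge0.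
Qed.

(** Discs of squared radius b have area pi b, so the squared norm pushes plane measure to pi times
    Lebesgue measure on the half-line. No angular variable is introduced. *)
Lemma integral_polar (H : R -> \bar R) :
  measurable_fun setT H -> (forall t, 0 <= H t) ->
  \int[mu]_x \int[mu]_y H (x ^+ 2 + y ^+ 2)%R =
  (pi : R)%:E * \int[mu]_(t in `[0%R, +oo[) H t.
Proof.
move=> mH H0.
have mHs : measurable_fun setT (H \o sqnorm2).
  exact: (measurableT_comp mH measurable_sqnorm2).
rewrite -(@fubini_tonelli1 _ _ RR RR R mu mu (H \o sqnorm2) mHs (fun p => H0 _)).
apply: (@integral_uniform_image _ _ R (mu \x mu) setT sqnorm2) => //.
- exact: pi_ge0.
- by move=> b; rewrite setTI; exact: disc_area.
Qed.

Lemma integral_shift (H : R -> \bar R) (t : R) :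
  measurable_fun setT H -> (forall t, 0 <= H t) ->
  \int[mu]_(s in `[0%R, +oo[) H (s + t)%R = \int[mu]_(s in `[t, +oo[) H s.
Proof.
move=> mH H0; rewrite -[RHS]mul1e.
apply: (@integral_uniform_image _ RR R mu _ (fun s => s + t)%R) => //.
  by apply: measurable_funD => //; exact: measurable_cst.
move=> b; rewrite mul1r.
have -> : (`[0%R, +oo[ `&` [set x | (x + t <= b)%R])%classic = `[0%R, (b - t)%R]%classic.
  apply/seteqP; split=> x /=; rewrite !in_itv/= ?andbT lerBrDr; first by case=> -> ->.
  by move=> /andP[].
have E := @lebesgue_measure_itv R `[0%R, (b - t)%R].
rewrite [LHS]E/= lte_fin; case: ltP => bt.
  by rewrite sube0.
by [].
Qed.

(** Translating the variable s by t turns the quadrant into the triangle 0 <= t <= s. Exchanging the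
    integrals there leaves the integral of t^k over [0, s]. Tonelli is used once before and once
    after the translation. *)
Lemma integral_triangle (k : nat) (H : R -> \bar R) :
  measurable_fun setT H -> (forall t, 0 <= H t) ->
  \int[mu]_(s in `[0%R, +oo[) \int[mu]_(t in `[0%R, +oo[) (H (s + t)%R * (t ^+ k)%:E) =
  (k.+1%:R^-1)%:E * \int[mu]_(s in `[0%R, +oo[) (H s * (s ^+ k.+1)%:E).
Proof.
move=> mH H0.
pose f (p : RR * RR) : \bar R :=
  if (0 <= p.1)%R && (0 <= p.2)%R then H (p.1 + p.2)%R * (p.2 ^+ k)%:E else 0.
pose g (p : RR * RR) : \bar R :=
  if (0 <= p.1)%R && (p.1 <= p.2)%R then H p.2 * (p.1 ^+ k)%:E else 0.
have m1 : measurable_fun setT (fun p : RR * RR => p.1 : R) by exact: measurable_fst.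
have m2 : measurable_fun setT (fun p : RR * RR => p.2 : R) by exact: measurable_snd.
have mX (h : RR * RR -> R) : measurable_fun setT h ->
    measurable_fun setT (fun p => (h p ^+ k)%:E).
  move=> mh; apply/measurable_EFinP.
  exact: measurable_funX.
have mf : measurable_fun setT f.
  apply: measurable_fun_ifT => //.
    by apply: measurable_and; apply: measurable_fun_ler => //; exact: measurable_cst.
  apply: emeasurable_funM; last exact: mX.
  by apply: (measurableT_comp mH); exact: measurable_funD.
have mg : measurable_fun setT g.
  apply: measurable_fun_ifT => //.
    by apply: measurable_and; apply: measurable_fun_ler => //; exact: measurable_cst.
  by apply: emeasurable_funM; [exact: (measurableT_comp mH)|exact: mX].
have f0 p : 0 <= f p.
  by rewrite /f; case: ifPn => // /andP[_ h]; rewrite mule_ge0// lee_fin exprn_ge0.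
have g0 p : 0 <= g p.
  by rewrite /g; case: ifPn => // /andP[h _]; rewrite mule_ge0// lee_fin exprn_ge0.
transitivity (\int[mu]_s \int[mu]_t f (s, t)).
  rewrite integral_mkcond; apply: eq_integral => s _; rewrite /patch mem_setE in_itv/= andbT.
  rewrite /f /=; case: ifPn => s0; last by rewrite integral0.
  rewrite integral_mkcond; apply: eq_integral => t _; rewrite /patch mem_setE in_itv/= andbT.
  by [].
rewrite (@fubini_tonelli _ _ RR RR R mu mu f mf f0).
transitivity (\int[mu]_t \int[mu]_s g (t, s)).
  apply: eq_integral => t _; have [t0|t0] := leP 0%R t; last first.
    rewrite [LHS]integral0_eq => [|s _]; last by rewrite /f /= [(0 <= t)%R]leNgt t0 andbF.
    by rewrite integral0_eq// => s _; rewrite /g /= leNgt t0.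
  pose h (s : R) : \bar R := H s * (t ^+ k)%:E.
  have mh : measurable_fun setT h.
    by apply: emeasurable_funM => //; exact: measurable_cst.
  have h0 s : 0 <= h s by rewrite /h mule_ge0// lee_fin exprn_ge0.
  transitivity (\int[mu]_(s in `[0%R, +oo[) h (s + t)%R).
    rewrite [RHS]integral_mkcond; apply: eq_integral => s _.
    by rewrite /patch mem_setE in_itv/= andbT /f /= t0 andbT.
  rewrite integral_shift// integral_mkcond; apply: eq_integral => s _.
  by rewrite /patch mem_setE in_itv/= andbT /g /= t0.
rewrite (@fubini_tonelli _ _ RR RR R mu mu g mg g0).
have mHk : measurable_fun (`[0%R, +oo[%classic : set R) (fun s : R => H s * (s ^+ k.+1)%:E).
  apply: measurable_funTS; apply: emeasurable_funM => //.
  by apply/measurable_EFinP; exact: exprn_measurable.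
have Hk0 (s : R) : (`[0%R, +oo[%classic : set R) s -> 0 <= H s * (s ^+ k.+1)%:E.
  by rewrite /= in_itv/= andbT => s0; rewrite mule_ge0// lee_fin exprn_ge0.
rewrite -ge0_integralZl_EFin//.
rewrite [RHS]integral_mkcond; apply: eq_integral => s _.
rewrite /patch mem_setE in_itv/= andbT; case: ifPn => s0; last first.
  rewrite integral0_eq// => t _; rewrite /g /=; case: ifPn => // /andP[h1 h2].
  by rewrite (le_trans h1 h2) in s0.
transitivity (\int[mu]_(t in `[0%R, s]) (H s * (t ^+ k)%:E)).
  rewrite [RHS]integral_mkcond; apply: eq_integral => t _.
  by rewrite /patch mem_setE in_itv.
have mk : measurable_fun (`[0%R, s]%classic : set R) (fun t : R => (t ^+ k)%:E).
  by apply: measurable_funTS; apply/measurable_EFinP; exact: exprn_measurable.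
have k0 (t : R) : (`[0%R, s]%classic : set R) t -> 0 <= (t ^+ k)%:E.
  by rewrite /= in_itv/= => /andP[t0 _]; rewrite lee_fin exprn_ge0.
rewrite ge0_integralZl//.
by rewrite integral_exp_prim// muleCA -EFinM mulrC.
Qed.

End polar.

Definition sqnorm (R : realType) (m : nat) (x : 'rV[R]_m) : R := \sum_i x 0 i ^+ 2.

Lemma sqnorm_row_mx (R : realType) (m : nat) (x : R) (t : 'rV[R]_m) :
  sqnorm (row_mx (const_mx x : 'rV[R]_1) t) = x ^+ 2 + sqnorm t.
Proof.
rewrite /sqnorm big_split_ord /= big_ord1 row_mxEl mxE; congr (_ + _).
by apply: eq_bigr => i _; rewrite row_mxEr.
Qed.

Section radial_integration.
Local Open Scope ereal_scope.
Variable R : realType.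
Local Notation mu := (@lebesgue_measure R).

Let iterated_integral_SS (m : nat) (F G : R -> \bar R) :
  (forall a : R, iterated_integral (fun t : 'rV[R]_m => F (a + sqnorm t)%R) = G a) ->
  iterated_integral (fun t : 'rV[R]_m.+2 => F (sqnorm t)) =
  \int[mu]_x \int[mu]_y G (x ^+ 2 + y ^+ 2)%R.
Proof.
move=> FG; rewrite /=; apply: eq_integral => x _; apply: eq_integral => y _.
rewrite -FG; congr iterated_integral; apply/funext => t; congr F.
by rewrite (sqnorm_row_mx (m := m.+1)) (sqnorm_row_mx (m := m)) addrA.
Qed.

Let measurable_shift_integral (k : nat) (F : R -> \bar R) :
  measurable_fun setT F -> (forall t, 0 <= F t) ->
  measurable_fun setT
    (fun a : R => \int[mu]_(t in `[0%R, +oo[) (F (a + t)%R * (t ^+ k)%:E)).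
Proof.
move=> mF F0.
pose f (p : measurableTypeR R * measurableTypeR R) : \bar R :=
  if (0 <= p.2)%R then F (p.1 + p.2)%R * (p.2 ^+ k)%:E else 0.
have m1 : measurable_fun setT (fun p : measurableTypeR R * measurableTypeR R => p.1 : R).
  exact: measurable_fst.
have m2 : measurable_fun setT (fun p : measurableTypeR R * measurableTypeR R => p.2 : R).
  exact: measurable_snd.
have mf : measurable_fun setT f.
  apply: measurable_fun_ifT => //.
    by apply: measurable_fun_ler => //; exact: measurable_cst.
  apply: emeasurable_funM; last by apply/measurable_EFinP; exact: measurable_funX.
  by apply: (measurableT_comp mF); exact: measurable_funD.
have f0 p : 0 <= f p.
  by rewrite /f; case: ifPn => // h; rewrite mule_ge0// lee_fin exprn_ge0.
have := @measurable_fun_fubini_tonelli_F _ _ (measurableTypeR R) (measurableTypeR R) R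
  mu f mf f0.
congr measurable_fun; apply/funext => a; rewrite /fubini_F [RHS]integral_mkcond.
by apply: eq_integral => t _; rewrite /patch mem_setE in_itv/= andbT.
Qed.

(** Induction by two dimensions. The inner variables contribute pi^(k+1) / k! t^k dt, the two new
    ones pi dt, and the sum of the two squared norms is handled by [integral_triangle], which
    supplies the next factor of the factorial. *)
Lemma iterated_integral_radial (k m : nat) (F : R -> \bar R) :
  m = (2 * k.+1)%N -> measurable_fun setT F -> (forall t, 0 <= F t) ->
  iterated_integral (fun t : 'rV[R]_m => F (sqnorm t)) =
  (pi ^+ k.+1 / k`!%:R)%:E * \int[mu]_(t in `[0%R, +oo[) (F t * (t ^+ k)%:E).
Proof.
elim: k m F => [|k IH] m F mE mF F0.
  rewrite {}mE (iterated_integral_SS (m := 0) (G := F)); last first.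
    by move=> a; rewrite /= /sqnorm big_ord0 addr0.
  rewrite integral_polar// divr1 expr1; congr (_ * _).
  by apply: eq_integral => t _; rewrite expr0 mule1.
case: m mE => [|[|m]] mE; [by lia|by lia|].
have {}mE : m = (2 * k.+1)%N by lia.
pose G (a : R) := (pi ^+ k.+1 / k`!%:R)%:E *
  \int[mu]_(t in `[0%R, +oo[) (F (a + t)%R * (t ^+ k)%:E).
have C0 : 0 <= (pi ^+ k.+1 / k`!%:R : R)%:E.
  by rewrite lee_fin divr_ge0// exprn_ge0// pi_ge0.
rewrite (iterated_integral_SS (G := G)); last first.
  move=> a; apply: (IH m (fun s => F (a + s)%R)) => //.
  by apply: (measurableT_comp mF); apply: measurable_funD => //; exact: measurable_cst.
have mS := measurable_shift_integral k mF F0.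
have S0 (a : R) : 0 <= \int[mu]_(t in `[0%R, +oo[) (F (a + t)%R * (t ^+ k)%:E).
  apply: integral_ge0 => t; rewrite /= in_itv/= andbT => t0.
  by rewrite mule_ge0// lee_fin exprn_ge0.
rewrite integral_polar//; last 2 first.
- by apply: measurable_funeM.
- by move=> a; rewrite mule_ge0.
rewrite /G ge0_integralZl//; last exact: measurable_funTS.
rewrite integral_triangle// !muleA -!EFinM; congr (_%:E * _).
rewrite factS natrM invfM (exprS _ k.+1).
move: (pi ^+ k.+1)%R (k`!%:R^-1)%R (k.+1%:R^-1)%R => p f g.
by ring.
Qed.

End radial_integration.

(** * Rotational hypersurfaces in Minkowski space *)

Section minkowski_form.
Variables (R : realType) (m : nat).
Implicit Types x y z : 'rV[R]_m.+2.

Lemma minkowskiC x y : minkowski x y = minkowski y x.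
Proof.
rewrite /minkowski mulrC; congr (_ - _).
by apply: eq_bigr => i _; rewrite mulrC.
Qed.

Lemma minkowskiDl x y z : minkowski (x + y) z = minkowski x z + minkowski y z.
Proof.
rewrite /minkowski !mxE; have -> : \sum_(i | i != ord_max) (x + y) 0 i * z 0 i =
    \sum_(i | i != ord_max) x 0 i * z 0 i + \sum_(i | i != ord_max) y 0 i * z 0 i.
  by rewrite -big_split; apply: eq_bigr => i _; rewrite mxE mulrDl.
ring.
Qed.

Lemma minkowskiZl (a : R) x y : minkowski (a *: x) y = a * minkowski x y.
Proof.
rewrite /minkowski !mxE mulrBr mulr_sumr mulrA; congr (_ - _).
by apply: eq_bigr => i _; rewrite mxE mulrA.
Qed.

Lemma minkowskiDr x y z : minkowski z (x + y) = minkowski z x + minkowski z y.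
Proof. by rewrite minkowskiC minkowskiDl !(minkowskiC z). Qed.

Lemma minkowskiZr (a : R) x y : minkowski y (a *: x) = a * minkowski y x.
Proof. by rewrite minkowskiC minkowskiZl (minkowskiC y). Qed.

Lemma minkowski0l x : minkowski 0 x = 0.
Proof. by rewrite -(scale0r (0 : 'rV[R]_m.+2)) minkowskiZl mul0r. Qed.

Lemma minkowski_suml (I : Type) (r : seq I) (P : pred I) (F : I -> 'rV[R]_m.+2) y :
  minkowski (\sum_(i <- r | P i) F i) y = \sum_(i <- r | P i) minkowski (F i) y.
Proof.
elim/big_rec2: _ => [|i a b _ <-]; first exact: minkowski0l.
exact: minkowskiDl.
Qed.

Lemma minkowski_deltal (k : 'I_m.+2) x : k != ord_max ->
  minkowski (delta_mx 0 k) x = x 0 k.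
Proof.
move=> km; rewrite /minkowski (bigD1 k)//= big1 => [|i /andP[_ ik]].
  by rewrite !mxE !eqxx (negbTE (_ : ord_max != k)) 1?eq_sym// mul0r mul1r subr0 addr0.
by rewrite !mxE (negbTE ik) andbF mul0r.
Qed.

Lemma minkowski_delta_max x : minkowski (delta_mx 0 ord_max) x = - x 0 ord_max.
Proof.
rewrite /minkowski big1 => [|i im]; first by rewrite !mxE !eqxx mul1r sub0r.
by rewrite !mxE (negbTE im) andbF mul0r.
Qed.

Variable sigma : 'I_m -> 'I_m.+2.
Hypothesis sigma_inj : injective sigma.
Hypothesis sigma_max : forall i, sigma i != ord_max.

Definition coordinate_embedding (x : 'rV[R]_m) : 'rV[R]_m.+2 :=
  \sum_i x 0 i *: delta_mx 0 (sigma i).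
Local Notation emb := coordinate_embedding.

Lemma coordinate_embeddingE (x : 'rV[R]_m) i : emb x 0 (sigma i) = x 0 i.
Proof.
rewrite /emb summxE (bigD1 i)//= big1 => [|j ji].
  by rewrite !mxE !eqxx mulr1 addr0.
by rewrite !mxE (inj_eq sigma_inj) eq_sym (negbTE ji) andbF mulr0.
Qed.

Lemma coordinate_embedding_out (x : 'rV[R]_m) k :
  (forall i, sigma i != k) -> emb x 0 k = 0.
Proof.
move=> h; rewrite /emb summxE big1// => j _.
by rewrite !mxE eq_sym (negbTE (h j)) andbF mulr0.
Qed.

Lemma minkowski_embl (x : 'rV[R]_m) y : minkowski (emb x) y = \sum_i x 0 i * y 0 (sigma i).
Proof.
rewrite minkowski_suml; apply: eq_bigr => i _.
by rewrite minkowskiZl minkowski_deltal.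
Qed.

End minkowski_form.

Section radial_maps.
Variables (R : realType) (m : nat) (sigma : 'I_m -> 'I_m.+2).
Hypothesis sigma_inj : injective sigma.
Hypothesis sigma_max : forall i, sigma i != ord_max.
Local Notation emb := (coordinate_embedding sigma).

Definition radial (a : R -> R) (g : R -> 'rV[R]_m.+2) (x : 'rV[R]_m) : 'rV[R]_m.+2 :=
  a (sqnorm x) *: emb x + g (sqnorm x).

Lemma der_sqnorm (x : 'rV[R]_m) (i : 'I_m) :
  is_derive x (delta_mx 0 i) (@sqnorm R m) (2 * x 0 i).
Proof.
have -> : @sqnorm R m = \sum_(j < m) (fun y : 'rV[R]_m => y 0 j ^+ 2).
  by apply/funext => y; rewrite fct_sumE.
apply: (is_derive_eq (is_derive_sum (fun j => der_exp 2 (is_derive_coord x _ j)))).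
rewrite (bigD1 i)//= big1 => [|j ji]; first by rewrite mxE !eqxx mulr1 addr0 expr1.
by rewrite mxE (negbTE ji) andbF mulr0.
Qed.

Lemma der_radial (a : R -> R) (g : R -> 'rV[R]_m.+2) (x : 'rV[R]_m) (i : 'I_m)
    (da : R) (dg : 'rV[R]_m.+2) :
  is_derive (sqnorm x) 1 a da ->
  (forall k, is_derive (sqnorm x) 1 (fun t => g t 0 k) (dg 0 k)) ->
  is_derive x (delta_mx 0 i) (radial a g)
    (a (sqnorm x) *: delta_mx 0 (sigma i) + (2 * x 0 i) *: (da *: emb x + dg)).
Proof.
move=> ha hg; apply: is_derive_mx => j k; rewrite (ord1 j).
have he : is_derive x (delta_mx 0 i) (fun y => emb y 0 k) ((delta_mx 0 (sigma i) : 'rV[R]_m.+2) 0 k).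
  have [[l <-]|hk] := pselect (exists l, sigma l = k).
    have -> : (fun y : 'rV[R]_m => emb y 0 (sigma l)) = (fun y => y 0 l).
      by apply/funext => y; rewrite coordinate_embeddingE.
    apply: (is_derive_eq (is_derive_coord x _ l)).
    by rewrite !mxE (inj_eq sigma_inj).
  have hk' l : sigma l != k by apply/eqP => E; apply: hk; exists l.
  have -> : (fun y : 'rV[R]_m => emb y 0 k) = (fun=> 0).
    by apply/funext => y; rewrite coordinate_embedding_out.
  apply: (is_derive_eq (der_cst 0)).
  by rewrite mxE eq_sym (negbTE (hk' i)) andbF.
have -> : (fun y => radial a g y 0 k) =
    (fun y => a (sqnorm y) * emb y 0 k + g (sqnorm y) 0 k).
  by apply/funext => y; rewrite !mxE.
have ds := der_sqnorm x i.
apply: (is_derive_eq (der_add (der_mul (is_derive_comp1 ds ha) he) (is_derive_comp1 ds (hg k)))).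
by rewrite !mxE /=; ring.
Qed.

(** Each partial derivative is a multiple of its own coordinate vector plus 2 x_i times a vector
    common to all i, hence a scalar matrix plus one of rank one. The condition on [dg] says that g
    moves in the plane orthogonal to the embedded space. *)
Lemma first_fundamental_form_radial (a : R -> R) (g : R -> 'rV[R]_m.+2) (x : 'rV[R]_m)
    (da : R) (dg : 'rV[R]_m.+2) :
  is_derive (sqnorm x) 1 a da ->
  (forall k, is_derive (sqnorm x) 1 (fun t => g t 0 k) (dg 0 k)) ->
  (forall i, dg 0 (sigma i) = 0) ->
  first_fundamental_form (radial a g) x =
    (a (sqnorm x) ^+ 2)%:M +
    (4 * (a (sqnorm x) * da + sqnorm x * da ^+ 2 + minkowski dg dg)) *: (x^T *m x).
Proof.
move=> ha hg g0; apply/matrixP => i j; rewrite !mxE big_ord1 !mxE /partial.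
have [_ ->] := der_radial i ha hg.
have [_ ->] := der_radial j ha hg.
have K1 y l : minkowski y (delta_mx 0 (sigma l)) = y 0 (sigma l).
  by rewrite minkowskiC minkowski_deltal.
have K2 y l : minkowski (delta_mx 0 (sigma l)) y = y 0 (sigma l).
  exact: minkowski_deltal.
have K3 : minkowski (emb x) dg = 0.
  by rewrite minkowski_embl// big1// => l _; rewrite g0 mulr0.
have K4 : minkowski (emb x) (emb x) = sqnorm x.
  rewrite minkowski_embl//; apply: eq_bigr => l _.
  by rewrite coordinate_embeddingE.
rewrite !(minkowskiDl, minkowskiDr, minkowskiZl, minkowskiZr) !(K1, K2) (minkowskiC dg) K3 K4.
rewrite !g0 !coordinate_embeddingE// mxE eqxx (inj_eq sigma_inj) (eq_sym j i) /=.
by case: eqVneq => _ /=; ring.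
Qed.

End radial_maps.

Lemma der_minkowski (R : realType) (m : nat) (V : normedModType R)
    (f g : V -> 'rV[R]_m.+2) (x v : V) (df dg : 'rV[R]_m.+2) :
  is_derive x v f df -> is_derive x v g dg ->
  is_derive x v (fun y => minkowski (f y) (g y)) (minkowski df (g x) + minkowski (f x) dg).
Proof.
have coord (h : V -> 'rV[R]_m.+2) dh i : is_derive x v h dh ->
    is_derive x v (fun y => h y 0 i) (dh 0 i).
  move=> [hd <-]; split; first by have /derivable_mxP := hd; apply.
  by rewrite derive_mx// mxE.
move=> hf hg.
have hm i := der_mul (coord _ _ i hf) (coord _ _ i hg).
have hs (s : seq 'I_m.+2) (P : pred 'I_m.+2) :
    is_derive x v (fun y => \sum_(i <- s | P i) f y 0 i * g y 0 i)
      (\sum_(i <- s | P i) (df 0 i * g x 0 i + f x 0 i * dg 0 i)).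
  elim: s => [|i s IH].
    under eq_fun do rewrite big_nil.
    by rewrite big_nil; exact: der_cst.
  under eq_fun do rewrite big_cons.
  by rewrite big_cons; case: (P i) => //; exact: der_add.
apply: (is_derive_eq (der_add (hs _ (fun i => i != ord_max)) (der_opp (hm ord_max)))).
by rewrite /minkowski big_split /=; ring.
Qed.

Section hypersurface_geometry.
Variables (R : realType) (m : nat) (phi nu : 'rV[R]_m -> 'rV[R]_m.+2).
Implicit Types x : 'rV[R]_m.

(** A linear relation between the partial derivatives is also one between the rows of the Gram
    matrix. This needs no positivity, so it holds for the indefinite Minkowski form. *)
Lemma gram_row_free x : \det (first_fundamental_form phi x) != 0 ->
  row_free (\matrix_(i < m) partial i phi x).
Proof.
move=> d0; have uI : first_fundamental_form phi x \in unitmx by rewrite unitmxE unitfE.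
set J := (X in row_free X); rewrite -kermx_eq0; apply/eqP/row_matrixP => k; rewrite row0.
have vJ : row k (kermx J) *m J = 0 by apply/sub_kermxP; exact: row_sub.
move: (row k (kermx J)) vJ => v vJ.
suff E : v *m first_fundamental_form phi x = 0.
  by rewrite -(mulmxK uI v) E mul0mx.
apply/rowP => j; rewrite mxE [RHS]mxE.
transitivity (minkowski (v *m J) (partial j phi x)); last by rewrite vJ minkowski0l.
rewrite mulmx_sum_row minkowski_suml; apply: eq_bigr => i _.
by rewrite minkowskiZl rowK mxE.
Qed.

(* Differentiating the orthogonality relations gives II = - W g. *)
Lemma mean_curvature_eq0 (U : set 'rV[R]_m) (W : 'M[R]_m) x :
  open U -> U x ->
  (forall y, U y -> forall j, minkowski (partial j phi y) (nu y) = 0) ->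
  (forall i j, derivable (partial j phi) x (delta_mx 0 i)) ->
  (forall i, is_derive x (delta_mx 0 i) nu (\sum_k W i k *: partial k phi x)) ->
  \det (first_fundamental_form phi x) != 0 -> \tr W = 0 ->
  mean_curvature phi x (nu x) = 0.
Proof.
move=> oU Ux orth dphi dnu d0 trW.
have uI : first_fundamental_form phi x \in unitmx by rewrite unitmxE unitfE.
have II : second_fundamental_form phi x (nu x) = - (W *m first_fundamental_form phi x).
  apply/matrixP => i j; rewrite !mxE.
  have h1 : is_derive x (delta_mx 0 i) (partial j phi) (partial i (partial j phi) x).
    by split=> //; exact: dphi.
  have [_ h2] := der_minkowski h1 (dnu i).
  have : 'D_(delta_mx 0 i) (fun y => minkowski (partial j phi y) (nu y)) x = 0.
    rewrite (@near_eq_derive _ _ _ _ (fun=> 0)) ?derive_cst//.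
    move: (open_nbhs_nbhs (conj oU Ux)); apply: (@filterS _ (nbhs x) (nbhs_filter x)) => y Uy.
    exact: orth.
  rewrite h2 => /eqP; rewrite addr_eq0 => /eqP ->; congr (- _).
  rewrite minkowskiC minkowski_suml; apply: eq_bigr => k _.
  by rewrite minkowskiZl mxE.
rewrite /mean_curvature II mulmxN raddfN /= mxtrace_mulC -mulmxA mulmxV// mulmx1 trW.
exact: oppr0.
Qed.

End hypersurface_geometry.

(** * The punctured space and proper maps *)

Section punctured_space.
Variables (R : realType) (m : nat).
Implicit Types x e : 'rV[R]_m.

Lemma sqnorm_ge0 x : 0 <= sqnorm x.
Proof. by apply: sumr_ge0 => i _; exact: sqr_ge0. Qed.

Lemma sqnorm_eq0 x : (sqnorm x == 0) = (x == 0).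
Proof.
apply/idP/eqP => [|->]; last by rewrite /sqnorm big1// => i _; rewrite mxE expr0n.
rewrite psumr_eq0 => [/allP h|i _]; last exact: sqr_ge0.
apply/rowP => i; rewrite mxE; apply/eqP; rewrite -sqrf_eq0.
exact: (h i (mem_index_enum i)).
Qed.

Lemma sqnorm_gt0 x : (0 < sqnorm x) = (x != 0).
Proof. by rewrite lt_def sqnorm_ge0 andbT sqnorm_eq0. Qed.

Lemma sqnormZ (a : R) x : sqnorm (a *: x) = a ^+ 2 * sqnorm x.
Proof.
by rewrite /sqnorm mulr_sumr; apply: eq_bigr => i _; rewrite mxE exprMn.
Qed.

Definition coordinates : set ('rV[R]_m -> R) :=
  [set f | exists i, f = fun x => x 0 i].

Lemma generated_sqnorm : generated coordinates (@sqnorm R m).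
Proof.
by apply: generated_sum => i; apply/generated_exp/generated_in; exists i.
Qed.

Lemma continuous_sqnorm : continuous (@sqnorm R m).
Proof.
have h : {in [set: 'rV[R]_m], continuous (@sqnorm R m)}.
  apply: (@generated_continuous _ _ _ coordinates); last exact: generated_sqnorm.
  by move=> _ [i ->] y _; exact: coord_continuous.
by move=> x; apply: h; exact: mem_set.
Qed.

Definition punctured : set 'rV[R]_m := [set x | 0 < sqnorm x].

Lemma open_punctured : open punctured.
Proof.
have -> : punctured = @sqnorm R m @^-1` [set t | 0 < t] by [].
apply: open_comp; [by move=> x _; exact: continuous_sqnorm|exact: (@open_gt R 0)].
Qed.

Let away e : set 'rV[R]_m := [set x | forall a, 0 <= a -> x != - a *: e].

Let star e : set 'rV[R]_m :=
  \bigcup_(x in away e) ((fun t : R => (1 - t) *: e + t *: x) @` `[0, 1]).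

Let star_connected e : e != 0 -> connected (star e).
Proof.
move=> e0; apply: bigcup_connected.
  exists e => x _; exists 0; first by rewrite /= in_itv/= lexx ler01.
  by rewrite subr0 scale1r scale0r addr0.
move=> x _; apply: connected_continuous_connected; first exact: segment_connected.
apply: continuous_subspaceT => t.
apply: cvgD; apply: cvgZr_tmp; last exact: cvg_id.
by apply: cvgB; [exact: cvg_cst|exact: cvg_id].
Qed.

Let star_away e x : away e x -> star e x.
Proof.
move=> h; exists x => //; exists 1; first by rewrite /= in_itv/= lexx ler01.
by rewrite subrr scale0r scale1r add0r.
Qed.

Let star_punctured e : e != 0 -> star e `<=` punctured.
Proof.
move=> e0 y [x hx [t ht <-]]; move: ht; rewrite /= in_itv/= => /andP[t0 t1].
rewrite /punctured /= sqnorm_gt0; apply/eqP => E.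
have := t0; rewrite le_eqVlt => /predU1P[t00|{}t0].
  by move: E; rewrite -t00 subr0 scale1r scale0r addr0 => /eqP; rewrite (negbTE e0).
have h0 : 0 <= (1 - t) / t by rewrite divr_ge0 ?subr_ge0// ltW.
have /eqP := hx _ h0; apply.
have tU : t != 0 by rewrite gt_eqF.
apply: (scalerI tU); rewrite scalerA mulrN mulrCA divff// mulr1 scaleNr.
by apply/eqP; rewrite -addr_eq0 addrC E.
Qed.

(** The complement of a closed half-line from the origin is star-shaped. Two such complements, for
    the half-lines opposite to two coordinate vectors, cover the punctured space and share the sum
    of these vectors. *)
Lemma connected_punctured : (1 < m)%N -> connected punctured.
Proof.
move=> m1; pose i0 : 'I_m := Ordinal (ltn_trans (ltnSn 0) m1); pose i1 : 'I_m := Ordinal m1.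
pose e0 : 'rV[R]_m := delta_mx 0 i0; pose e1 : 'rV[R]_m := delta_mx 0 i1.
have e00 : e0 != 0.
  by apply/eqP => /rowP /(_ i0); rewrite !mxE !eqxx => /eqP; rewrite oner_eq0.
have e10 : e1 != 0.
  by apply/eqP => /rowP /(_ i1); rewrite !mxE !eqxx => /eqP; rewrite oner_eq0.
have -> : punctured = star e0 `|` star e1.
  apply/seteqP; split=> x; last by case; exact: star_punctured.
  rewrite /punctured /= sqnorm_gt0 => x0.
  have [h|h] := pselect (away e0 x); first by left; exact: star_away.
  right; apply: star_away => b b0; apply/eqP => xb; apply: h => a a0; apply/eqP => xa.
  move: xb; rewrite xa => /rowP /(_ i0); rewrite !mxE !eqxx mulr1 mulr0 => /eqP.
  rewrite oppr_eq0 => /eqP a00.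
  by move: x0; rewrite xa a00 oppr0 scale0r eqxx.
apply: connectedU; [|exact: star_connected|exact: star_connected].
exists (e0 + e1); split; apply: star_away => a a0; apply/eqP => /rowP.
  by move=> /(_ i1); rewrite !mxE !eqxx /= mulr0 add0r => /eqP; rewrite oner_eq0.
by move=> /(_ i0); rewrite !mxE !eqxx /= mulr0 addr0 => /eqP; rewrite oner_eq0.
Qed.

Lemma annulus_compact (a b : R) (C : set 'rV[R]_m) : closed C ->
  compact (C `&` [set x | a <= sqnorm x <= b]).
Proof.
move=> cC; apply: bounded_closed_compact.
  exists (b + 1); split; first exact: num_real.
  move=> M bM x [_ /= /andP[_ xb]].
  rewrite [leLHS]/Num.Def.normr/= mx_normrE; apply/bigmax_leP.
  have b0 := le_trans (sqnorm_ge0 x) xb.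
  split=> [|[i j] _ /=]; first by lra.
  have h : x i j ^+ 2 <= b.
    apply: le_trans xb; rewrite (ord1 i) /sqnorm (bigD1 j)//= lerDl.
    by apply: sumr_ge0 => k _; exact: sqr_ge0.
  by rewrite ler_norml; apply/andP; split; nra.
apply: closedI => //.
have -> : [set x | a <= sqnorm x <= b] = @sqnorm R m @^-1` `[a, b].
  by apply/seteqP; split=> x /=; rewrite in_itv.
by apply: closed_comp; [move=> x _; exact: continuous_sqnorm|exact: itv_closed].
Qed.

End punctured_space.

Section proper_maps.
Variables (R : realType) (m p : nat) (phi : 'rV[R]_m -> 'rV[R]_p) (j : 'I_p).
Local Notation U := (punctured (R := R) (m := m)).
Hypothesis cphi : {in U, continuous phi}.
Hypothesis proper : forall B, exists a b, 0 < a /\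
  forall x, U x -> phi x 0 j <= B -> a <= sqnorm x <= b.

(** Near an adherent point the coordinate [j] is bounded, so only a compact annulus contributes to
    the image, and the image of a compact set is closed. *)
Lemma proper_closed (C : set 'rV[R]_m) : closed C -> closed (phi @` (U `&` C)).
Proof.
move=> cC y hy; have [a [b [a0 hab]]] := proper (y 0 j + 1).
pose K := C `&` [set x | a <= sqnorm x <= b].
have KU : K `<=` U by move=> x [_ /= /andP[ax _]]; exact: lt_le_trans ax.
have cK : closed (phi @` K).
  apply: compact_closed; first exact: norm_hausdorff.
  apply: continuous_compact; last exact: annulus_compact.
  apply/continuous_in_subspaceT => x /set_mem Kx; apply: cphi.
  exact/mem_set/KU.
suff : (phi @` K) y by move=> [x [Cx Kx] <-]; exists x => //; split=> //; exact: KU.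
apply: cK => N hN.
have hB : nbhs y [set y' : 'rV[R]_p | y' 0 j < y 0 j + 1].
  have := @coord_continuous R 1 p 0 j y; move=> /(_ [set t | t < y 0 j + 1]); apply.
  by apply: open_nbhs_nbhs; split; [exact: open_lt|rewrite /= ltrDl].
have [_ [[x [Ux Cx] <-] [Nx hx]]] := hy _ (filterI hN hB).
exists (phi x); split=> //; exists x => //; split=> //.
by apply: hab => //; exact: ltW.
Qed.

Hypothesis inj : {in U &, injective phi}.

(** [W] is the complement of the image of [U] minus [V], closed by properness. Injectivity keeps the
    image of [V] inside it. *)
Lemma proper_open_image (V : set 'rV[R]_m) : V `<=` U -> open V ->
  exists2 W, open W & phi @` V = (phi @` U) `&` W.
Proof.
move=> VU oV; exists (~` (phi @` (U `&` ~` V))).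
  by rewrite openC; apply: proper_closed; rewrite closedC.
apply/seteqP; split=> y.
  move=> [x Vx <-]; split; first by exists x => //; exact: VU.
  move=> [x' [Ux' nVx'] E]; apply: nVx'.
  by rewrite (inj (mem_set Ux') (mem_set (VU _ Vx)) E).
move=> [[x Ux <-] h]; exists x => //; apply: contrapT => nVx.
by apply: h; exists x.
Qed.

End proper_maps.

(** * The profile of the catenoid *)

(* [area_poly k] is the polynomial P with d/dt (P(t) sqrt (1 + t)) = t^k / (2 sqrt (1 + t)). *)
Fixpoint area_poly (R : realType) (k : nat) : {poly R} :=
  if k is j.+1 then
    (j.*2 + 3)%:R^-1 *: ('X^(j.+1) - (j.*2 + 2)%:R *: area_poly R j)
  else 1.

(* With r'^2 = 1 + r^2 - q^2, q being the flux, and P = [area_poly k], Q = [defect_poly k]: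
   d/ds (P(r^2) r') = r^(2k+1) + (q^2 / r) Q(r^2). *)
Definition defect_poly (R : realType) (k : nat) : {poly R} :=
  (k.*2.+1)%:R *: area_poly R k - 2 *: ('X * (area_poly R k)^`()).

Section area_polynomial.
Variable R : realType.
Local Notation P := (area_poly R).
Local Notation Q := (defect_poly R).

Lemma area_poly_ode k (t : R) : 2 * (1 + t) * (P k)^`().[t] + (P k).[t] = t ^+ k.
Proof.
elim: k => [|k IH]; first by rewrite /= derivC !hornerE; ring.
rewrite /= derivZ derivB derivZ derivXn !(hornerZ, hornerD, hornerN, hornerMn, hornerXn) /=.
rewrite -[_ *+ k.+1]mulr_natr.
have d0 : (k.*2 + 3)%:R != 0 :> R by rewrite addnS pnatr_eq0.
set a := (P k).[t] in IH *; set b := (P k)^`().[t] in IH *.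
have -> : k.+1%:R = (k.*2 + 2)%:R / 2 :> R.
  by rewrite -[(k.*2 + 2)%N]/(k.*2 + 1.*2)%N -doubleD -muln2 natrM addn1 mulfK// pnatr_eq0.
have E : (k.*2 + 3)%:R = (k.*2 + 2)%:R + 1 :> R by rewrite addnS -natr1.
rewrite E in d0 *; move: (_ + 2)%:R d0 => c d0.
rewrite exprS -{}IH /=; field.
by rewrite d0.
Qed.

(** The recursion multiplies the value at 0 by - (2k+2) / (2k+3). The closed form isolates the
    factor (-4)^n n! / (2n)! of the area of H^(2n), n = k + 1. The factor k! is the one that the
    constant of the radial integration will cancel. *)
Lemma area_poly0 k : (P k).[0] = - (k`!%:R / 2) * ((- 4) ^+ k.+1 * k.+1`!%:R / (2 * k.+1)`!%:R).
Proof.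
elim: k => [|k IH].
  by rewrite /= hornerC (_ : (2 * 1)%N`! = 2%N)// !factS fact0 expr1; field.
rewrite /= hornerZ hornerD hornerN hornerZ hornerXn expr0n /= {}IH.
have -> : (2 * k.+2)`! = ((k.*2 + 4) * ((k.*2 + 3) * (2 * k.+1)`!))%N.
  have -> : (2 * k.+2 = (2 * k.+1).+2)%N by lia.
  have -> : (k.*2 + 4 = (2 * k.+1).+2)%N by lia.
  have -> : (k.*2 + 3 = (2 * k.+1).+1)%N by lia.
  by rewrite !factS.
have f0 : (2 * k.+1)`!%:R != 0 :> R by rewrite pnatr_eq0 -lt0n fact_gt0.
rewrite 2!(natrM _ (_ + _)); move: (2 * k.+1)`!%:R f0 => g g0.
rewrite (factS k.+1) (factS k) !(natrM _ _.+1).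
have -> : (k.*2 + 2)%:R = 2 * k%:R + 2 :> R by rewrite natrD -muln2 natrM mulrC.
have E3 : (k.*2 + 3)%:R = 2 * k%:R + 3 :> R by rewrite natrD -muln2 natrM mulrC.
have E4 : (k.*2 + 4)%:R = 2 * k%:R + 4 :> R by rewrite natrD -muln2 natrM mulrC.
have -> : k.+1%:R = k%:R + 1 :> R by rewrite -natr1.
have -> : k.+2%:R = k%:R + 2 :> R by rewrite -addn2 natrD.
have k0 : 0 <= k%:R :> R by [].
rewrite E3 E4 (exprS _ k.+1).
move: (k%:R) k0 ((-4) ^+ k.+1) (k`!%:R) => x x0 e f.
by field; rewrite g0 /=; do ?[apply/andP; split]; rewrite gt_eqF//; lra.
Qed.

Lemma size_area_poly k : (size (P k) <= k.+1)%N.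
Proof.
elim: k => [|k IH]; first by rewrite /= size_polyC; case: (_ != _).
apply: (leq_trans (size_scale_leq _ _)).
apply: (leq_trans (size_polyD _ _)); rewrite size_polyXn size_polyN geq_max leqnn /=.
by apply: (leq_trans (size_scale_leq _ _)); exact: leqW.
Qed.

Lemma area_poly_top k : (P k)`_k = (k.*2.+1)%:R^-1.
Proof.
case: k => [|k]; first by rewrite coef1 invr1.
rewrite /= coefZ coefB coefXn eqxx coefZ nth_default ?size_area_poly//.
by rewrite mulr0 subr0 mulr1 addn3.
Qed.

Lemma size_defect_poly k : (size (Q k) <= k.+1)%N.
Proof.
apply: (leq_trans (size_polyD _ _)); rewrite size_polyN geq_max; apply/andP; split.
  by apply: (leq_trans (size_scale_leq _ _)); exact: size_area_poly.
apply: (leq_trans (size_scale_leq _ _)).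
have [->|d0] := eqVneq (P k)^`() 0; first by rewrite mulr0 size_poly0.
rewrite mulrC size_mulX//; apply: leq_trans (size_area_poly k).
by apply: lt_size_deriv; apply: contraNneq d0 => ->; rewrite deriv0.
Qed.

Lemma defect_poly_top k : (Q k)`_k = (k.*2.+1)%:R^-1.
Proof.
have E (p : {poly R}) i : ('X * p^`())`_i = i%:R * p`_i.
  by rewrite coefXM mulr_natl; case: i => [|i] //=; rewrite coef_deriv.
rewrite coefB !coefZ E area_poly_top.
have -> : (k.*2.+1)%:R = 2 * k%:R + 1 :> R by rewrite -natr1 -muln2 natrM mulrC.
have k0 : 0 <= k%:R :> R by [].
by field; rewrite gt_eqF//; lra.
Qed.

(** The leading coefficient is 1 / (2k+1) > 0. This positivity for large arguments is what drives
    the renormalized area to minus infinity as the neck widens. *)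
Lemma defect_poly_pos k : exists2 T0 : R, 0 < T0 &
  forall t, T0 <= t -> (k.*2.+1)%:R^-1 <= (Q k).[t].
Proof.
have l0 : 0 < (k.*2.+1)%:R^-1 :> R by rewrite invr_gt0 ltr0n.
have sQ : size (Q k) = k.+1.
  apply/eqP; rewrite eqn_leq size_defect_poly /= ltnNge; apply/negP => h.
  by have := defect_poly_top k; rewrite nth_default// => E; rewrite -E ltxx in l0.
have lc : lead_coef (Q k) = (k.*2.+1)%:R^-1 by rewrite /lead_coef sQ defect_poly_top.
have [|T0 hT] := @poly_pinfty_gt_lc R (Q k); first by rewrite lc.
exists (Num.max 1 T0) => [|t]; first by rewrite lt_max ltr01.
by rewrite ge_max => /andP[_ /hT]; rewrite lc.
Qed.

(** Uniformity in [a] provides, with a = tau and t = xi^2, a dominating function for all tau in a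
    bounded interval. *)
Lemma defect_poly_bound k (M : R) : 0 <= M -> exists2 C : R, 0 <= C &
  forall a t, 0 <= a <= M -> 1 <= t -> `|(Q k).[a * t]| <= C * t ^+ k.
Proof.
move=> M0; exists (\sum_(i < k.+1) `|(Q k)`_i| * M ^+ i).
  by apply: sumr_ge0 => i _; rewrite mulr_ge0 ?exprn_ge0.
move=> a t /andP[a0 aM] t1; rewrite (horner_coef_wide _ (size_defect_poly k)).
apply: le_trans (ler_norm_sum _ _ _) _; rewrite mulr_suml; apply: ler_sum => i _.
have t0 : 0 <= t by exact: le_trans t1.
rewrite normrM [X in _ * X]ger0_norm; last by rewrite exprn_ge0// mulr_ge0.
rewrite exprMn mulrA ler_pM//; last by rewrite ler_weXn2l// -ltnS.
- by rewrite mulr_ge0// exprn_ge0.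
- by rewrite exprn_ge0.
- by rewrite ler_wpM2l// lerXn2r// nnegrE.
Qed.

End area_polynomial.

(* With [x = 1 + w^2 = (r / r0)^2], where r is the radius of the catenoid, r0 that of
   its neck and [tau = r0^2], one has [(dr/ds)^2 = (x - 1) S(x) / x^(2n-1)], n = k + 1. *)
Definition profile_poly (R : realType) (k : nat) (tau : R) : {poly R} :=
  \sum_(i < k.*2.+1) 'X^i + tau *: \sum_(i < k.*2.+2) 'X^i.

Section profile.
Variables (R : realType) (k : nat).
Implicit Types tau w x : R.

(** The geometric sums divide out the zero at the neck x = 1 exactly. The quotient stays at least 1
    for x >= 0, so its square root remains smooth where the square root of the energy is not. *)
Lemma profile_poly_geometric tau :
  ('X - 1%:P) * profile_poly k tau = 'X^(k.*2.+1) * (1%:P + tau *: 'X) - (1 + tau)%:P.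
Proof.
rewrite polyC1; have h j : ('X - 1) * \sum_(i < j) 'X^i = 'X^j - 1 :> {poly R} by rewrite -subrX1.
rewrite mulrDr -scalerAr !h polyCD mulrDr mulr1 -scalerAr -exprSr scalerBr.
by rewrite -(mul_polyC _ 1) mulr1; ring.
Qed.

Lemma profile_polyE tau x :
  (x - 1) * (profile_poly k tau).[x] = x ^+ k.*2.+1 * (1 + tau * x) - (1 + tau).
Proof.
have := congr1 (horner^~ x) (profile_poly_geometric tau).
by rewrite !(hornerM, hornerD, hornerN, hornerZ, hornerX, hornerXn, hornerC).
Qed.

Lemma profile_poly_derivE tau x :
  (profile_poly k tau).[x] + (x - 1) * (profile_poly k tau)^`().[x] =
  k.*2.+1%:R * x ^+ k.*2 * (1 + tau * x) + tau * x ^+ k.*2.+1.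
Proof.
have := congr1 (fun p => p^`().[x]) (profile_poly_geometric tau).
rewrite !(derivM, derivB, derivD, derivX, derivXn, derivZ, derivC).
rewrite !(hornerM, hornerD, hornerN, hornerZ, hornerX, hornerXn, hornerC, hornerMn) subr0 mul1r.
move=> ->; rewrite /= -mulr_natl; ring.
Qed.

Lemma profile_poly_ge1 tau x : 0 <= tau -> 0 <= x -> 1 <= (profile_poly k tau).[x].
Proof.
move=> t0 x0; rewrite hornerD hornerZ !horner_sum big_ord_recl /= hornerXn expr0.
rewrite -addrA lerDl addr_ge0//.
  by apply: sumr_ge0 => i _; rewrite hornerXn exprn_ge0.
by rewrite mulr_ge0//; apply: sumr_ge0 => i _; rewrite hornerXn exprn_ge0.
Qed.

Lemma profile_poly_le tau x : 0 <= tau -> 1 <= x ->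
  (profile_poly k tau).[x] <= (1 + tau) * k.*2.+2%:R * x ^+ k.*2.+1.
Proof.
move=> t0 x1; have x0 : 0 <= x by exact: le_trans x1.
have h j : (j <= k.*2.+2)%N -> (\sum_(i < j) 'X^i).[x] <= k.*2.+2%:R * x ^+ k.*2.+1.
  move=> jk; rewrite horner_sum.
  apply: (@le_trans _ _ (\sum_(i < j) x ^+ k.*2.+1)).
    apply: ler_sum => i _; rewrite hornerXn ler_weXn2l// -ltnS.
    exact: leq_trans (ltn_ord i) jk.
  by rewrite sumr_const card_ord -[leLHS]mulr_natl ler_wpM2r ?exprn_ge0// ler_nat.
rewrite hornerD hornerZ -mulrA mulrDl mul1r lerD ?h//.
by rewrite ler_wpM2l// h.
Qed.

Lemma continuous_profile_poly x : continuous (fun tau => (profile_poly k tau).[x]).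
Proof.
move=> t; under eq_fun do rewrite hornerD hornerZ.
by apply: cvgD; [exact: cvg_cst|apply: cvgM; [exact: cvg_id|exact: cvg_cst]].
Qed.

Definition xi w := Num.sqrt (1 + w ^+ 2).
Definition root_profile tau w := Num.sqrt (profile_poly k tau).[1 + w ^+ 2].
Local Notation S := root_profile.

Lemma xi_sqr w : xi w ^+ 2 = 1 + w ^+ 2.
Proof. by rewrite sqr_sqrtr// addr_ge0// sqr_ge0. Qed.

Lemma xi_ge1 w : 1 <= xi w.
Proof.
have h : 1 <= 1 + w ^+ 2 by rewrite lerDl sqr_ge0.
by rewrite /xi -[leLHS]sqrtr1 ler_sqrt// (le_trans ler01).
Qed.

Lemma xi_gt0 w : 0 < xi w. Proof. exact: lt_le_trans ltr01 (xi_ge1 w). Qed.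

Lemma xiN w : xi (- w) = xi w. Proof. by rewrite /xi sqrrN. Qed.

Lemma root_profileN tau w : S tau (- w) = S tau w.
Proof. by rewrite /root_profile sqrrN. Qed.

Lemma root_profile_gt0 tau w : 0 <= tau -> 0 < S tau w.
Proof.
move=> t0; rewrite sqrtr_gt0; apply: lt_le_trans (profile_poly_ge1 t0 _); first exact: ltr01.
by rewrite addr_ge0// sqr_ge0.
Qed.

Lemma root_profile_ge1 tau w : 0 <= tau -> 1 <= S tau w.
Proof.
move=> t0; have h : 1 <= (profile_poly k tau).[1 + w ^+ 2].
  by apply: profile_poly_ge1 => //; rewrite addr_ge0// sqr_ge0.
by rewrite /root_profile -[leLHS]sqrtr1 ler_sqrt// (le_trans ler01).
Qed.

Lemma root_profile_sqr tau w : 0 <= tau ->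
  S tau w ^+ 2 = (profile_poly k tau).[1 + w ^+ 2].
Proof.
move=> t0; rewrite sqr_sqrtr//; apply: le_trans (profile_poly_ge1 t0 _) => //.
by rewrite addr_ge0// sqr_ge0.
Qed.

Lemma root_profile_energy tau w : 0 <= tau ->
  w ^+ 2 * S tau w ^+ 2 = xi w ^+ 2 ^+ k.*2.+1 * (1 + tau * xi w ^+ 2) - (1 + tau).
Proof.
by move=> t0; rewrite root_profile_sqr// xi_sqr -profile_polyE addrAC subrr add0r.
Qed.

Lemma der_xi w : is_derive w 1 xi (w / xi w).
Proof.
have x0 : 0 < 1 + w ^+ 2 by rewrite ltr_pwDl// sqr_ge0.
apply: (is_derive_eq (der_sqrt (der_add (der_cst 1) (der_exp 2 (is_derive_id w 1))) x0)).
rewrite -/(xi w) /= expr1 mulr1 add0r; field.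
by rewrite gt_eqF// xi_gt0.
Qed.

Lemma der_root_profile tau w : 0 <= tau ->
  is_derive w 1 (S tau) (w * (profile_poly k tau)^`().[1 + w ^+ 2] / S tau w).
Proof.
move=> t0.
have S0 : 0 < (profile_poly k tau).[1 + w ^+ 2].
  by apply: lt_le_trans (profile_poly_ge1 t0 _) => //; rewrite addr_ge0// sqr_ge0.
apply: (is_derive_eq (der_sqrt (der_horner _ (der_add (der_cst 1)
  (der_exp 2 (is_derive_id w 1)))) S0)).
rewrite -/(S tau w) /= expr1 mulr1 add0r; field.
by rewrite gt_eqF// root_profile_gt0.
Qed.

(* In the arc length s, this is dr/ds. *)
Definition radial_speed tau w := w * S tau w / xi w ^+ k.*2.+1.

(** The value tau = 0 is included on purpose: there the derivative reduces to N / (xi^(2k+3) S),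
    which makes the limiting area defect computable in closed form. *)
Lemma der_radial_speed tau w : 0 <= tau ->
  is_derive w 1 (radial_speed tau)
    ((tau * xi w ^+ k.*2.+2.*2 + k.*2.+1%:R * (1 + tau)) / (xi w ^+ k.*2.+3 * S tau w)).
Proof.
move=> t0; have x0 : xi w != 0 by rewrite gt_eqF// xi_gt0.
have s0 : S tau w != 0 by rewrite gt_eqF// root_profile_gt0.
apply: (is_derive_eq (der_mul (der_mul (is_derive_id w 1) (der_root_profile w t0))
  (der_inv (der_exp _ (der_xi w)) (expf_neq0 _ x0)))).
have E1 := profile_poly_derivE tau (1 + w ^+ 2).
have E2 := root_profile_energy w t0.
have E3 := root_profile_sqr w t0.
have x2 := xi_sqr w.
have {}E1 : S tau w ^+ 2 + w ^+ 2 * (profile_poly k tau)^`().[1 + w ^+ 2] =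
    k.*2.+1%:R * (xi w ^+ 2) ^+ k.*2 * (1 + tau * xi w ^+ 2) +
    tau * (xi w ^+ 2) ^+ k.*2.+1.
  by rewrite E3 x2 -E1 [1 + _ - 1]addrAC subrr add0r.
have K1 : xi w ^+ k.*2.+2.*2 = xi w ^+ 2 * (xi w ^+ 2) ^+ k.*2.+1.
  by rewrite -!exprM -exprD; congr (_ ^+ _); lia.
have K3 : xi w ^+ k.*2.+3 = xi w ^+ 2 * (xi w * xi w ^+ k.*2) by rewrite -exprS -exprD.
rewrite K1 K3 !(exprS _ k.*2) /= in E1 E2 *.
have y0 : xi w ^+ k.*2 != 0 by rewrite expf_neq0.
move: (profile_poly k tau)^`().[1 + w ^+ 2] (k.*2.+1%:R) ((xi w ^+ 2) ^+ k.*2)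
  (xi w ^+ k.*2) y0 E1 E2 => D N Y y y0 E1 E2.
transitivity (((S tau w ^+ 2 + w ^+ 2 * D) * xi w ^+ 2 - N * (w ^+ 2 * S tau w ^+ 2)) /
    (xi w ^+ 2 * (xi w * y) * S tau w)).
  by field; rewrite x0 s0 y0.
by rewrite E1 E2; congr (_ / _); ring.
Qed.

End profile.

Lemma ler_of_sqr (R : realDomainType) (x y : R) : 0 <= y -> x ^+ 2 <= y ^+ 2 -> x <= y.
Proof. by move=> y0 h; rewrite leNgt; apply/negP => xy; nra. Qed.

Section catenary.
Variables (R : realType) (k : nat) (tau : R).
Hypothesis tau0 : 0 < tau.
Local Notation S := (root_profile k tau).

Let tau_ge0 : 0 <= tau. Proof. exact: ltW. Qed.
Let stau0 : 0 < Num.sqrt tau. Proof. by rewrite sqrtr_gt0. Qed.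
Let S0 w : 0 < S w. Proof. exact: root_profile_gt0. Qed.
Let x0 (w : R) : 0 < xi w. Proof. exact: xi_gt0. Qed.

(** This is dw/ds: [radial_speed] divided by the derivative sqrt tau * w / xi of the radius in w.
    The factor w cancels, so the slope does not vanish at the neck. *)
Definition slope (w : R) := S w / (Num.sqrt tau * xi w ^+ k.*2).

Lemma slope_gt0 w : 0 < slope w.
Proof. by rewrite divr_gt0// mulr_gt0// exprn_gt0. Qed.

Lemma continuous_slope : continuous slope.
Proof.
move=> w; apply: cvgM; first exact: is_derive_continuous (der_root_profile k w tau_ge0).
apply: cvgV; first by rewrite gt_eqF// mulr_gt0// exprn_gt0.
apply: cvgM; first exact: cvg_cst.
exact: is_derive_continuous (der_exp _ (der_xi w)).
Qed.

Definition is_catenary (w : R -> R) :=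
  [/\ w 0 = 0, forall s : R, is_derive s 1 w (slope (w s)),
      forall s, w (- s) = - w s & forall y, exists s, w s = y].

(** The equation is autonomous with positive slope, so w is the inverse of a primitive H of 1 /
    slope. Since S <= C xi^(2k+1), H grows at least like a multiple of ln xi, hence is onto and the
    solution is global. Oddness of w comes from evenness of the slope. *)
Lemma exists_catenary : exists w, is_catenary w.
Proof.
have ch : continuous (fun w => (slope w)^-1).
  move=> w; apply: cvgV; last exact: continuous_slope.
  by rewrite gt_eqF// slope_gt0.
have [H H0 dH] := exists_primitive ch.
have Hincr a b : a < b -> H a < H b.
  move=> ab; apply: (derive_gt0_lt dH) => // x _ _.
  by rewrite invr_gt0 slope_gt0.
have Hinj a b : H a = H b -> a = b.
  by move=> E; case: (ltgtP a b) => // /Hincr; rewrite E ltxx.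
have Hodd a : H (- a) = - H a.
  apply/eqP; rewrite -addr_eq0; apply/eqP.
  have d (z : R) : is_derive z 1 (fun z => H (- z) + H z) 0.
    apply: (is_derive_eq (der_add (is_derive_comp1 (der_opp (is_derive_id z 1)) (dH _)) (dH z))).
    by rewrite /slope xiN root_profileN; ring.
  by rewrite (derive0_eq a 0 d) oppr0 H0 addr0.
pose C : R := Num.sqrt ((1 + tau) * k.*2.+2%:R).
have C0 : 0 < C by rewrite sqrtr_gt0 mulr_gt0// addr_gt0.
have SC w : S w <= C * xi w ^+ k.*2.+1.
  apply: ler_of_sqr; first by rewrite mulr_ge0 ?exprn_ge0// ltW.
  rewrite root_profile_sqr// exprMn sqr_sqrtr; last by rewrite mulr_ge0// addr_ge0.
  rewrite exprAC xi_sqr. apply: profile_poly_le => //.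
  by rewrite lerDl sqr_ge0.
pose e := Num.sqrt tau / C; have e0 : 0 < e by rewrite divr_gt0.
have xi0 : xi 0 = 1 :> R by rewrite /xi expr0n addr0 sqrtr1.
have Hge y : 0 <= y -> e * ln (xi y) <= H y.
  move=> y0; rewrite -subr_ge0.
  have d (z : R) : is_derive z 1 (fun z => H z - e * ln (xi z)) ((slope z)^-1 - e * (z / xi z ^+ 2)).
    apply: (is_derive_eq (der_add (dH z) (der_opp (der_mul (der_cst e) (der_ln (der_xi z) (x0 z)))))).
    by rewrite mul0r add0r; congr (_ - e * _); field; rewrite gt_eqF.
  have := derive_ge0_le d _ y0; rewrite H0 xi0 ln1 mulr0 subr0; apply.
  move=> z z0 _; rewrite subr_ge0 /slope invf_div.
  have zx : z <= xi z by apply: ler_of_sqr; [exact: ltW|rewrite xi_sqr lerDr].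
  have E : e * (z / xi z ^+ 2) <= e / xi z.
    apply: ler_wpM2l; first exact: ltW.
    by rewrite ler_pdivrMr ?exprn_gt0// expr2 mulKf// gt_eqF.
  apply: (le_trans E).
  have xk0 : 0 < xi z ^+ k.*2 by rewrite exprn_gt0.
  have -> : e / xi z = Num.sqrt tau * xi z ^+ k.*2 / (C * xi z ^+ k.*2.+1).
    by rewrite /e exprS; field; rewrite !gt_eqF.
  apply: ler_wpM2l; first by rewrite mulr_ge0 ?ltW.
  by rewrite lef_pV2 ?posrE ?mulr_gt0 ?exprn_gt0.
have Hsurj s : exists y, H y = s.
  (* Chosen so that e ln y = |s|; since xi y >= y, the logarithmic lower bound gives H y >= |s|. *)
  pose y := expR (`|s| / e).
  have y0 : 0 < y by exact: expR_gt0.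
  have sy : `|s| <= H y.
    apply: le_trans (Hge _ (ltW y0)); rewrite -ler_pdivrMl// -[leLHS]expRK mulrC ler_ln ?posrE//.
    by apply: ler_of_sqr; [exact: ltW|rewrite xi_sqr lerDr].
  have cH : {within `[- y, y], continuous H} by apply: is_derive_within dH.
  have [] // := @IVT R H (- y) y s _ cH; first by lra.
    rewrite ge_min le_max Hodd; apply/andP; split; apply/orP.
      by left; move: sy; rewrite ler_norml => /andP[].
    by right; exact: le_trans (ler_norm s) sy.
  by move=> z _ <-; exists z.
pose w s := sval (cid (Hsurj s)).
have Hw s : H (w s) = s by rewrite /w; case: (cid _).
have wH y : w (H y) = y by apply: Hinj; rewrite Hw.
exists w; split.
- by rewrite -[X in w X]H0 wH.
- move=> s.
  have h1 : {near w s, cancel H w} by apply: filterE => y; rewrite wH.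
  have h2 : \forall y \near w s, {for y, continuous H}.
    by apply: filterE => y; exact: is_derive_continuous (dH y).
  have h3 : (slope (w s))^-1 != 0 by rewrite invr_neq0// gt_eqF// slope_gt0.
  by have := is_derive_inverse h1 h2 (dH (w s)) h3; rewrite Hw invrK.
- by move=> s; apply: Hinj; rewrite Hodd !Hw.
- by move=> y; exists (H y).
Qed.

Variable w : R -> R.
Hypothesis hw : is_catenary w.

Definition radius s := Num.sqrt tau * xi (w s).
Definition speed s := radial_speed k tau (w s).
(* [flux * radius^(2n-1)] is the first integral of a rotational minimal hypersurface;
   its square is N^(4n-2) / c^(4n), N = 2n - 1, which relates tau to c. *)
Definition flux s := Num.sqrt (tau ^+ k.*2.+1 * (1 + tau)) / radius s ^+ k.*2.+1.
Local Notation r := radius.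
Local Notation p := speed.
Local Notation q := flux.

Lemma radius_gt0 s : 0 < r s. Proof. by rewrite mulr_gt0. Qed.

Lemma radius_sqr s : r s ^+ 2 = tau * (1 + w s ^+ 2).
Proof. by rewrite exprMn sqr_sqrtr// xi_sqr. Qed.

Lemma flux_gt0 s : 0 < q s.
Proof.
rewrite divr_gt0// ?exprn_gt0// ?radius_gt0// sqrtr_gt0 mulr_gt0// ?exprn_gt0//.
by rewrite addr_gt0.
Qed.

Lemma flux_sqr s : q s ^+ 2 = (1 + tau) / (xi (w s) ^+ 2) ^+ k.*2.+1.
Proof.
rewrite expr_div_n sqr_sqrtr; last by rewrite mulr_ge0 ?exprn_ge0// addr_ge0.
rewrite [(r s ^+ _) ^+ 2]exprAC radius_sqr -xi_sqr exprMn.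
have t0 : tau ^+ k.*2.+1 != 0 by rewrite expf_neq0// gt_eqF.
have y0 : (xi (w s) ^+ 2) ^+ k.*2.+1 != 0 by rewrite !expf_neq0// gt_eqF.
by field; rewrite t0 y0.
Qed.

Lemma speed_sqr s : p s ^+ 2 = 1 + r s ^+ 2 - q s ^+ 2.
Proof.
rewrite flux_sqr radius_sqr -xi_sqr /speed /radial_speed expr_div_n exprMn.
rewrite root_profile_energy// [(xi _ ^+ k.*2.+1) ^+ 2]exprAC.
set y := (xi (w s) ^+ 2) ^+ k.*2.+1.
have y0 : y != 0 by rewrite !expf_neq0// gt_eqF.
by move: y (xi (w s) ^+ 2) y0 => y z y0; field.
Qed.

Lemma der_radius (s : R) : is_derive s 1 r (p s).
Proof.
case: hw => _ dw _ _.
apply: (is_derive_eq (der_mul (der_cst _) (is_derive_comp1 (dw s) (der_xi _)))).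
rewrite mul0r add0r /speed /radial_speed /slope exprS.
have y0 : xi (w s) ^+ k.*2 != 0 by rewrite expf_neq0// gt_eqF.
by field; rewrite y0 !gt_eqF.
Qed.

Lemma der_speed (s : R) : is_derive s 1 p (r s + k.*2.+1%:R * q s ^+ 2 / r s).
Proof.
case: hw => _ dw _ _.
apply: (is_derive_eq (is_derive_comp1 (dw s) (der_radial_speed k (w s) tau_ge0))).
rewrite flux_sqr /radius /slope.
have y0 : xi (w s) ^+ k.*2 != 0 by rewrite expf_neq0// gt_eqF.
have -> : xi (w s) ^+ k.*2.+2.*2 = xi (w s) ^+ 4 * (xi (w s) ^+ k.*2) ^+ 2.
  by rewrite -exprM -exprD; congr (_ ^+ _); lia.
have -> : xi (w s) ^+ k.*2.+3 = xi (w s) ^+ 3 * xi (w s) ^+ k.*2 by rewrite -exprD.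
have -> : (xi (w s) ^+ 2) ^+ k.*2.+1 = xi (w s) ^+ 2 * (xi (w s) ^+ k.*2) ^+ 2.
  by rewrite -!exprM -exprD; congr (_ ^+ _); lia.
have t2 : tau = Num.sqrt tau ^+ 2 by rewrite sqr_sqrtr.
move: (S (w s)) (S0 (w s)) (xi (w s)) (x0 (w s)) (xi (w s) ^+ k.*2) y0 (Num.sqrt tau) stau0 t2.
move=> S' S'0 x x'0 y y0 z z0 ->.
by field; rewrite y0 !gt_eqF.
Qed.

Lemma der_flux (s : R) : is_derive s 1 q (- k.*2.+1%:R * q s * p s / r s).
Proof.
have r0 : r s != 0 by rewrite gt_eqF// radius_gt0.
apply: (is_derive_eq (der_mul (der_cst _) (der_inv (der_exp _ (der_radius s)) (expf_neq0 _ r0)))).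
rewrite /flux /= exprS; have y0 : r s ^+ k.*2 != 0 by rewrite expf_neq0.
by field; rewrite r0 y0.
Qed.

Lemma catenary_incr a b : a < b -> w a < w b.
Proof.
case: hw => _ dw _ _ ab; apply: (derive_gt0_lt dw) => // x _ _; exact: slope_gt0.
Qed.

Lemma catenary_ge0 s : 0 <= s -> 0 <= w s.
Proof.
case: hw => w0 _ _ _; rewrite le_eqVlt => /predU1P[<-|/catenary_incr/ltW]; rewrite w0//.
Qed.

Lemma speedN s : p (- s) = - p s.
Proof.
case: hw => _ _ wN _.
by rewrite /speed /radial_speed wN xiN root_profileN !mulNr.
Qed.

Lemma radiusN s : r (- s) = r s.
Proof. by case: hw => _ _ wN _; rewrite /radius wN xiN. Qed.

Lemma fluxN s : q (- s) = q s.
Proof. by rewrite /flux radiusN. Qed.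

Lemma speed_ge0 s : 0 <= s -> 0 <= p s.
Proof.
move=> s0; apply: divr_ge0; last exact/ltW/exprn_gt0.
by apply: mulr_ge0; [exact: catenary_ge0|exact: ltW].
Qed.

Lemma radius_ge s : Num.sqrt tau * `|w s| <= r s.
Proof.
apply: ler_wpM2l; first exact: ltW.
by apply: ler_of_sqr; [exact: ltW|rewrite xi_sqr real_normK ?num_real// lerDr].
Qed.

End catenary.

(** * Uniqueness for second order equations *)

Section ode.
Variable R : realType.

(** With the factor exp(- L s) the function is nonincreasing for s >= 0, with exp(L s) nondecreasing
    for s <= 0, and in both cases it starts or ends at 0. *)
Lemma gronwall0 (e de : R -> R) (L : R) :
  (forall s : R, is_derive s 1 e (de s)) -> (forall s, 0 <= e s) ->
  (forall s, `|de s| <= L * e s) -> e 0 = 0 -> forall s, e s = 0.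
Proof.
move=> he e0 hL e00 s.
have d (a z : R) : is_derive z 1 (fun z => e z * expR (a * z)) ((de z + a * e z) * expR (a * z)).
  apply: (is_derive_eq (der_mul (he z) (der_exp_real (der_mul (der_cst a) (is_derive_id z 1))))).
  by rewrite mul0r add0r; ring.
apply/le_anti/andP; split=> //; have [s0|s0] := leP 0 s.
  have hd (z : R) := der_opp (d (- L) z).
  have := derive_ge0_le hd _ s0; rewrite e00 mul0r oppr0 oppr_ge0 pmulr_lle0 ?expR_gt0//.
  apply=> z _ _; rewrite -mulNr mulr_ge0 ?expR_ge0//.
  by have := hL z; rewrite ler_norml => /andP[]; lra.
have := derive_ge0_le (d L) _ (ltW s0); rewrite e00 mul0r pmulr_lle0 ?expR_gt0//.
apply=> z _ _; rewrite mulr_ge0 ?expR_ge0//.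
by have := hL z; rewrite ler_norml => /andP[]; lra.
Qed.

Lemma horner_lipschitz (p : {poly R}) (M : R) : 0 <= M -> exists2 L, 0 <= L &
  forall x y, 0 <= x <= M -> 0 <= y <= M -> `|p.[x] - p.[y]| <= L * `|x - y|.
Proof.
move=> M0; suff [L [B [L0 B0 hL hB]]] : exists L B, [/\ 0 <= L, 0 <= B,
    forall x y, 0 <= x <= M -> 0 <= y <= M -> `|p.[x] - p.[y]| <= L * `|x - y|
    & forall x, 0 <= x <= M -> `|p.[x]| <= B] by exists L.
elim/poly_ind: p => [|p a [L [B [L0 B0 hL hB]]]].
  exists 0, 0; split=> // [x y _ _|x _]; first by rewrite !horner0 subr0 normr0 mul0r.
  by rewrite horner0 normr0.
exists (B + M * L), (B * M + `|a|); split; rewrite ?addr_ge0 ?mulr_ge0//.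
  move=> x y hx hy; rewrite !(hornerD, hornerM, hornerX, hornerC).
  have -> : p.[x] * x + a - (p.[y] * y + a) = p.[x] * (x - y) + y * (p.[x] - p.[y]) by ring.
  apply: le_trans (ler_normD _ _) _; rewrite !normrM mulrDl; apply: lerD.
    by rewrite ler_wpM2r// hB.
  have [y0 yM] := andP hy; rewrite (ger0_norm y0) -mulrA.
  by apply: ler_pM => //; exact: hL.
move=> x hx; rewrite !(hornerD, hornerM, hornerX, hornerC).
apply: le_trans (ler_normD _ _) _; rewrite lerD2r normrM; apply: ler_pM => //; first exact: hB.
by have [x0 xM] := andP hx; rewrite ger0_norm.
Qed.

(** Apply [gronwall0] to the squared distance of the two solutions in the phase plane. A polynomial
    is Lipschitz with some constant L on [0, M], where both solutions stay, and 2ab <= a^2 + b^2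
    gives the rate 1 + L. *)
Lemma ode2_unique (F : {poly R}) (M : R) (u1 u2 v1 v2 : R -> R) :
  (forall s : R, is_derive s 1 u1 (v1 s)) -> (forall s : R, is_derive s 1 u2 (v2 s)) ->
  (forall s : R, is_derive s 1 v1 F.[u1 s]) -> (forall s : R, is_derive s 1 v2 F.[u2 s]) ->
  (forall s, 0 <= u1 s <= M) -> (forall s, 0 <= u2 s <= M) ->
  u1 0 = u2 0 -> v1 0 = v2 0 -> forall s, u1 s = u2 s.
Proof.
move=> du1 du2 dv1 dv2 b1 b2 E0 V0 s.
have M0 : 0 <= M by have /andP[h1 h2] := b1 0; exact: le_trans h2.
have [L L0 hL] := horner_lipschitz F M0.
pose e s := (u1 s - u2 s) ^+ 2 + (v1 s - v2 s) ^+ 2.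
have de (z : R) := der_add (der_exp 2 (der_add (du1 z) (der_opp (du2 z))))
  (der_exp 2 (der_add (dv1 z) (der_opp (dv2 z)))).
suff : e s = 0.
  move=> /eqP; rewrite paddr_eq0 ?sqr_ge0// sqrf_eq0 => /andP[/eqP h _].
  by apply/eqP; rewrite -subr_eq0 h.
apply: (@gronwall0 e _ (1 + L) de) => [z|z|]; first by rewrite addr_ge0 ?sqr_ge0.
  have h := hL _ _ (b1 z) (b2 z).
  rewrite /e /= !expr1; move: (u1 z - u2 z) (v1 z - v2 z) (F.[u1 z] - F.[u2 z]) h => a b f h.
  have {h} [h1 h2] : f <= L * `|a| /\ - (L * `|a|) <= f.
    by move: h; rewrite ler_norml => /andP[].
  have [ha1 ha2] : (`|a| ^+ 2 = a ^+ 2) /\ (`|b| ^+ 2 = b ^+ 2) by rewrite !real_normK ?num_real.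
  have hab : `|a * b| <= (a ^+ 2 + b ^+ 2) / 2.
    by rewrite normrM -ha1 -ha2; have := sqr_ge0 (`|a| - `|b|); nra.
  have hbf : `|b * f| <= L * ((a ^+ 2 + b ^+ 2) / 2).
    rewrite normrM; apply: (@le_trans _ _ (`|b| * (L * `|a|))).
      by rewrite ler_wpM2l// ler_norml h1 h2.
    rewrite mulrCA ler_wpM2l//.
    by rewrite -ha1 -ha2; have := sqr_ge0 (`|a| - `|b|); nra.
  have -> : 2 * a * b + 2 * b * f = 2 * (a * b + b * f) by ring.
  rewrite normrM ger0_norm//; have := ler_normD (a * b) (b * f); lra.
by rewrite /e E0 V0 !subrr expr0n addr0.
Qed.

End ode.

Section catenoid_profile.
Variables (R : realType) (k : nat) (c tau : R).
Hypothesis c0 : 0 < c.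
Hypothesis tau0 : 0 < tau.
Local Notation N := (k.*2.+1%:R : R).
Hypothesis hK : tau ^+ k.*2.+1 * (1 + tau) * (c ^+ 2) ^+ k.*2.+2 = (N ^+ 2) ^+ k.*2.+1.

Let alpha := N ^+ 2 / (c ^+ 2 * tau).
Let N0 : 0 < N. Proof. by []. Qed.
Let natN : (2 * k.+1 - 1)%N = k.*2.+1. Proof. lia. Qed.
Let alpha0 : 0 < alpha. Proof. by rewrite divr_gt0 ?mulr_gt0 ?exprn_gt0. Qed.

Let alpha_pow : alpha ^+ k.*2.+2 = N ^+ 2 * (1 + tau) / tau.
Proof.
rewrite expr_div_n (exprMn _ (c ^+ 2)) (exprS (N ^+ 2)) (exprS tau) -hK.
have A0 : (c ^+ 2) ^+ k.*2.+2 != 0 by rewrite !expf_neq0// gt_eqF.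
have T0 : tau ^+ k.*2.+1 != 0 by rewrite expf_neq0// gt_eqF.
by field; rewrite T0 A0 gt_eqF.
Qed.

Let Qpoly : {poly R} := - 'X^(k.*2.+2) + c ^+ 2 *: 'X + (N ^+ 2)%:P.

Let QpolyE u : catenoid_Q k.+1 c u = Qpoly.[u].
Proof.
rewrite /catenoid_Q natN !(hornerD, hornerN, hornerZ, hornerXn, hornerX, hornerC).
by rewrite (_ : (2 * k.+1)%N = k.*2.+2)//; lia.
Qed.

Let Q_alpha : catenoid_Q k.+1 c alpha = 0.
Proof.
rewrite QpolyE !(hornerD, hornerN, hornerZ, hornerXn, hornerX, hornerC) alpha_pow /alpha.
by field; rewrite !gt_eqF.
Qed.

(** For 0 < x < y, the combination y Q(x) - x Q(y) equals x y (y^(2k+1) - x^(2k+1)) + N^2 (y - x) >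
    0, so x and y cannot both be roots. *)
Let Q_root_unique a : 0 < a -> catenoid_Q k.+1 c a = 0 -> a = alpha.
Proof.
suff h x y : 0 < x -> x < y -> catenoid_Q k.+1 c x = 0 -> catenoid_Q k.+1 c y = 0 -> False.
  by move=> a0 Qa; case: (ltgtP a alpha) => // /h; [move=> /(_ a0 Qa Q_alpha)|move=> /(_ alpha0 Q_alpha Qa)].
move=> hx xy; rewrite !QpolyE !(hornerD, hornerN, hornerZ, hornerXn, hornerX, hornerC) !(exprS _ k.*2.+1) => h1 h2.
have hp : x ^+ k.*2.+1 < y ^+ k.*2.+1 by rewrite ltr_pXn2r// ?nnegrE ltW// (lt_trans hx).
have y0 := lt_trans hx xy.
have xy0 : 0 < x * y by rewrite mulr_gt0.
have n2 : 0 < N ^+ 2 by rewrite exprn_gt0.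
have E : x * y * (y ^+ k.*2.+1 - x ^+ k.*2.+1) = - (N ^+ 2 * (y - x)).
  by apply/eqP; rewrite -subr_eq0; apply/eqP; transitivity
    (y * (- (x * x ^+ k.*2.+1) + c ^+ 2 * x + N ^+ 2) - x * (- (y * y ^+ k.*2.+1) + c ^+ 2 * y + N ^+ 2)); [ring|rewrite h1 h2 !mulr0 subr0].
have : 0 < x * y * (y ^+ k.*2.+1 - x ^+ k.*2.+1) by rewrite mulr_gt0// subr_gt0.
by rewrite E oppr_gt0 pmulr_rlt0// subr_lt0 ltNge ltW.
Qed.

Lemma catenoid_alphaE : catenoid_alpha k.+1 c = alpha.
Proof. by apply: xget_unique => // y [y0 Qy]; exact: Q_root_unique. Qed.

Let Gpoly : {poly R} := (4 / N ^+ 2) *: ('X^2 * Qpoly).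

Let GpolyE u : 4 * u ^+ 2 / (2 * k.+1 - 1)%:R ^+ 2 * catenoid_Q k.+1 c u = Gpoly.[u].
Proof. by rewrite natN QpolyE hornerZ hornerM hornerXn; ring. Qed.

(** Differentiating u'^2 = G(u) only gives u' (u'' - F(u)) = 0 with F = G'/2. Where f = u'' - F(u)
    is nonzero, u' vanishes nearby, so u = alpha, u'' = 0 and f = - F(alpha). Thus the continuous
    function f takes at most two values and cannot pass from 0 to the other. If it were never 0,
    then u' would vanish everywhere and u would be constant. *)
Let catenoid_u_ode2 u : is_catenoid_u k.+1 c u -> forall s : R,
  is_derive s 1 u ((derive1 u) s) /\ is_derive s 1 (derive1 u) (2^-1 *: Gpoly^`()).[u s].
Proof.
move=> [sm rng ncst ode u0]; rewrite catenoid_alphaE in rng u0.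
have d1 (s : R) : is_derive s 1 u ((derive1 u) s).
  by split; [exact: (sm 0%N s)|rewrite derive1E].
have d2 (s : R) : is_derive s 1 (derive1 u) ((derive1 (derive1 u)) s).
  by split; [exact: (sm 1%N s)|rewrite derive1E].
have cd2 : continuous (derive1 (derive1 u)).
  by move=> s; apply/differentiable_continuous/derivable1_diffP; exact: (sm 2 s).
pose F : {poly R} := 2^-1 *: Gpoly^`().
pose f s := (derive1 (derive1 u)) s - F.[u s].
have cf : continuous f.
  move=> s; apply: cvgB; first exact: cd2.
  apply: (@continuous_comp _ _ _ u (horner F)); last exact: continuous_horner.
  exact: is_derive_continuous (d1 s).
have prod0 s : (derive1 u) s * f s = 0.
  have E : (fun s => (derive1 u) s ^+ 2) = (fun s => Gpoly.[u s]).
    by apply/funext => z; rewrite ode GpolyE.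
  have h1 := der_exp 2 (d2 s); have h2 := der_horner Gpoly (d1 s).
  rewrite /= in h1; rewrite E in h1.
  have : 2%:R * (derive1 u) s ^+ 1 * (derive1 (derive1 u)) s = (derive1 u) s * Gpoly^`().[u s].
    by case: h1 => _ <-; case: h2.
  rewrite /f hornerZ expr1 => h; rewrite mulrBr; lra.
have stat s : (derive1 u) s = 0 -> u s = alpha.
  move=> us0; have /andP[us usa] := rng s.
  have := ode s; rewrite us0 expr0n /= => /esym/eqP; rewrite mulf_eq0 => /orP[|/eqP Qu].
    by rewrite !mulf_eq0 invr_eq0 !expf_eq0 /= pnatr_eq0 natN pnatr_eq0 (gt_eqF us).
  exact: Q_root_unique.
have f_values s : f s = 0 \/ f s = - F.[alpha].
  have [->|fs] := eqVneq (f s) 0; [by left|right].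
  have near0 : \forall z \near s, f z != 0.
    have := cf s; move=> /(_ [set y | y != 0]); apply.
    by apply: open_nbhs_nbhs; split; [exact: open_neq|].
  have near1 : \forall z \near s, (derive1 u) z = 0.
    apply: filterS near0 => z fz; have /eqP := prod0 z.
    by rewrite mulf_eq0 (negbTE fz) orbF => /eqP.
  have us : u s = alpha by apply: stat; exact: nbhs_singleton near1.
  rewrite /f us derive1E (@near_eq_derive _ _ _ _ (fun=> 0)) ?derive_cst ?sub0r//.
have f_const a b : f a = 0 -> f b = 0.
  move=> fa; apply: contrapT => /eqP fb.
  have fbE : f b = - F.[alpha] by case: (f_values b) => // h; rewrite h eqxx in fb.
  (* Half of [f b] lies between the two values of f and equals neither, which the intermediate value
     theorem contradicts. *)
  have hmid : Num.min (f (Num.min a b)) (f (Num.max a b)) <= f b / 2 <=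
      Num.max (f (Num.min a b)) (f (Num.max a b)).
    have H (x y : R) : x = 0 /\ y = f b \/ x = f b /\ y = 0 ->
        Num.min x y <= f b / 2 <= Num.max x y.
      by case=> -[-> ->]; rewrite ge_min le_max; case: (lerP 0 (f b)) => h;
        apply/andP; split; apply/orP; (try by left; lra); right; lra.
    by apply: H; case: (leP a b) => _; [left|right].
  have [] // := @IVT R f (Num.min a b) (Num.max a b) (f b / 2) _ _ hmid.
  - by rewrite ge_min le_max lexx.
  - exact: continuous_subspaceT.
  move=> z _ fz; case: (f_values z); rewrite fz => E; move: fb; last rewrite fbE in E *.
    by rewrite -[f b](@divfK _ 2)// E mul0r eqxx.
  by rewrite (_ : - F.[alpha] = 0) ?eqxx//; lra.
have f0 s : f s = 0.
  apply: contrapT => fs; apply: ncst; exists alpha => z; apply: stat.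
  have /eqP := prod0 z; rewrite mulf_eq0 => /orP[/eqP //|/eqP fz].
  by exfalso; apply: fs; exact: f_const fz.
move=> s; split=> //; apply: (is_derive_eq (d2 s)).
by have /eqP := f0 s; rewrite subr_eq0 => /eqP.
Qed.

Variable w : R -> R.
Hypothesis hw : is_catenary k tau w.
Local Notation r := (radius tau w).
Local Notation p := (speed k tau w).
Local Notation q := (flux k tau w).

Let u0 s := N ^+ 2 / (c ^+ 2 * r s ^+ 2).

Let r0 s : 0 < r s. Proof. exact: radius_gt0. Qed.

Let der_u0 (s : R) : is_derive s 1 u0 (- 2 * (N ^+ 2 / c ^+ 2) * p s * (r s)^-1 ^+ 3).
Proof.
have cr : c ^+ 2 * r s ^+ 2 != 0 by rewrite mulf_neq0 ?expf_neq0// gt_eqF.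
apply: (is_derive_eq (der_mul (der_cst _) (der_inv (der_mul (der_cst (c ^+ 2))
  (der_exp 2 (der_radius tau0 hw s))) cr))).
by rewrite /= expr1; field; rewrite !gt_eqF.
Qed.

Lemma is_catenoid_radius : is_catenoid_u k.+1 c u0.
Proof.
have w0 : w 0 = 0 by case: hw.
have rE s : tau <= r s ^+ 2.
  rewrite radius_sqr// -[leLHS]mulr1; apply: ler_wpM2l; first exact: ltW.
  by rewrite lerDl sqr_ge0.
have u0_0 : u0 0 = alpha.
  by rewrite /u0 /alpha radius_sqr// w0 expr0n addr0 mulr1.
split.
(* r, 1/r and p generate an algebra stable under d/ds: in r'' the squared flux is a constant times a
   power of 1/r. *)
- pose G : set (R -> R) := [set f | f = r \/ f = (fun s => (r s)^-1) \/ f = p].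
  have gr : generated G r by apply: generated_in; left.
  have gi : generated G (fun s => (r s)^-1) by apply: generated_in; right; left.
  have gp : generated G p by apply: generated_in; right; right.
  apply: (@generated_derive1n _ G) => [g [->|[->|->]]|].
  + by exists p => // s _; exact: der_radius.
  + exists (fun s => - (p s * (r s)^-1 ^+ 2)).
      by apply/generated_opp/generated_mul => //; exact: generated_exp.
    move=> s _; apply: (is_derive_eq (der_inv (der_radius tau0 hw s) _)); first by rewrite gt_eqF.
    by rewrite exprVn.
  + exists (fun s => r s + k.*2.+1%:R * (tau ^+ k.*2.+1 * (1 + tau)) * (r s)^-1 ^+ (k.*2.+1 * 2).+1).
      apply: generated_add => //; apply: generated_mul; first exact: generated_cst.
      exact: generated_exp.
    move=> s _; apply: (is_derive_eq (der_speed tau0 hw s)).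
    rewrite /flux expr_div_n sqr_sqrtr; last by rewrite mulr_ge0 ?exprn_ge0 ?addr_ge0 ?ltW.
    by rewrite -[(r s ^+ _) ^+ 2]exprM [(r s)^-1 ^+ _.+1]exprS exprVn; ring.
  + have -> : u0 = (fun s => N ^+ 2 / c ^+ 2 * (r s)^-1 ^+ 2).
      by apply/funext => s; rewrite /u0 invfM exprVn mulrA.
    by apply: generated_mul; [exact: generated_cst|exact: generated_exp].
- move=> s; rewrite catenoid_alphaE.
  have cr : 0 < c ^+ 2 * r s ^+ 2 by exact: mulr_gt0 (exprn_gt0 _ c0) (exprn_gt0 _ (r0 s)).
  have ct : 0 < c ^+ 2 * tau by exact: mulr_gt0 (exprn_gt0 _ c0) tau0.
  have n2 : 0 < N ^+ 2 by exact: exprn_gt0.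
  rewrite /u0 /alpha divr_gt0//=; apply: ler_wpM2l; first exact: ltW.
  by rewrite lef_pV2 ?posrE//; apply: ler_wpM2l => //; exact/exprn_ge0/ltW.
- move=> [a ha]; have [s ws] : exists s, w s = 1 by case: hw => _ _ _; apply.
  have : u0 s = u0 0 by rewrite !ha.
  move=> /(mulfI (expf_neq0 _ (lt0r_neq0 N0)))/invr_inj/(mulfI (expf_neq0 _ (lt0r_neq0 c0))).
  rewrite !radius_sqr// w0 ws => /(mulfI (lt0r_neq0 tau0)); rewrite expr1n expr0n /=; lra.
- move=> s; rewrite derive1E; have [_ ->] := der_u0 s.
  have rp : 0 < r s ^+ 2 by rewrite exprn_gt0.
  have E : (4 * u0 s ^+ 2 / N ^+ 2) * catenoid_Q k.+1 c (u0 s) =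
     4 * u0 s ^+ 2 / r s ^+ 2 * p s ^+ 2.
    rewrite speed_sqr// QpolyE !(hornerD, hornerN, hornerZ, hornerXn, hornerX, hornerC).
    have -> : u0 s ^+ k.*2.+2 = c ^+ 2 * u0 s * q s ^+ 2.
      have -> : u0 s = alpha * tau / r s ^+ 2.
        by rewrite /u0 /alpha; field; rewrite !gt_eqF.
      rewrite flux_sqr// exprMn exprMn alpha_pow exprVn radius_sqr// -xi_sqr exprMn.
      have T0 : tau ^+ k.*2.+1 != 0 by rewrite expf_neq0// gt_eqF.
      have X0 : (xi (w s) ^+ 2) ^+ k.*2.+1 != 0 by rewrite !expf_neq0// gt_eqF// xi_gt0.
      rewrite !(exprS _ k.*2.+1) /alpha; field.
      by rewrite X0 T0 !gt_eqF// xi_gt0.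
    by rewrite /u0; field; rewrite !gt_eqF.
  rewrite natN E /u0; field; rewrite !gt_eqF//.
- by rewrite catenoid_alphaE.
Qed.

(** The existence of one solution makes the choice by [xget] satisfy its specification. Both
    solutions then solve the same second order equation with the same data at 0, namely value alpha
    and derivative 0, the latter because alpha is a root of Q. *)
Lemma catenoid_uE s : catenoid_u k.+1 c s = N ^+ 2 / (c ^+ 2 * r s ^+ 2).
Proof.
have h0 := is_catenoid_radius.
have h1 : is_catenoid_u k.+1 c (catenoid_u k.+1 c) by exact: (xgetPex _ (ex_intro _ _ h0)).
have e0 := catenoid_u_ode2 h0; have e1 := catenoid_u_ode2 h1.
have bd u : is_catenoid_u k.+1 c u -> forall s, 0 <= u s <= alpha.
  by move=> [_ rng _ _ _] z; have := rng z; rewrite catenoid_alphaE => /andP[/ltW -> ->].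
have init u : is_catenoid_u k.+1 c u -> u 0 = alpha /\ (derive1 u) 0 = 0.
  move=> [_ _ _ ode]; rewrite catenoid_alphaE => ua; split=> //.
  by apply/eqP; rewrite -sqrf_eq0 ode ua Q_alpha mulr0.
have [i1 j1] := init _ h1; have [i0 j0] := init _ h0.
have i10 : catenoid_u k.+1 c 0 = u0 0 by rewrite i1 i0.
have j10 : derive1 (catenoid_u k.+1 c) 0 = derive1 u0 0 by rewrite j1 j0.
exact: (@ode2_unique R (2^-1 *: Gpoly^`()) alpha (catenoid_u k.+1 c) u0
  (derive1 (catenoid_u k.+1 c)) (derive1 u0) (fun z => (e1 z).1) (fun z => (e0 z).1)
  (fun z => (e1 z).2) (fun z => (e0 z).2) (bd _ h1) (bd _ h0) i10 j10 s).
Qed.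

(** The real power splits as u^(k+1) sqrt u. Here u^k sqrt u = c q, since both sides are positive
    and their squares agree by [hK], and the denominator is c^2 u (1 + r^2). *)
Let v_integrand t : catenoid_u k.+1 c t `^ (k.+1%:R + 2^-1) /
  (c ^+ 2 * catenoid_u k.+1 c t + (2 * k.+1 - 1)%:R ^+ 2) = q t / (1 + r t ^+ 2) / c.
Proof.
have rt := r0 t; have rp : 0 < r t ^+ 2 by rewrite exprn_gt0.
have u_gt0 : 0 < u0 t by exact: divr_gt0 (exprn_gt0 _ N0) (mulr_gt0 (exprn_gt0 _ c0) rp).
rewrite catenoid_uE -/(u0 t) natN powRD ?(gt_eqF u_gt0) ?implybT//.
rewrite powR_mulrn ?(ltW u_gt0)// powR12_sqrt ?(ltW u_gt0)//.
have E : u0 t ^+ k * Num.sqrt (u0 t) = c * q t.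
  have q0 : 0 < q t by exact: flux_gt0.
  have l0 : 0 < u0 t ^+ k * Num.sqrt (u0 t) by rewrite mulr_gt0 ?exprn_gt0 ?sqrtr_gt0.
  have cq0 : 0 < c * q t by exact: mulr_gt0.
  apply/eqP; rewrite -(@eqrXn2 _ 2) ?(ltW cq0) ?(ltW l0)//; apply/eqP.
  rewrite [RHS]exprMn.
  rewrite [LHS]exprMn (sqr_sqrtr (ltW u_gt0)) -[(u0 t ^+ k) ^+ 2]exprM muln2 -exprSr.
  rewrite /flux [(Num.sqrt _ / _) ^+ 2]expr_div_n sqr_sqrtr; last first.
    by rewrite mulr_ge0 ?exprn_ge0 ?addr_ge0 ?(ltW tau0).
  have K : tau ^+ k.*2.+1 * (1 + tau) = (N ^+ 2) ^+ k.*2.+1 / (c ^+ 2) ^+ k.*2.+2.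
    by rewrite -hK mulfK// !expf_neq0// gt_eqF.
  rewrite K /u0 expr_div_n (exprMn _ (c ^+ 2)) [(r t ^+ k.*2.+1) ^+ 2]exprAC.
  rewrite (exprS (c ^+ 2) k.*2.+1) exprMn.
  have C0 : (c ^+ 2) ^+ k.*2.+1 != 0 by rewrite !expf_neq0// gt_eqF.
  have R0 : (r t ^+ 2) ^+ k.*2.+1 != 0 by rewrite !expf_neq0// gt_eqF.
  by field; rewrite C0 R0 gt_eqF.
have D : c ^+ 2 * u0 t + N ^+ 2 = c ^+ 2 * u0 t * (1 + r t ^+ 2).
  by rewrite /u0; field; rewrite !gt_eqF.
rewrite D (exprS (u0 t)) -[u0 t * _ * Num.sqrt _]mulrA E; field.
by rewrite !gt_eqF// addr_gt0.
Qed.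

Lemma catenoid_v0 : catenoid_v k.+1 c 0 = 0.
Proof.
by rewrite /catenoid_v lexx set_itv1 Rintegral_set1 mulr0.
Qed.

Lemma der_catenoid_v (s : R) : is_derive s 1 (catenoid_v k.+1 c) (- (q s / (1 + r s ^+ 2))).
Proof.
have cq : continuous (fun s => q s / (1 + r s ^+ 2) / c).
  move=> z; have d0 : 1 + r z ^+ 2 != 0 by rewrite gt_eqF// addr_gt0// exprn_gt0.
  exact: is_derive_continuous (der_mul (der_mul (der_flux tau0 hw z)
    (der_inv (der_add (der_cst 1) (der_exp 2 (der_radius tau0 hw z))) d0)) (der_cst c^-1)).
have [F F0 dF] := exists_primitive cq.
have -> : catenoid_v k.+1 c = (fun s => - c * F s).
  apply/funext => z; rewrite /catenoid_v; congr (_ * _).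
  under eq_Rintegral do rewrite v_integrand.
  have [z0|z0] := leP 0 z; first by rewrite (Rintegral_is_derive dF)// F0 subr0.
  under eq_Rintegral do rewrite v_integrand.
  by rewrite (Rintegral_is_derive dF) ?ltW// F0 sub0r opprK.
apply: (is_derive_eq (der_mul (der_cst _) (dF s))).
have d0 : 1 + r s ^+ 2 != 0 by rewrite gt_eqF// addr_gt0// exprn_gt0.
by field; rewrite d0 gt_eqF.
Qed.

End catenoid_profile.

(** * Areas of radially parametrized sets *)

Lemma closed_borel (R : realType) (m : nat) (D : set 'rV[R]_m) : closed D -> borel_set D.
Proof.
move=> cD.
have h : @measurable _ (g_sigma_algebraType (@open 'rV[R]_m)) D.
  rewrite -(setCK D); apply: measurableC; apply: sub_sigma_algebra.
  by rewrite openC.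
exact: h.
Qed.

Lemma iterated_integral0 (R : realType) (m : nat) (f : 'rV[R]_m -> \bar R) :
  (forall t, f t = 0%E) -> iterated_integral f = 0%E.
Proof.
elim: m f => [|m IH] f f0 /=; first exact: f0.
by apply: integral0_eq => x _; exact: IH.
Qed.

(** Needed because [has_renormalized_area] asks for an area at every eps > 0, including those for
    which the truncation lies below the whole hypersurface. *)
Lemma has_area_set0 (R : realType) (m : nat) : has_area (set0 : set 'rV[R]_m.+2) 0.
Proof.
exists (fun=> 0), set0, set0, set0; split; [split|split; [split|split; [split|]]].
- exact: open0.
- by split=> [x|i]; [rewrite inE|split=> // x; rewrite inE].
- by rewrite image_set0.
- apply: closed_borel; exact: (@closed0 _).
- by [].
- by rewrite image_set0.
- apply: closed_borel; exact: (@closed0 _).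
- by apply: iterated_integral0 => t; rewrite indicE in_set0.
- by move=> x y; rewrite inE => -[].
- by apply: iterated_integral0 => t; rewrite indicE in_set0 mulr0.
Qed.

(** The area element depends on the squared norm t alone, so the area is a one-variable integral
    with weight t^k, evaluated by a primitive [B]. The chart is injective on the annulus, and the
    exceptional null set is empty. *)
Lemma has_area_radial (R : realType) (k m : nat) (phi : 'rV[R]_m -> 'rV[R]_m.+2)
    (U : set 'rV[R]_m) (S : set 'rV[R]_m.+2) (f B : R -> R) (a b : R) :
  m = (2 * k.+1)%N -> open U -> smooth_on U phi -> phi @` U `<=` hyperbolic_space R m ->
  0 <= a -> a <= b -> [set x | a <= sqnorm x <= b] `<=` U ->
  phi @` [set x | a <= sqnorm x <= b] = S ->
  {in [set x | a <= sqnorm x <= b] &, injective phi} ->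
  (forall t, a <= t <= b -> 0 <= f t) ->
  (forall x, a <= sqnorm x <= b -> area_element phi x = f (sqnorm x)) ->
  (forall t, a <= t <= b -> {for t, continuous f}) ->
  (forall t, a <= t <= b -> is_derive t 1 B (f t * t ^+ k)) ->
  has_area S (pi ^+ k.+1 / k`!%:R * (B b - B a)).
Proof.
move=> mE oU sphi phiH a0 ab DU phiD inj f0 area cf dB.
pose D := [set x : 'rV[R]_m | a <= sqnorm x <= b].
exists phi, U, D, set0; split; [split|split; [split|split; [split|]]] => //.
- apply: closed_borel.
  have -> : D = @sqnorm R m @^-1` `[a, b] by apply/seteqP; split=> x /=; rewrite in_itv.
  by apply: closed_comp; [move=> x _; exact: continuous_sqnorm|exact: itv_closed].
- apply: closed_borel; exact: (@closed0 _).
- by apply: iterated_integral0 => t; rewrite indicE in_set0.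
- by rewrite setD0.
(* Extension by zero absorbs the indicator of the annulus and makes the integrand measurable and
   nonnegative on the whole line. *)
pose F (t : R) : \bar R := ((EFin \o f) \_ `[a, b]) t.
have mab : measurable (`[a, b]%classic : set R) by exact: measurable_itv.
have wf : {within `[a, b], continuous f}.
  by apply/continuous_in_subspaceT => t /set_mem; rewrite /= in_itv/= => /cf.
have mF : measurable_fun setT F.
  apply/(measurable_restrictT _ mab)/measurable_EFinP.
  by apply: subspace_continuous_measurable_fun.
have F0 t : (0 <= F t)%E.
  by rewrite /F /patch mem_setE in_itv/=; case: ifPn => // /f0; rewrite lee_fin.
transitivity (iterated_integral (fun x : 'rV[R]_m => F (sqnorm x))).
  congr iterated_integral; apply/funext => x; rewrite /F /patch mem_setE in_itv/= indicE.
  case: ifPn => h; first by rewrite mem_set// mulr1 area.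
  by rewrite memNset ?mulr0//; exact/negP.
rewrite (iterated_integral_radial mE mF F0) [RHS]EFinM; congr (_ * _)%E.
transitivity (\int[lebesgue_measure]_(t in `[a, b]) (f t * t ^+ k)%:E)%E.
  rewrite integral_mkcond [RHS]integral_mkcond; apply: eq_integral => t _.
  rewrite /F /patch !mem_setE !in_itv/= andbT; case: (boolP (a <= t <= b)) => h.
    by have /andP[at_ _] := h; rewrite (le_trans a0 at_).
  by rewrite mul0e if_same.
(* The annulus degenerates when the truncation height is the least height of the hypersurface; the
   fundamental theorem needs a < b. *)
move: ab; rewrite le_eqVlt => /predU1P[ab|ab].
  by rewrite -ab set_itv1 integral_set1 subrr.
rewrite (@continuous_FTC2 R (fun t => f t * t ^+ k) B) ?EFinB//.
- apply/continuous_in_subspaceT => t /set_mem; rewrite /= in_itv/= => /cf ct.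
  by apply: cvgM => //; exact: exprn_continuous.
- split.
  + by move=> t; rewrite in_itv/= => /andP[h1 h2]; case: (dB t); rewrite ?(ltW h1) ?(ltW h2).
  + apply: cvg_at_right_filter; apply: is_derive_continuous (dB a _).
    by rewrite lexx ltW.
  + apply: cvg_at_left_filter; apply: is_derive_continuous (dB b _).
    by rewrite lexx ltW.
- move=> t; rewrite in_itv/= => /andP[h1 h2]; rewrite derive1E.
  by case: (dB t); rewrite ?(ltW h1) ?(ltW h2).
Qed.

Section cylinder.
Variables (R : realType) (m : nat) (sigma : 'I_m -> 'I_m.+2) (b : 'I_m.+2).
Hypothesis sigma_inj : injective sigma.
Hypothesis sigma_max : forall i, sigma i != ord_max.
Hypothesis sigma_b : forall i, sigma i != b.
Hypothesis b_max : b != ord_max.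
Hypothesis cover : forall j, [\/ j = ord_max, j = b | exists i, j = sigma i].
Local Notation emb := (coordinate_embedding sigma).

Definition axis (beta zeta : R) : 'rV[R]_m.+2 :=
  beta *: delta_mx 0 b + zeta *: delta_mx 0 ord_max.

Lemma axis_sigma beta zeta i : axis beta zeta 0 (sigma i) = 0.
Proof.
by rewrite !mxE eqxx (negbTE (sigma_b i)) (negbTE (sigma_max i)) !mulr0 addr0.
Qed.

Lemma axis_b beta zeta : axis beta zeta 0 b = beta.
Proof. by rewrite !mxE !eqxx (negbTE b_max) mulr1 mulr0 addr0. Qed.

Lemma axis_max beta zeta : axis beta zeta 0 ord_max = zeta.
Proof. by rewrite !mxE !eqxx eq_sym (negbTE b_max) mulr1 mulr0 add0r. Qed.

Lemma minkowski_axis beta zeta beta' zeta' :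
  minkowski (axis beta zeta) (axis beta' zeta') = beta * beta' - zeta * zeta'.
Proof.
rewrite minkowskiDl !minkowskiZl minkowski_deltal// minkowski_delta_max axis_b axis_max.
by rewrite mulrN.
Qed.

Lemma minkowski_emb_axis y beta zeta : minkowski (emb y) (axis beta zeta) = 0.
Proof.
by rewrite minkowski_embl// big1// => i _; rewrite axis_sigma mulr0.
Qed.

Lemma minkowski_emb (y y' : 'rV[R]_m) : minkowski (emb y) (emb y') = \sum_i y 0 i * y' 0 i.
Proof.
by rewrite minkowski_embl//; apply: eq_bigr => i _; rewrite coordinate_embeddingE.
Qed.

Lemma minkowski_cylinder y beta zeta :
  minkowski (emb y + axis beta zeta) (emb y + axis beta zeta) =
  sqnorm y + beta ^+ 2 - zeta ^+ 2.
Proof.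
have h1 := minkowski_axis beta zeta beta zeta; have h2 := minkowski_emb_axis y beta zeta.
have h3 : minkowski (emb y) (emb y) = sqnorm y.
  by rewrite minkowski_emb; apply: eq_bigr => i _; rewrite expr2.
move: (axis beta zeta) (emb y) h1 h2 h3 => A e h1 h2 h3.
by rewrite minkowskiDl !minkowskiDr h1 h2 h3 [minkowski A e]minkowskiC h2; ring.
Qed.

Lemma cylinder_coord y beta zeta :
  [/\ forall i, (emb y + axis beta zeta) 0 (sigma i) = y 0 i,
      (emb y + axis beta zeta) 0 b = beta
    & (emb y + axis beta zeta) 0 ord_max = zeta].
Proof.
split=> [i||]; rewrite mxE.
- by rewrite coordinate_embeddingE// axis_sigma addr0.
- by rewrite coordinate_embedding_out// axis_b add0r.
- by rewrite coordinate_embedding_out// axis_max add0r.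
Qed.

Lemma cylinder_decomp (x : 'rV[R]_m.+2) :
  x = emb (\row_i x 0 (sigma i)) + axis (x 0 b) (x 0 ord_max).
Proof.
apply/rowP => j; have [h1 h2 h3] := cylinder_coord (\row_i x 0 (sigma i)) (x 0 b) (x 0 ord_max).
case: (cover j) => [->|->|[i ->]]; first by rewrite h3.
  by rewrite h2.
by rewrite h1 mxE.
Qed.

Definition cylindrical (a beta zeta : R -> R) : 'rV[R]_m -> 'rV[R]_m.+2 :=
  radial sigma a (fun t => axis (beta t) (zeta t)).

Lemma cylindricalE a beta zeta x : cylindrical a beta zeta x =
  emb (a (sqnorm x) *: x) + axis (beta (sqnorm x)) (zeta (sqnorm x)).
Proof.
rewrite /cylindrical /radial; congr (_ + _).
rewrite /coordinate_embedding scaler_sumr; apply: eq_bigr => i _.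
by rewrite mxE scalerA.
Qed.

Lemma der_axis (beta zeta : R -> R) (t db dz : R) :
  is_derive t 1 beta db -> is_derive t 1 zeta dz ->
  forall j, is_derive t 1 (fun t => axis (beta t) (zeta t) 0 j) (axis db dz 0 j).
Proof.
move=> hb hz j.
have -> : (fun t => axis (beta t) (zeta t) 0 j) = (fun t =>
    beta t * (delta_mx 0 b : 'rV[R]_m.+2) 0 j + zeta t * (delta_mx 0 ord_max : 'rV[R]_m.+2) 0 j).
  by apply/funext => s; rewrite !mxE.
apply: (is_derive_eq (der_add (der_mul hb (der_cst _)) (der_mul hz (der_cst _)))).
by rewrite !mxE !mulr0 !addr0.
Qed.

Lemma det_first_fundamental_form_cylindrical (a beta zeta : R -> R) (x : 'rV[R]_m) (da db dz : R) :
  is_derive (sqnorm x) 1 a da -> is_derive (sqnorm x) 1 beta db ->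
  is_derive (sqnorm x) 1 zeta dz -> a (sqnorm x) != 0 ->
  \det (first_fundamental_form (cylindrical a beta zeta) x) =
  (a (sqnorm x) ^+ 2) ^+ m * (1 + 4 * (a (sqnorm x) * da + sqnorm x * da ^+ 2 +
    (db ^+ 2 - dz ^+ 2)) / a (sqnorm x) ^+ 2 * sqnorm x).
Proof.
move=> ha hb hz a0.
have := first_fundamental_form_radial sigma_inj sigma_max ha (der_axis hb hz)
  (axis_sigma db dz).
rewrite /cylindrical => ->.
by rewrite det_scalar_add_rank1 ?expf_neq0// minkowski_axis -!expr2.
Qed.

Lemma cylindrical_smooth_on (U : set 'rV[R]_m) (G : set ('rV[R]_m -> R)) a beta zeta :
  open U -> (forall g, G g -> {in U, continuous g}) ->
  (forall g (i : 'I_m), G g -> generated_derivative U (delta_mx 0 i) G g) ->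
  @coordinates R m `<=` G ->
  (exists2 h, generated G h & forall x, U x -> a (sqnorm x) = h x) ->
  (exists2 h, generated G h & forall x, U x -> beta (sqnorm x) = h x) ->
  (exists2 h, generated G h & forall x, U x -> zeta (sqnorm x) = h x) ->
  smooth_on U (cylindrical a beta zeta).
Proof.
move=> oU cG dG hG [ga a1 a2] [gb b1 b2] [gz z1 z2]; apply: (generated_smooth_on oU cG dG) => j.
have E x : cylindrical a beta zeta x 0 j = _ := congr1 (fun y : 'rV_ _ => y 0 j) (cylindricalE a beta zeta x).
case: (cover j) => [jE|jE|[i jE]].
- by exists gz => // x Ux; rewrite E jE; have [_ _ ->] := cylinder_coord (a (sqnorm x) *: x) (beta (sqnorm x)) (zeta (sqnorm x)); exact: z2.
- by exists gb => // x Ux; rewrite E jE; have [_ -> _] := cylinder_coord (a (sqnorm x) *: x) (beta (sqnorm x)) (zeta (sqnorm x)); exact: b2.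
- exists (fun x => ga x * x 0 i).
    by apply: generated_mul => //; apply: generated_in; apply: hG; exists i.
  move=> x Ux; rewrite E jE; have [-> _ _] := cylinder_coord (a (sqnorm x) *: x) (beta (sqnorm x)) (zeta (sqnorm x)).
  by rewrite mxE a2.
Qed.

End cylinder.

(** * The totally geodesic hypersurface *)

Section totally_geodesic.
Variables (R : realType) (k : nat).
Local Notation m := (2 * k.+1)%N.

(* The coordinates of H^{2n} in R^{2n+1,1}, all but the second and the last. *)
Definition skip_second (i : 'I_m) : 'I_m.+2 :=
  inord (if i == 0%N :> nat then 0%N else i.+1).

Let skip_secondE (i : 'I_m) : skip_second i = (if i == 0%N :> nat then 0%N else i.+1) :> nat.
Proof. by rewrite /skip_second inordK//; case: ifP => // _; rewrite ltnS (leq_trans (ltn_ord i)). Qed.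

Let second : 'I_m.+2 := inord 1.

Let secondE : second = 1%N :> nat. Proof. by rewrite /second inordK. Qed.

Let skip_second_inj : injective skip_second.
Proof.
move=> i j /(congr1 val) /=; rewrite !skip_secondE => h; apply: val_inj => /=.
by move: h; case: eqP => [->|_]; case: eqP => [->|_] //= [].
Qed.

Let skip_second_max i : skip_second i != ord_max.
Proof.
apply/eqP => /(congr1 val) /=; rewrite skip_secondE; case: ifP => [_|_]; first by [].
by move=> [E]; have := ltn_ord i; rewrite E ltnn.
Qed.

Let skip_second_neq i : skip_second i != second.
Proof.
apply/eqP => /(congr1 val) /=; rewrite skip_secondE secondE; case: ifP => // h [] E.
by rewrite E eqxx in h.
Qed.

Let second_max : second != ord_max.
Proof. by apply/eqP => /(congr1 val) /=; rewrite secondE; lia. Qed.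

Let skip_second_cover j : [\/ j = ord_max, j = second | exists i, j = skip_second i].
Proof.
have [j0|j0] := posnP j.
  apply: Or33; have m0 : (0 < m)%N by [].
  by exists (Ordinal m0); apply: val_inj; rewrite /= skip_secondE /= j0.
have [j1|j1] := eqVneq (val j) 1%N; first by apply: Or32; apply: val_inj; rewrite /= secondE.
have [jm|jm] := eqVneq (val j) m.+1; first by apply: Or31; apply: val_inj.
apply: Or33; have jl : (j.-1 < m)%N by have := ltn_ord j; move: j0 j1 jm => /=; lia.
exists (Ordinal jl); apply: val_inj; rewrite /= skip_secondE /=.
by move: j0 j1 {jm jl} => /=; case: (nat_of_ord j) => [|[|l]].
Qed.

Let graph : 'rV[R]_m -> 'rV[R]_m.+2 :=
  cylindrical skip_second second (fun=> 1) (fun=> 0) (fun t => Num.sqrt (1 + t)).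

Let graphE x : graph x = coordinate_embedding skip_second x +
  axis second 0 (Num.sqrt (1 + sqnorm x)).
Proof. by rewrite /graph cylindricalE scale1r. Qed.

Let z (x : 'rV[R]_m) := Num.sqrt (1 + sqnorm x).

Let z_gt0 x : 0 < z x.
Proof. by rewrite sqrtr_gt0 ltr_pwDl// sqnorm_ge0. Qed.

Let z_sqr x : z x ^+ 2 = 1 + sqnorm x.
Proof. by rewrite sqr_sqrtr// addr_ge0// sqnorm_ge0. Qed.

Let der_z (x : 'rV[R]_m) i : is_derive x (delta_mx 0 i) z (x 0 i / z x).
Proof.
have z0 : 0 < 1 + sqnorm x by rewrite ltr_pwDl// sqnorm_ge0.
apply: (is_derive_eq (der_sqrt (der_add (der_cst 1) (der_sqnorm x i)) z0)).
by rewrite add0r -/(z x); field; rewrite gt_eqF.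
Qed.

Let graph_smooth : smooth_on setT graph.
Proof.
pose G : set ('rV[R]_m -> R) :=
  [set f | coordinates f \/ f = z \/ f = (fun x => (z x)^-1)].
have cz : continuous z.
  have cs : continuous (fun t : R => Num.sqrt (1 + t)).
    move=> t; apply: (@continuous_comp _ _ _ (fun t : R => 1 + t) Num.sqrt).
      by apply: cvgD; [exact: cvg_cst|exact: cvg_id].
    exact: sqrt_continuous.
  move=> x; apply: (@continuous_comp _ _ _ (@sqnorm R m) (fun t : R => Num.sqrt (1 + t))).
    exact: continuous_sqnorm.
  exact: cs.
apply: (cylindrical_smooth_on skip_second_inj skip_second_max skip_second_neq second_max
  skip_second_cover (G := G)).
- exact: openT.
- move=> g [[i ->]|[->|->]] x _; [exact: coord_continuous|exact: cz|].
  apply: (@continuous_comp _ _ _ z GRing.inv); first exact: cz.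
  by apply: cvgV; [rewrite gt_eqF|exact: cvg_id].
- have gz : generated G z by apply: generated_in; right; left.
  have gi : generated G (fun x => (z x)^-1) by apply: generated_in; right; right.
  have gc i : generated G (fun x => x 0 i) by apply: generated_in; left; exists i.
  move=> g i [[j ->]|[->|->]].
  + exists (fun=> (delta_mx 0 i : 'rV[R]_m) 0 j); first exact: generated_cst.
    by move=> x _; exact: is_derive_coord.
  + exists (fun x : 'rV[R]_m => x 0 i * (z x)^-1); first exact: generated_mul.
    by move=> x _; exact: der_z.
  + exists (fun x : 'rV[R]_m => - (x 0 i * (z x)^-1 ^+ 3)).
      by apply/generated_opp/generated_mul => //; exact: generated_exp.
    move=> x _; have z0 : z x != 0 by rewrite gt_eqF.
    by apply: (is_derive_eq (der_inv (der_z x i) z0)); field.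
- by move=> f [i ->]; left; exists i.
- by exists (fun=> 1) => //; exact: generated_cst.
- by exists (fun=> 0) => //; exact: generated_cst.
- by exists z => //; apply: generated_in; right; left.
Qed.

Let graph_coord x : [/\ forall i, graph x 0 (skip_second i) = x 0 i,
  graph x 0 second = 0 & graph x 0 ord_max = z x].
Proof.
by rewrite graphE; exact: (cylinder_coord skip_second_inj skip_second_max skip_second_neq second_max).
Qed.

Let graph_inj : injective graph.
Proof.
move=> x y E; apply/rowP => i; have [hx _ _] := graph_coord x; have [hy _ _] := graph_coord y.
by rewrite -hx -hy E.
Qed.

Let graph_hyperbolic x : hyperbolic_space R m (graph x).
Proof.
split; last by have [_ _ ->] := graph_coord x.
rewrite graphE (minkowski_cylinder skip_second_inj skip_second_max skip_second_neq second_max).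
by rewrite -/(z x) z_sqr; ring.
Qed.

Let graph_area x : area_element graph x = (z x)^-1.
Proof.
have z0 : 0 < 1 + sqnorm x by rewrite ltr_pwDl// sqnorm_ge0.
rewrite /area_element (det_first_fundamental_form_cylindrical skip_second_inj skip_second_max
  skip_second_neq second_max (der_cst 1) (der_cst 0)
  (der_sqrt (der_add (der_cst 1) (is_derive_id (sqnorm x) 1)) z0)) ?oner_eq0//.
rewrite -/(z x) !expr1n mul1r.
have -> : 1 + 4 * (1 * 0 + sqnorm x * 0 ^+ 2 + (0 ^+ 2 - ((0 + 1) / (2 * z x)) ^+ 2)) / 1 *
    sqnorm x = (z x)^-1 ^+ 2.
  rewrite -[sqnorm x](addKr 1) -z_sqr; field.
  by rewrite gt_eqF.
by rewrite sqrtr_sqr ger0_norm// invr_ge0 ltW.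
Qed.

Let primitive t : R := 2 * (area_poly R k).[t] * Num.sqrt (1 + t).

Let der_primitive (t : R) : 0 <= t ->
  is_derive t 1 primitive ((Num.sqrt (1 + t))^-1 * t ^+ k).
Proof.
move=> t0; have z0 : 0 < 1 + t by rewrite ltr_pwDl.
apply: (is_derive_eq (der_mul (der_mul (der_cst 2) (der_horner _ (is_derive_id t 1)))
  (der_sqrt (der_add (der_cst 1) (is_derive_id t 1)) z0))).
rewrite -(area_poly_ode k t).
have s0 : Num.sqrt (1 + t) != 0 by rewrite gt_eqF// sqrtr_gt0.
have : Num.sqrt (1 + t) ^+ 2 = 1 + t by rewrite sqr_sqrtr// ltW.
move: (Num.sqrt (1 + t)) s0 => s s0 <- /=.
by field.
Qed.

(** On the boundary of the truncation sqrt (1 + t) = 1 / eps, so the upper end of the primitive is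
    exactly a polynomial in 1 / eps divisible by its variable. The constant term is the contribution
    of the lower end t = 0, that is - 2 C P(0). *)
Lemma totally_geodesic_has_renormalized_area :
  has_renormalized_area (totally_geodesic_H2n R k.+1)
    ((- (4 * pi)) ^+ k.+1 * k.+1`!%:R / m`!%:R).
Proof.
pose C : R := pi ^+ k.+1 / k`!%:R.
pose P := area_poly R k.
(* H^(2n) lies in z >= 1, so its truncation is empty for e > 1; otherwise z <= 1/e means that the
   squared norm is at most 1/e^2 - 1. *)
pose A (e : R) := if e <= 1 then C * (primitive (e^-1 ^+ 2 - 1) - primitive 0) else 0.
pose p : {poly R} := (2 * C) *: ('X * (P \Po ('X^2 - 1%:P))).
exists A, p; split.
- move=> e e0; rewrite /A.
  have truncE (x : 'rV[R]_m.+2) : truncation (totally_geodesic_H2n R k.+1) e x ->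
      exists2 y : 'rV[R]_m, graph y = x & 1 + sqnorm y <= e^-1 ^+ 2.
    move=> [[[xx x0]]]; rewrite /= -/second => xs xe.
    have D := cylinder_decomp skip_second_inj skip_second_max skip_second_neq second_max
      skip_second_cover x.
    pose y := \row_i x 0 (skip_second i).
    have x2 : x 0 ord_max ^+ 2 = 1 + sqnorm y.
      move: xx; rewrite {1 2}D (minkowski_cylinder skip_second_inj skip_second_max
        skip_second_neq second_max) xs -/y => h.
      rewrite expr0n addr0 in h; lra.
    have zx : z y = x 0 ord_max by rewrite /z -x2 sqrtr_sqr gtr0_norm.
    exists y; first by rewrite graphE -/(z y) zx [RHS]D xs.
    by rewrite -x2 ler_sqr ?nnegrE ?invr_ge0 ?(ltW e0) ?(ltW x0).
  case: ifPn => e1; last first.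
    suff -> : truncation (totally_geodesic_H2n R k.+1) e = set0 by exact: has_area_set0.
    apply/seteqP; split=> // x /truncE[y _]; rewrite leNgt => /negP; apply.
    apply: (@lt_le_trans _ _ 1); last by rewrite lerDl sqnorm_ge0.
    have ei0 : 0 <= e^-1 by rewrite invr_ge0; exact: ltW.
    by rewrite expr_lt1// invf_lt1// ltNge.
  have ei : 1 <= e^-1 by rewrite invf_ge1.
  have T0 : 0 <= e^-1 ^+ 2 - 1 by rewrite subr_ge0 expr_ge1// (le_trans ler01).
  apply: (@has_area_radial R k m graph setT _ (fun t => (Num.sqrt (1 + t))^-1)) => //.
  + exact: openT.
  + by move=> _ [x _ <-]; exact: graph_hyperbolic.
  + apply/seteqP; split=> [_ [x /= /andP[_ hx] <-]|x hx].
      have [_ h2 h3] := graph_coord x.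
      split; first by split; [exact: graph_hyperbolic|rewrite /= -/second h2].
      rewrite /= h3; apply: ler_of_sqr; first exact: le_trans ei.
      by rewrite z_sqr; lra.
    have [y yx hy] := truncE x hx; exists y => //=; rewrite sqnorm_ge0 /=; lra.
  + by move=> x y _ _; exact: graph_inj.
  + move=> t /andP[t0 _]; have z0 : 0 < 1 + t by rewrite ltr_pwDl.
    apply: cvgV; first by rewrite gt_eqF// sqrtr_gt0.
    exact: is_derive_continuous (der_sqrt (der_add (der_cst 1) (is_derive_id t 1)) z0).
  + by move=> t /andP[t0 _]; exact: der_primitive.
- by rewrite hornerZ hornerM hornerX mul0r mulr0.
have -> : (- (4 * pi)) ^+ k.+1 * k.+1`!%:R / m`!%:R = - (C * primitive 0).
  rewrite /primitive addr0 sqrtr1 area_poly0 /C.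
  have -> : (- (4 * pi)) ^+ k.+1 = (-4) ^+ k.+1 * pi ^+ k.+1 :> R by rewrite -exprMn; congr (_ ^+ _); ring.
  have f0 : k`!%:R != 0 :> R by rewrite pnatr_eq0 -lt0n fact_gt0.
  have g0 : m`!%:R != 0 :> R by rewrite pnatr_eq0 -lt0n fact_gt0.
  move: (k`!%:R) f0 (m`!%:R) g0 (k.+1`!%:R) => f f0 g g0 h.
  by field; rewrite f0 g0.
apply: cvg_near_cst; near=> e.
have e0 : 0 < e by near: e; exact: nbhs_right_gt.
have e1 : e <= 1 by near: e; exact: nbhs_right_le.
rewrite /A e1 /p !(hornerZ, hornerM, hornerX) horner_comp hornerD hornerN hornerXn hornerC.
rewrite /primitive addrCA subrr addr0 sqrtr_sqr ger0_norm; last by rewrite invr_ge0; exact: ltW.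
by rewrite -/P; ring.
Unshelve. all: by end_near. Qed.

End totally_geodesic.

(** * Parametrization and area of the catenoid *)

Section lower_coordinates.
Variable k : nat.
Local Notation m := (2 * k.+1)%N.

Definition low_index (i : 'I_m) : 'I_m.+2 := inord i.
Definition axis_index : 'I_m.+2 := inord m.

Lemma low_indexE i : low_index i = i :> nat.
Proof. by rewrite /low_index inordK// (ltn_trans (ltn_ord i))// ltnS. Qed.

Lemma axis_indexE : axis_index = m :> nat.
Proof. by rewrite /axis_index inordK. Qed.

Lemma low_index_inj : injective low_index.
Proof. by move=> i j /(congr1 val) /=; rewrite !low_indexE => /val_inj. Qed.

Lemma low_index_max i : low_index i != ord_max.
Proof.
apply/eqP => /(congr1 val) /=; rewrite low_indexE => E.
by have := ltn_ord i; rewrite E ltnNge leqnSn.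
Qed.

Lemma low_index_axis i : low_index i != axis_index.
Proof.
apply/eqP => /(congr1 val) /=; rewrite low_indexE axis_indexE => E.
by have := ltn_ord i; rewrite E ltnn.
Qed.

Lemma axis_index_max : axis_index != ord_max.
Proof.
by apply/eqP => /(congr1 val) /=; rewrite axis_indexE => /eqP; rewrite eqn_leq ltnn andbF.
Qed.

Lemma low_index_cover j : [\/ j = ord_max, j = axis_index | exists i, j = low_index i].
Proof.
have [jm|jm] := eqVneq (val j) m.+1; first by apply: Or31; apply: val_inj.
have [j1|j1] := eqVneq (val j) m; first by apply: Or32; apply: val_inj; rewrite /= axis_indexE.
apply: Or33; have jl : (j < m)%N.
  have := ltn_ord j; rewrite !ltnS leq_eqVlt (negbTE jm) /= ltnS.
  by rewrite leq_eqVlt (negbTE j1).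
by exists (Ordinal jl); apply: val_inj; rewrite /= low_indexE.
Qed.

End lower_coordinates.

Section catenoid_parametrization.
Variables (R : realType) (k : nat) (c tau : R) (w : R -> R).
Hypothesis c0 : 0 < c.
Hypothesis tau0 : 0 < tau.
Local Notation N := (k.*2.+1%:R : R).
Hypothesis hK : tau ^+ k.*2.+1 * (1 + tau) * (c ^+ 2) ^+ k.*2.+2 = (N ^+ 2) ^+ k.*2.+1.
Hypothesis hw : is_catenary k tau w.
Local Notation m := (2 * k.+1)%N.
Local Notation r := (radius tau w).
Local Notation p := (speed k tau w).
Local Notation q := (flux k tau w).
Local Notation v := (catenoid_v k.+1 c).
Local Notation U := (punctured (R := R) (m := m)).
Local Notation emb := (coordinate_embedding (@low_index k)).
Local Notation ax := (axis (axis_index k)).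

Definition lorentz s := Num.sqrt (1 + r s ^+ 2).
Local Notation rho := lorentz.
Definition depth s := rho s * sinh (v s).
Definition height s := rho s * cosh (v s).
Definition log_norm (x : 'rV[R]_m) := ln (sqnorm x) / 2.
Local Notation L := log_norm.

Definition catenoid_map : 'rV[R]_m -> 'rV[R]_m.+2 :=
  cylindrical (@low_index k) (axis_index k)
    (fun t => r (ln t / 2) * expR (- (ln t / 2)))
    (fun t => depth (ln t / 2)) (fun t => height (ln t / 2)).

Let r0 s : 0 < r s. Proof. exact: radius_gt0. Qed.
Let q0 s : 0 < q s. Proof. exact: flux_gt0. Qed.

Lemma lorentz_gt0 s : 0 < rho s.
Proof. by rewrite sqrtr_gt0 addr_gt0// exprn_gt0. Qed.

Lemma lorentz_sqr s : rho s ^+ 2 = 1 + r s ^+ 2.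
Proof. by rewrite sqr_sqrtr// addr_ge0// sqr_ge0. Qed.

Lemma speed_flux s : p s ^+ 2 + q s ^+ 2 = rho s ^+ 2.
Proof. by rewrite lorentz_sqr speed_sqr// subrK. Qed.

Lemma height_depth s : height s ^+ 2 - depth s ^+ 2 = rho s ^+ 2.
Proof.
rewrite /height /depth; have := cosh2_sinh2 (v s).
move: (rho s) (cosh (v s)) (sinh (v s)) => a b d h.
have -> : (a * b) ^+ 2 - (a * d) ^+ 2 = a ^+ 2 * (b ^+ 2 - d ^+ 2) by ring.
by rewrite h mulr1.
Qed.

Lemma der_lorentz (s : R) : is_derive s 1 rho (r s * p s / rho s).
Proof.
have h0 : 0 < 1 + r s ^+ 2 by rewrite addr_gt0// exprn_gt0.
apply: (is_derive_eq (der_sqrt (der_add (der_cst 1) (der_exp 2 (der_radius tau0 hw s))) h0)).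
have := lorentz_gt0 s; rewrite /lorentz /= => l0.
by field; rewrite gt_eqF.
Qed.

Lemma der_v (s : R) : is_derive s 1 v (- (q s / rho s ^+ 2)).
Proof. by rewrite lorentz_sqr; exact: der_catenoid_v. Qed.

Lemma der_depth (s : R) :
  is_derive s 1 depth ((r s * p s * sinh (v s) - q s * cosh (v s)) / rho s).
Proof.
apply: (is_derive_eq (der_mul (der_lorentz s) (der_sinh (der_v s)))).
by field; rewrite gt_eqF// lorentz_gt0.
Qed.

Lemma der_height (s : R) :
  is_derive s 1 height ((r s * p s * cosh (v s) - q s * sinh (v s)) / rho s).
Proof.
apply: (is_derive_eq (der_mul (der_lorentz s) (der_cosh (der_v s)))).
by field; rewrite gt_eqF// lorentz_gt0.
Qed.

Lemma v_decr a b : a < b -> v b < v a.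
Proof.
move=> ab; rewrite -ltrN2; apply: (derive_gt0_lt (fun s => der_opp (der_v s))) => // s _ _.
by rewrite opprK divr_gt0// exprn_gt0// lorentz_gt0.
Qed.

Lemma v_inj : injective v.
Proof. by move=> a b E; case: (ltgtP a b) => // /v_decr; rewrite E ltxx. Qed.

Lemma vN s : v (- s) = - v s.
Proof.
apply/eqP; rewrite -addr_eq0; apply/eqP.
have d (z : R) : is_derive z 1 (fun z => v (- z) + v z) 0.
  apply: (is_derive_eq (der_add (is_derive_comp1 (der_opp (is_derive_id z 1)) (der_v _)) (der_v z))).
  by rewrite (fluxN hw) /lorentz (radiusN hw); ring.
by rewrite (derive0_eq s 0 d) oppr0 (catenoid_v0 k c) addr0.
Qed.

Lemma heightN s : height (- s) = height s.
Proof. by rewrite /height /lorentz (radiusN hw) vN coshN. Qed.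

Lemma height_gt0 s : 0 < height s.
Proof. by rewrite mulr_gt0 ?lorentz_gt0// (lt_le_trans ltr01)// cosh_ge1. Qed.

(** For s > 0 one has v < 0 and p >= 0, so both terms of r p cosh v - q sinh v help. As the height
    is even, its sublevel sets are the intervals |s| <= a. *)
Lemma height_incr a b : 0 <= a -> a < b -> height a < height b.
Proof.
move=> a0 ab; apply: (derive_gt0_lt der_height) => // s ha hb.
have s0 : 0 < s by exact: le_lt_trans ha.
rewrite divr_gt0 ?lorentz_gt0//.
have vs : v s < 0 by rewrite -(catenoid_v0 k c); exact: v_decr.
have h1 : 0 < sinh (- v s) by rewrite sinh_gt0// oppr_gt0.
have h2 : sinh (- v s) = - sinh (v s) by rewrite /sinh opprK; ring.
have h3 := cosh_ge1 (v s).
have h4 : 0 <= p s by apply: speed_ge0 => //; exact: ltW.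
have h5 : 0 <= r s * p s * cosh (v s).
  by apply: mulr_ge0; [apply: mulr_ge0 => //; exact: ltW|lra].
have h6 : 0 < q s * sinh (- v s) by rewrite mulr_gt0.
rewrite h2 mulrN in h6; lra.
Qed.

Lemma height_ge s : Num.sqrt tau * `|w s| <= height s.
Proof.
apply: (le_trans (radius_ge tau0 w s)).
have h : r s <= rho s.
  by apply: ler_of_sqr; [rewrite ltW// lorentz_gt0|rewrite lorentz_sqr lerDr].
apply: (le_trans h); rewrite -[leLHS]mulr1 ler_wpM2l ?cosh_ge1//.
by rewrite ltW// lorentz_gt0.
Qed.

Lemma height_le (H : R) : height 0 <= H -> exists2 s, 0 <= s & height s = H.
Proof.
move=> H0; have [s1 ws1] : exists s, w s = H / Num.sqrt tau by case: hw.
have t0 : 0 < Num.sqrt tau by rewrite sqrtr_gt0.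
have Hs1 : H <= height s1.
  apply: le_trans (height_ge s1); rewrite ws1 mulrC -ler_pdivrMr//; exact: ler_norm.
have {}Hs1 : H <= height `|s1|.
  have [h|h] := leP 0 s1; first by rewrite (ger0_norm h); exact: Hs1.
  by rewrite (ltr0_norm h) heightN; exact: Hs1.
have cH : {within `[0, `|s1|], continuous height} by exact: (is_derive_within der_height).
have hH : Num.min (height 0) (height `|s1|) <= H <= Num.max (height 0) (height `|s1|).
  apply/andP; split; [rewrite ge_min|rewrite le_max]; apply/orP; first by left; exact: H0.
  by right; exact: Hs1.
have [s hs <-] := IVT (normr_ge0 s1) cH hH.
by exists s => //; move: hs; rewrite in_itv/= => /andP[].
Qed.

Lemma log_normK x : U x -> expR (- L x) ^+ 2 = (sqnorm x)^-1.
Proof.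
move=> Ux; have E : - L x + - L x = - ln (sqnorm x) by rewrite /log_norm; lra.
by rewrite expr2 -expRD E expRN lnK.
Qed.

Lemma catenoid_mapE x : catenoid_map x =
  emb ((r (L x) * expR (- L x)) *: x) + ax (depth (L x)) (height (L x)).
Proof. by rewrite /catenoid_map cylindricalE. Qed.

Lemma sqnorm_catenoid_map x : U x ->
  sqnorm ((r (L x) * expR (- L x)) *: x) = r (L x) ^+ 2.
Proof.
move=> Ux; rewrite sqnormZ exprMn log_normK// -mulrA mulVf ?mulr1//.
by rewrite gt_eqF.
Qed.

Lemma catenoid_map_hyperbolic x : U x -> hyperbolic_space R m (catenoid_map x).
Proof.
move=> Ux; rewrite catenoid_mapE; split; last first.
  have [_ _ ->] := cylinder_coord (@low_index_inj k) (@low_index_max k) (@low_index_axis k)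
    (axis_index_max k) ((r (L x) * expR (- L x)) *: x) (depth (L x)) (height (L x)).
  exact: height_gt0.
rewrite (minkowski_cylinder (@low_index_inj k) (@low_index_max k) (@low_index_axis k)
  (axis_index_max k)) sqnorm_catenoid_map//.
by have := height_depth (L x); rewrite lorentz_sqr; lra.
Qed.

Lemma catenoid_map_coord x : [/\
  forall i, catenoid_map x 0 (low_index i) = r (L x) * expR (- L x) * x 0 i,
  catenoid_map x 0 (axis_index k) = depth (L x)
  & catenoid_map x 0 ord_max = height (L x)].
Proof.
rewrite catenoid_mapE.
have [h1 -> ->] := cylinder_coord (@low_index_inj k) (@low_index_max k) (@low_index_axis k)
    (axis_index_max k) ((r (L x) * expR (- L x)) *: x) (depth (L x)) (height (L x)).
by split=> // i; rewrite h1 mxE.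
Qed.

(** height^2 - depth^2 = rho^2 recovers rho, then the depth gives sinh v, and v is strictly
    decreasing, so s is determined. The radius alone would not distinguish s from - s. *)
Lemma catenoid_map_inj : {in U &, injective catenoid_map}.
Proof.
move=> x y /set_mem Ux /set_mem Uy E.
have [x1 x2 x3] := catenoid_map_coord x; have [y1 y2 y3] := catenoid_map_coord y.
have D := etrans (esym x2) (etrans (congr1 (fun z : 'rV[R]_m.+2 => z 0 (axis_index k)) E) y2).
have H := etrans (esym x3) (etrans (congr1 (fun z : 'rV[R]_m.+2 => z 0 ord_max) E) y3).
have X i := etrans (esym (x1 i))
  (etrans (congr1 (fun z : 'rV[R]_m.+2 => z 0 (low_index i)) E) (y1 i)).
move: (L x) (L y) D H X {x1 x2 x3 y1 y2 y3} => a b D H X.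
have r2 : rho a ^+ 2 = rho b ^+ 2.
  exact: etrans (esym (height_depth a))
    (etrans (congr2 (fun x y => x ^+ 2 - y ^+ 2) H D) (height_depth b)).
have rr : rho a = rho b.
  exact: (pexpIrn (isT : (0 < 2)%N) (ltW (lorentz_gt0 a)) (ltW (lorentz_gt0 b)) r2).
have ra : rho a != 0 := lt0r_neq0 (lorentz_gt0 a).
have Es : rho a * sinh (v a) = rho a * sinh (v b).
  exact: etrans D (congr1 (fun z => z * sinh (v b)) (esym rr)).
have ab : a = b := v_inj (sinh_inj (mulfI ra Es)).
have a0 : r b * expR (- b) != 0 := lt0r_neq0 (mulr_gt0 (r0 b) (expR_gt0 _)).
by apply/rowP => i; apply: (mulfI a0); rewrite -X; congr (r _ * expR (- _) * _); exact: esym.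
Qed.

Lemma image_catenoid_map : catenoid_map @` U = catenoid k.+1 c.
Proof.
have N0 : 0 < N by [].
have natN : (2 * k.+1 - 1)%N = k.*2.+1 by lia.
have uE s : Num.sqrt (catenoid_u k.+1 c s) = N / (c * r s).
  rewrite (catenoid_uE c0 tau0 hK hw) -exprMn -expr_div_n sqrtr_sqr ger0_norm//.
  by apply: divr_ge0 => //; apply: mulr_ge0; exact: ltW.
have invE s : (c * Num.sqrt (catenoid_u k.+1 c s))^-1 = r s / N.
  by rewrite uE; field; rewrite !gt_eqF.
have rootE s : Num.sqrt (c ^+ 2 * catenoid_u k.+1 c s + N ^+ 2) = N * rho s / r s.
  rewrite (catenoid_uE c0 tau0 hK hw).
  have -> : c ^+ 2 * (N ^+ 2 / (c ^+ 2 * r s ^+ 2)) + N ^+ 2 = (N * rho s / r s) ^+ 2.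
    rewrite [(_ / r s) ^+ 2]expr_div_n [(N * rho s) ^+ 2]exprMn lorentz_sqr; field.
    by rewrite !gt_eqF.
  rewrite sqrtr_sqr ger0_norm//; apply: divr_ge0; last exact: ltW.
  by apply: mulr_ge0 => //; exact: ltW (lorentz_gt0 s).
apply/seteqP; split=> [_ [x Ux <-]|y [s [om]]].
  exists (L x), (expR (- L x) *: x); have [x1 x2 x3] := catenoid_map_coord x.
  rewrite /= natN invE rootE; split.
  - have : sqnorm (expR (- L x) *: x) = 1.
      by rewrite sqnormZ log_normK// mulVf// gt_eqF.
    by [].
  - by move=> i; rewrite -/(low_index i) x1 mxE; field.
  - by rewrite -/(axis_index k) x2 /depth; field; rewrite !gt_eqF.
  - by rewrite x3 /height; field; rewrite !gt_eqF.
rewrite /= natN invE rootE => -[om1 y1 y2 y3].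
have om1' : sqnorm om = 1 by [].
have e0 : 0 < expR s by exact: expR_gt0.
have sq : sqnorm (expR s *: om) = expR s ^+ 2 by rewrite sqnormZ om1' mulr1.
have Lx : L (expR s *: om) = s by rewrite /log_norm sq lnXn// expRK; lra.
exists (expR s *: om); first by rewrite /punctured /= sq exprn_gt0.
have [x1 x2 x3] := catenoid_map_coord (expR s *: om); rewrite Lx in x1 x2 x3.
apply/rowP => j; case: (low_index_cover j) => [->|->|[i ->]].
- by rewrite x3 y3 /height; field; rewrite !gt_eqF.
- by rewrite x2 y2 /depth; field; rewrite !gt_eqF.
- rewrite x1 y1 mxE expRN; field.
  by rewrite !gt_eqF.
Qed.

End catenoid_parametrization.

(* Keeps unification from unfolding integrals. *)
#[local] Opaque catenoid_v.

Lemma generated_comp (R : realType) (V : normedModType R) (G1 : set (R -> R))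
    (G : set (V -> R)) (l : V -> R) (f : R -> R) :
  (forall h, G1 h -> generated G (fun x => h (l x))) -> generated G1 f ->
  generated G (fun x => f (l x)).
Proof.
move=> hG; elim=> [a|h /hG//|h1 h2 _ ih1 _ ih2|h1 h2 _ ih1 _ ih2].
- exact: generated_cst.
- exact: (generated_add ih1 ih2).
- exact: (generated_mul ih1 ih2).
Qed.

Section catenoid_smooth.
Variables (R : realType) (k : nat) (c tau : R) (w : R -> R).
Hypothesis c0 : 0 < c.
Hypothesis tau0 : 0 < tau.
Local Notation N := (k.*2.+1%:R : R).
Hypothesis hK : tau ^+ k.*2.+1 * (1 + tau) * (c ^+ 2) ^+ k.*2.+2 = (N ^+ 2) ^+ k.*2.+1.
Hypothesis hw : is_catenary k tau w.
Local Notation m := (2 * k.+1)%N.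
Local Notation r := (radius tau w).
Local Notation p := (speed k tau w).
Local Notation q := (flux k tau w).
Local Notation v := (catenoid_v k.+1 c).
Local Notation U := (punctured (R := R) (m := m)).
Local Notation rho := (lorentz tau w).
Local Notation L := (@log_norm R k).
Local Notation dep := (depth k c tau w).
Local Notation hei := (height k c tau w).

Let r0 s : 0 < r s. Proof. exact: radius_gt0. Qed.
Let rho0 s : 0 < rho s. Proof. exact: lorentz_gt0. Qed.

(** The list is closed under d/ds up to products and sums. Neither q nor v appears: q is a constant
    times a power of 1/r, and v occurs only inside sinh and cosh. The exponential is there because
    the partial derivatives of L = ln |x| are x_i exp(- 2 L). *)
Inductive catenoid_function : (R -> R) -> Prop :=
| cf_exp : catenoid_function (fun s => expR (- s))
| cf_radius : catenoid_function r
| cf_radiusV : catenoid_function (fun s => (r s)^-1)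
| cf_speed : catenoid_function p
| cf_lorentz : catenoid_function rho
| cf_lorentzV : catenoid_function (fun s => (rho s)^-1)
| cf_sinh : catenoid_function (fun s => sinh (v s))
| cf_cosh : catenoid_function (fun s => cosh (v s)).
Local Notation G1 := (catenoid_function : set (R -> R)).

Definition catenoid_generators : set ('rV[R]_m -> R) :=
  [set f | coordinates f \/ exists2 h, G1 h & f = fun x => h (L x)].
Local Notation G := catenoid_generators.

Lemma generated_flux : generated G1 q.
Proof.
have -> : q = (fun s => Num.sqrt (tau ^+ k.*2.+1 * (1 + tau)) * (r s)^-1 ^+ k.*2.+1).
  by apply/funext => s; rewrite /flux exprVn.
apply: generated_mul; first exact: generated_cst.
by apply/generated_exp/generated_in; exact: cf_radiusV.
Qed.

Let der_G1 g : G1 g -> generated_derivative (setT : set R) (1 : R) G1 g.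
Proof.
have gr : generated G1 r by exact/generated_in/cf_radius.
have gi : generated G1 (fun s => (r s)^-1) by exact/generated_in/cf_radiusV.
have gp : generated G1 p by exact/generated_in/cf_speed.
have gh : generated G1 rho by exact/generated_in/cf_lorentz.
have gj : generated G1 (fun s => (rho s)^-1) by exact/generated_in/cf_lorentzV.
have gs : generated G1 (fun s => sinh (v s)) by exact/generated_in/cf_sinh.
have gc : generated G1 (fun s => cosh (v s)) by exact/generated_in/cf_cosh.
have gq := generated_flux.
have gv : generated G1 (fun s => - (q s * (rho s)^-1 ^+ 2)).
  exact: generated_opp (generated_mul gq (generated_exp 2 gj)).
have dv (s : R) : is_derive s 1 v (- (q s * (rho s)^-1 ^+ 2)).
  by rewrite exprVn; exact: (der_v c0 tau0 hK hw).
have gl : generated G1 (fun s => r s * p s * (rho s)^-1).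
  exact: generated_mul (generated_mul gr gp) gj.
have dl (s : R) : is_derive s 1 rho (r s * p s * (rho s)^-1) by exact: (der_lorentz tau0 hw).
case.
- exists (fun s => - expR (- s)); first exact/generated_opp/generated_in/cf_exp.
  move=> s _; apply: (is_derive_eq (der_exp_real (der_opp (is_derive_id s 1)))).
  by rewrite mulN1r.
- by exists p => // s _; exact: (der_radius tau0 hw).
- exists (fun s => - (p s * (r s)^-1 ^+ 2)); first exact: generated_opp (generated_mul gp (generated_exp 2 gi)).
  move=> s _; apply: (is_derive_eq (der_inv (der_radius tau0 hw s) (lt0r_neq0 (r0 s)))).
  by rewrite exprVn.
- exists (fun s => r s + N * q s ^+ 2 * (r s)^-1).
    exact: generated_add gr (generated_mul (generated_mul (generated_cst _ _) (generated_exp 2 gq)) gi).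
  by move=> s _; exact: (der_speed tau0 hw).
- by exists (fun s => r s * p s * (rho s)^-1) => // s _; exact: dl.
- exists (fun s => - ((r s * p s * (rho s)^-1) * (rho s)^-1 ^+ 2)).
    exact: generated_opp (generated_mul gl (generated_exp 2 gj)).
  move=> s _; apply: (is_derive_eq (der_inv (dl s) (lt0r_neq0 (rho0 s)))).
  by rewrite exprVn.
- exists (fun s => - (q s * (rho s)^-1 ^+ 2) * cosh (v s)); first exact: generated_mul gv gc.
  by move=> s _; exact: der_sinh (dv s).
- exists (fun s => - (q s * (rho s)^-1 ^+ 2) * sinh (v s)); first exact: generated_mul gv gs.
  by move=> s _; exact: der_cosh (dv s).
Qed.

Lemma generated_catenoid_function f : generated G1 f -> generated G (fun x => f (L x)).
Proof.
by apply: generated_comp => h hh; apply: generated_in; right; exists h.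
Qed.

Lemma der_log_norm (x : 'rV[R]_m) i : U x ->
  is_derive x (delta_mx 0 i) L (x 0 i * expR (- L x) ^+ 2).
Proof.
move=> Ux; apply: (is_derive_eq (der_mul (der_ln (der_sqnorm x i) Ux) (der_cst 2^-1))).
rewrite log_normK// mulr0 addr0; field.
exact: lt0r_neq0.
Qed.

Lemma catenoid_generators_continuous g : G g -> {in U, continuous g}.
Proof.
move=> [[i ->] x _|[h hh ->] x /set_mem Ux]; first exact: coord_continuous.
have [dh _ /(_ (L x) I) Dh] := der_G1 hh.
apply: (@continuous_comp _ _ _ L h); last exact: is_derive_continuous Dh.
apply: (@continuous_comp _ _ _ (@sqnorm R m) (fun t => ln t / 2)); first exact: continuous_sqnorm.
exact: is_derive_continuous (der_mul (der_ln (is_derive_id (sqnorm x) 1) Ux) (der_cst 2^-1)).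
Qed.

Lemma catenoid_generators_derivative g i : G g -> generated_derivative U (delta_mx 0 i) G g.
Proof.
move=> [[j ->]|[h hh ->]].
  exists (fun=> (delta_mx 0 i : 'rV[R]_m) 0 j); first exact: generated_cst.
  by move=> x _; exact: is_derive_coord.
have [dh gdh Dh] := der_G1 hh.
exists (fun x : 'rV[R]_m => x 0 i * expR (- L x) ^+ 2 * dh (L x)).
  apply: generated_mul; last exact: generated_catenoid_function.
  apply: generated_mul; first by apply: generated_in; left; exists i.
  have := generated_catenoid_function (generated_in cf_exp).
  exact: generated_exp.
by move=> x Ux; exact: (is_derive_comp1 (der_log_norm i Ux) (Dh _ I)).
Qed.

Lemma generated_depth : generated G1 dep.
Proof. exact: generated_mul (generated_in cf_lorentz) (generated_in cf_sinh). Qed.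

Lemma generated_height : generated G1 hei.
Proof. exact: generated_mul (generated_in cf_lorentz) (generated_in cf_cosh). Qed.

Lemma catenoid_cylindrical_smooth (a b z : R -> R) :
  generated G1 a -> generated G1 b -> generated G1 z ->
  smooth_on U (cylindrical (@low_index k) (axis_index k) (fun t => a (ln t / 2))
    (fun t => b (ln t / 2)) (fun t => z (ln t / 2))).
Proof.
move=> ga gb gz.
apply: (cylindrical_smooth_on (@low_index_inj k) (@low_index_max k) (@low_index_axis k)
  (axis_index_max k) (@low_index_cover k) (@open_punctured R m)
  catenoid_generators_continuous catenoid_generators_derivative).
- by move=> f hf; left.
- by exists (fun x => a (L x)) => //; exact: generated_catenoid_function.
- by exists (fun x => b (L x)) => //; exact: generated_catenoid_function.
- by exists (fun x => z (L x)) => //; exact: generated_catenoid_function.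
Qed.

Lemma catenoid_map_smooth : smooth_on U (catenoid_map c tau w).
Proof.
apply: (@catenoid_cylindrical_smooth (fun s => r s * expR (- s)) dep hei).
- exact: generated_mul (generated_in cf_radius) (generated_in cf_exp).
- exact: generated_depth.
- exact: generated_height.
Qed.

Lemma der_half_log (f : R -> R) (t df : R) : 0 < t -> is_derive (ln t / 2) 1 f df ->
  is_derive t 1 (fun t => f (ln t / 2)) (df / (2 * t)).
Proof.
move=> t0 hf; apply: (is_derive_eq (is_derive_comp1
  (der_mul (der_ln (is_derive_id t 1) t0) (der_cst 2^-1)) hf)).
by rewrite mulr0 addr0; field; exact: lt0r_neq0.
Qed.

(** The generating curve has unit speed, so the metric is ds^2 plus r^2 times that of the sphere. In
    the coordinates x with |x| = e^s it scales lengths by 1/|x| along the ray and by r/|x| in the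
    2k+1 spherical directions. *)
Lemma catenoid_det (x : 'rV[R]_m) : U x ->
  \det (first_fundamental_form (catenoid_map c tau w) x) =
  (r (L x) ^+ k.*2.+1 / sqnorm x ^+ k.+1) ^+ 2.
Proof.
move=> Ux; have t0 : 0 < sqnorm x by [].
pose s := ln (sqnorm x) / 2.
have da := der_half_log t0 (der_mul (der_radius tau0 hw s) (der_exp_real (der_opp (is_derive_id s 1)))).
have db := der_half_log t0 (der_depth c0 tau0 hK hw s).
have dz := der_half_log t0 (der_height c0 tau0 hK hw s).
have E0 : 0 < expR (- s) by exact: expR_gt0.
have a0 : r s * expR (- s) != 0 by rewrite gt_eqF// mulr_gt0.
rewrite (det_first_fundamental_form_cylindrical (@low_index_inj k) (@low_index_max k)
  (@low_index_axis k) (axis_index_max k) da db dz a0).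
have E2 : expR (- s) ^+ 2 = (sqnorm x)^-1 by exact: log_normK.
have pq := speed_flux k w tau0 s.
have h2 := lorentz_sqr tau w s.
have ch := cosh2_sinh2 (v s).
have rs := r0 s; have hs := rho0 s.
rewrite /log_norm -/s.
move: (sqnorm x) t0 E2 {da db dz a0} => t t0 E2.
move: (r s) (p s) (q s) (rho s) (cosh (v s)) (sinh (v s)) (expR (- s)) rs hs E0 E2 pq h2 ch.
move=> r' p' q' h' ch sh E rs hs E0 E2 pq h2 hc.
have [rn hn En tn] : [/\ r' != 0, h' != 0, E != 0 & t != 0] by rewrite !gt_eqF.
(* This is the unit speed relation p^2 + depth'^2 - height'^2 = 1, up to the factor from the
   variable t = e^(2s). *)
have X : ((r' * p' * sh - q' * ch) / h' / (2 * t)) ^+ 2 -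
    ((r' * p' * ch - q' * sh) / h' / (2 * t)) ^+ 2 = (1 - p' ^+ 2) / (4 * t ^+ 2).
  transitivity ((q' ^+ 2 - r' ^+ 2 * p' ^+ 2) * (ch ^+ 2 - sh ^+ 2) / (h' ^+ 2 * (4 * t ^+ 2))).
    by field; rewrite hn tn.
  have -> : q' ^+ 2 = h' ^+ 2 - p' ^+ 2 by rewrite -pq; ring.
  have -> : r' ^+ 2 = h' ^+ 2 - 1 by rewrite h2; ring.
  by rewrite hc; field; rewrite hn tn.
rewrite X.
have -> : 1 + 4 * (r' * E * ((p' * E + r' * (- 1 * E)) / (2 * t)) +
    t * ((p' * E + r' * (- 1 * E)) / (2 * t)) ^+ 2 +
    (1 - p' ^+ 2) / (4 * t ^+ 2)) / (r' * E) ^+ 2 * t = (r' ^+ 2)^-1.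
  transitivity (1 + 4 * (r' * (p' - r') * E ^+ 2 / (2 * t) +
    (p' - r') ^+ 2 * E ^+ 2 / (4 * t) + (1 - p' ^+ 2) / (4 * t ^+ 2)) / (r' ^+ 2 * E ^+ 2) * t).
    by field; rewrite rn En tn.
  by rewrite E2; field; rewrite rn tn.
rewrite [(r' * E) ^+ 2]exprMn E2 mulnC exprM [(r' ^+ 2 / t) ^+ _]expr_div_n.
have -> : r' ^+ k.*2.+1 = (r' ^+ 2) ^+ k.+1 / r'.
  by rewrite -exprM mul2n doubleS [in RHS]exprSr mulfK.
move: ((r' ^+ 2) ^+ k.+1) (t ^+ k.+1) (expf_neq0 k.+1 tn) => y z z0.
by field; rewrite rn z0.
Qed.

Lemma catenoid_area_element (x : 'rV[R]_m) : U x ->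
  area_element (catenoid_map c tau w) x = r (L x) ^+ k.*2.+1 / sqnorm x ^+ k.+1.
Proof.
move=> Ux; rewrite /area_element catenoid_det// sqrtr_sqr ger0_norm//.
by apply: divr_ge0; apply/exprn_ge0/ltW.
Qed.

End catenoid_smooth.

(** * Asymptotics of the truncated area *)

Lemma horner_bound (R : realType) (P : {poly R}) d : (size P <= d.+1)%N ->
  exists2 C : R, 0 <= C & forall x, 1 <= x -> `|P.[x]| <= C * x ^+ d.
Proof.
move=> sP; exists (\sum_(i < d.+1) `|P`_i|); first by apply: sumr_ge0.
move=> x x1; rewrite (horner_coef_wide _ sP) mulr_suml.
apply: (le_trans (ler_norm_sum _ _ _)); apply: ler_sum => i _.
rewrite normrM ler_wpM2l// ger0_norm; last by apply/exprn_ge0/(le_trans ler01).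
by apply: ler_weXn2l; rewrite // -ltnS.
Qed.

Lemma bernoulli_le (R : realType) (y : R) i : 0 <= y <= 1 -> 1 - y ^+ i <= i%:R * (1 - y).
Proof.
move=> /andP[y0 y1]; elim: i => [|i IH]; first by rewrite expr0 subrr mul0r.
have : y * (1 - y ^+ i) <= 1 - y ^+ i.
  by apply: ler_piMl => //; rewrite subr_ge0 exprn_ile1.
rewrite exprS -[i.+1%:R]natr1 => h; lra.
Qed.

(** The terms of degree i contribute x^i (1 - y^i), and Bernoulli bounds 1 - y^i by i (1 - y). It
    measures the effect of a relative error 1 - y on the leading polynomial. *)
Lemma horner_contraction (R : realType) (P : {poly R}) d : (size P <= d.+1)%N ->
  exists2 C : R, 0 <= C &
    forall x y, 1 <= x -> 0 <= y <= 1 -> `|P.[x] - P.[x * y]| <= C * x ^+ d * (1 - y).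
Proof.
move=> sP; exists (\sum_(i < d.+1) `|P`_i| * i%:R); first by apply: sumr_ge0 => i _; rewrite mulr_ge0.
move=> x y x1 /andP[y0 y1].
have x0 : 0 <= x by exact: le_trans x1.
rewrite !(horner_coef_wide _ sP) -sumrB !mulr_suml.
apply: (le_trans (ler_norm_sum _ _ _)); apply: ler_sum => i _.
rewrite -mulrBr normrM -!mulrA ler_wpM2l// [(x * y) ^+ i]exprMn -[X in X - _]mulr1 -mulrBr.
have h0 : 0 <= 1 - y ^+ i by rewrite subr_ge0 exprn_ile1.
rewrite ger0_norm; last by rewrite mulr_ge0// exprn_ge0.
rewrite mulrCA; apply: ler_pM => //; first exact: exprn_ge0.
  by apply: ler_weXn2l; rewrite // -ltnS.
by apply: bernoulli_le; rewrite y0.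
Qed.

(** By convexity exp a >= exp b (1 + a - b), and likewise at - a and - b; the average is cosh a >=
    cosh b (1 - |b - a|). *)
Lemma cosh_ratio (R : realType) (a b : R) : 1 - cosh a / cosh b <= `|b - a|.
Proof.
have cb : 0 < cosh b by exact: lt_le_trans ltr01 (cosh_ge1 b).
rewrite -{1}[1](divff (lt0r_neq0 cb)) -mulrBl ler_pdivrMr//.
have h1 : expR b * (1 + (a - b)) <= expR a.
  rewrite (_ : expR a = expR (b + (a - b))); last by congr expR; ring.
  by rewrite expRD ler_wpM2l ?expR_ge0// expR_ge1Dx.
have h2 : expR (- b) * (1 + (b - a)) <= expR (- a).
  rewrite (_ : expR (- a) = expR (- b + (b - a))); last by congr expR; ring.
  by rewrite expRD ler_wpM2l ?expR_ge0// expR_ge1Dx.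
have e1 := expR_ge0 b; have e2 := expR_ge0 (- b).
have n1 := ler_norm (b - a); have n2 := ler_norm (- (b - a)); rewrite normrN in n2.
have m1 := ler_wpM2r e1 n1; have m2 := ler_wpM2r e2 n2.
rewrite /cosh; nra.
Qed.

(** The error term (q^2 / r) Q(r^2) ds in the variable w, divided by 1 + tau. The factors sqrt tau
    of r and of ds cancel, so the density makes sense at tau = 0. *)
Definition defect_density (R : realType) (k : nat) (tau y : R) : R :=
  (defect_poly R k).[tau * xi y ^+ 2] / (xi y ^+ k.*2.+3 * root_profile k tau y).

Section catenoid_area.
Variables (R : realType) (k : nat) (c tau : R) (w : R -> R).
Hypothesis c0 : 0 < c.
Hypothesis tau0 : 0 < tau.
Local Notation N := (k.*2.+1%:R : R).
Hypothesis hK : tau ^+ k.*2.+1 * (1 + tau) * (c ^+ 2) ^+ k.*2.+2 = (N ^+ 2) ^+ k.*2.+1.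
Hypothesis hw : is_catenary k tau w.
Variables (Psi : R -> R) (l : R).
Hypothesis Psi0 : Psi 0 = 0.
Hypothesis dPsi : forall y : R, is_derive y 1 Psi (defect_density k tau y).
Hypothesis Psi_lim : Psi y @[y --> +oo] --> l.
Local Notation m := (2 * k.+1)%N.
Local Notation r := (radius tau w).
Local Notation p := (speed k tau w).
Local Notation q := (flux k tau w).
Local Notation v := (catenoid_v k.+1 c).
Local Notation U := (punctured (R := R) (m := m)).
Local Notation rho := (lorentz tau w).
Local Notation L := (@log_norm R k).
Local Notation hei := (height k c tau w).
Local Notation P := (area_poly R k).
Local Notation Q := (defect_poly R k).
Local Notation M := (@catenoid_map R k c tau w).

Let r0 s : 0 < r s. Proof. exact: radius_gt0. Qed.
Let rho0 s : 0 < rho s. Proof. exact: lorentz_gt0. Qed.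

Definition half_area s := P.[r s ^+ 2] * p s - (1 + tau) * Psi (w s).

(** Replacing p^2 by 1 + r^2 - q^2 lets the differential equation of P produce r^(2k+1); the terms
    in q^2 gather into Q and are cancelled by the derivative of Psi. *)
Lemma der_half_area (s : R) : is_derive s 1 half_area (r s ^+ k.*2.+1).
Proof.
have [_ dw _ _] := hw; have rn : r s != 0 by rewrite gt_eqF.
have dr := der_radius tau0 hw s.
apply: (is_derive_eq (der_add (der_mul (der_horner P (der_exp 2 dr)) (der_speed tau0 hw s))
  (der_opp (der_mul (der_cst (1 + tau)) (is_derive_comp1 (dw s) (dPsi (w s))))))).
have Sn : root_profile k tau (w s) != 0 by rewrite gt_eqF// root_profile_gt0// ltW.
have xn : xi (w s) != 0 by rewrite gt_eqF// xi_gt0.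
have tn : Num.sqrt tau != 0 by rewrite gt_eqF// sqrtr_gt0.
have -> : slope k tau (w s) * defect_density k tau (w s) =
    Q.[r s ^+ 2] / (Num.sqrt tau * xi (w s) * xi (w s) ^+ 2 ^+ k.*2.+1).
  rewrite radius_sqr// -xi_sqr /slope /defect_density -exprM.
  have -> : (2 * k.*2.+1)%N = (k.*2 + k.*2.+2)%N by lia.
  rewrite exprD (exprS _ k.*2.+2).
  have := expf_neq0 k.*2 xn; have := expf_neq0 k.*2.+2 xn.
  move: (_ ^+ k.*2) (_ ^+ k.*2.+2) => a b bn an; field.
  by rewrite Sn xn tn an bn.
have E : Q.[r s ^+ 2] = N * P.[r s ^+ 2] - 2 * (r s ^+ 2 * P^`().[r s ^+ 2]).
  by rewrite /defect_poly hornerD hornerN !hornerZ hornerM hornerX.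
have q2 := flux_sqr k tau0 w s.
have -> : Num.sqrt tau * xi (w s) = r s by [].
have -> : r s ^+ k.*2.+1 = r s * (2 * (1 + r s ^+ 2) * P^`().[r s ^+ 2] + P.[r s ^+ 2]).
  by rewrite area_poly_ode -exprM mul2n exprS.
transitivity (2 * r s * p s ^+ 2 * P^`().[r s ^+ 2] + P.[r s ^+ 2] * (r s + N * q s ^+ 2 / r s) -
  q s ^+ 2 / r s * Q.[r s ^+ 2]).
  rewrite q2 /=; have := expf_neq0 k.*2.+1 (expf_neq0 2 xn).
  move: (_ ^+ k.*2.+1) => a an; field.
  by rewrite rn an.
rewrite speed_sqr// E; field.
exact: rn.
Qed.

Lemma half_areaN s : half_area (- s) = - half_area s.
Proof.
have [_ _ wN _] := hw.
have PsiN y : Psi (- y) = - Psi y.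
  apply/eqP; rewrite -addr_eq0; apply/eqP.
  have d (z : R) : is_derive z 1 (fun z => Psi (- z) + Psi z) 0.
    apply: (is_derive_eq (der_add (is_derive_comp1 (der_opp (is_derive_id z 1)) (dPsi _)) (dPsi z))).
    by rewrite /defect_density xiN root_profileN; ring.
  by rewrite (derive0_eq y 0 d) oppr0 Psi0 addr0.
by rewrite /half_area (radiusN hw) (speedN hw) wN PsiN; ring.
Qed.

Lemma height_norm s : hei `|s| = hei s.
Proof.
have [h|h] := leP 0 s; first by rewrite ger0_norm.
by rewrite (ltr0_norm h); exact: (heightN c0 tau0 hK hw).
Qed.

Lemma height_le_norm a s : 0 <= a -> (hei s <= hei a) = (`|s| <= a).
Proof.
move=> a0; rewrite -height_norm; apply/idP/idP => [h|].
  by rewrite leNgt; apply/negP => /(height_incr c0 tau0 hK hw a0); rewrite ltNge h.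
rewrite le_eqVlt => /predU1P[->//|h]; apply: ltW.
exact: (height_incr c0 tau0 hK hw (normr_ge0 s) h).
Qed.

Lemma log_norm_le (x : 'rV[R]_m) s : U x ->
  (`|L x| <= s) = (expR (- (2 * s)) <= sqnorm x <= expR (2 * s)).
Proof.
move=> Ux; have e : expR (2 * L x) = sqnorm x.
  by rewrite /log_norm mulrC divfK// lnK.
by rewrite -e !ler_expR ler_norml; congr (_ && _); apply/idP/idP => h; lra.
Qed.

(** With t = e^(2s) the weighted area element is r^(2k+1) dt / t = 2 r^(2k+1) ds. The other factor 2
    in the constant 4 is the oddness of [half_area] over the interval from - s to s. *)
Lemma has_area_catenoid_below s : 0 <= s ->
  has_area (catenoid k.+1 c `&` [set x | x 0 ord_max <= hei s])
    (4 * (pi ^+ k.+1 / k`!%:R) * half_area s).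
Proof.
move=> s0.
pose f (t : R) := r (ln t / 2) ^+ k.*2.+1 / t ^+ k.+1.
pose B (t : R) := 2 * half_area (ln t / 2).
pose a : R := expR (- (2 * s)); pose b : R := expR (2 * s).
have a0 : 0 < a by exact: expR_gt0.
have -> : 4 * (pi ^+ k.+1 / k`!%:R) * half_area s = pi ^+ k.+1 / k`!%:R * (B b - B a).
  rewrite /B /a /b !expRK mulNr (_ : 2 * s / 2 = s); last by field.
  by rewrite half_areaN; ring.
have UD (x : 'rV[R]_m) : a <= sqnorm x -> U x by exact: lt_le_trans.
have D x : U x -> (M x 0 ord_max <= hei s) = (a <= sqnorm x <= b).
  move=> Ux; have [_ _ X] := catenoid_map_coord c tau w x.
  by rewrite (etrans (congr1 (fun z => z <= hei s) X) (height_le_norm _ s0)) log_norm_le.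
apply: (@has_area_radial R k m M U _ f B a b).
- by [].
- exact: open_punctured.
- exact: (catenoid_map_smooth c0 tau0 hK hw).
- by move=> _ [x Ux <-]; apply: catenoid_map_hyperbolic.
- exact: ltW.
- by rewrite ler_expR; lra.
- by move=> x /= /andP[/UD].
- rewrite -(image_catenoid_map c0 tau0 hK hw).
  apply/seteqP; split=> [_ [x /= hx <-]|_ [[x Ux <-] hx]].
    have Ux : U x by case/andP: hx => /UD.
    by split; [exists x|rewrite /= D].
  by exists x => //=; rewrite -D.
- move=> x y /set_mem /= /andP[/UD Ux _] /set_mem /= /andP[/UD Uy _].
  by apply: (catenoid_map_inj c0 tau0 hK hw); apply: mem_set.
- move=> t /andP[at_ _]; have t0 : 0 < t by exact: lt_le_trans at_.
  by rewrite divr_ge0// exprn_ge0// ltW.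
- move=> x /andP[/UD Ux _]; exact: (catenoid_area_element c0 tau0 hK hw).
- move=> t /andP[at_ _]; have t0 : 0 < t by exact: lt_le_trans at_.
  apply: is_derive_continuous (der_mul (der_half_log t0 (der_exp _ (der_radius tau0 hw _)))
    (der_inv (der_exp k.+1 (is_derive_id t 1)) _)).
  by rewrite expf_neq0// gt_eqF.
- move=> t /andP[at_ _]; have t0 : 0 < t by exact: lt_le_trans at_.
  apply: (is_derive_eq (der_mul (der_cst 2) (der_half_log t0 (der_half_area _)))).
  rewrite /f [t ^+ k.+1]exprSr mul0r add0r; have := expf_neq0 k (lt0r_neq0 t0).
  have tn := lt0r_neq0 t0.
  by move: (t ^+ k) (r _ ^+ _) => x y xn; field; rewrite xn tn.
Qed.

Local Notation K := (Num.sqrt (tau ^+ k.*2.+1 * (1 + tau))).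

Let K0 : 0 <= K. Proof. exact: sqrtr_ge0. Qed.

(** w increases and attains (1 + K) / sqrt tau, and r >= sqrt tau |w|. Beyond that point q = K /
    r^(2k+1) is at most 1, hence p >= r, so the radius grows at least exponentially. *)
Lemma eventually_far : exists2 s0, 0 <= s0 & forall s, s0 <= s -> 1 <= r s /\ K <= r s.
Proof.
have [w0 _ _ wsurj] := hw; have t0 : 0 < Num.sqrt tau by rewrite sqrtr_gt0.
have [s0 ws0] := wsurj ((1 + K) / Num.sqrt tau).
have ws0_ge0 : 0 < w s0 by rewrite ws0 divr_gt0// ltr_pwDl.
exists s0.
  rewrite leNgt; apply/negP => /(catenary_incr tau0 hw).
  by rewrite w0 ltNge (ltW ws0_ge0).
move=> s ss; have wss : w s0 <= w s.
  by move: ss; rewrite le_eqVlt => /predU1P[->//|/(catenary_incr tau0 hw)/ltW].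
suff : 1 + K <= r s by move=> h; have := K0; split; lra.
apply: (le_trans _ (radius_ge tau0 w s)); rewrite -ler_pdivrMl// mulrC -ws0.
by apply: (le_trans wss); exact: ler_norm.
Qed.

Lemma flux_le1 s : 1 <= r s -> K <= r s -> q s <= 1.
Proof.
move=> r1 Kr; rewrite ler_pdivrMr ?exprn_gt0// mul1r (le_trans Kr)//.
by rewrite exprS ler_peMr ?(ltW (r0 s))// exprn_ege1.
Qed.

Lemma radius_le_speed s : 0 <= s -> q s <= 1 -> r s <= p s.
Proof.
move=> s0 q1; apply: ler_of_sqr; first exact: speed_ge0.
by rewrite speed_sqr// addrAC lerDr subr_ge0 exprn_ile1// ltW// flux_gt0.
Qed.

(** Compare - v' with the derivative of the bound: - v' = q / rho^2 <= K / r^(2k+3), while - (K /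
    r^(2k+3))' is the same quantity times (2k+3) p / r, and p >= r. *)
Lemma v_gap s0 a b : (forall s, s0 <= s -> 1 <= r s /\ K <= r s) -> 0 <= s0 -> s0 <= a -> a <= b ->
  v a - v b <= K / r a ^+ k.*2.+3.
Proof.
move=> far s00 sa ab.
have rn s : r s ^+ k.*2.+3 != 0 by rewrite expf_neq0// gt_eqF.
have dG (s : R) := der_add (der_v c0 tau0 hK hw s) (der_opp
  (der_mul (der_cst K) (der_inv (der_exp k.*2.+3 (der_radius tau0 hw s)) (rn s)))).
have rb : 0 <= K / r b ^+ k.*2.+3 by rewrite divr_ge0// exprn_ge0// ltW.
suff : v a - K / r a ^+ k.*2.+3 <= v b - K / r b ^+ k.*2.+3 by lra.
apply: (derive_ge0_le dG) => // s as_ sb.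
have [r1 Kr] := far _ (le_trans sa (ltW as_)).
have rp := radius_le_speed (le_trans s00 (le_trans sa (ltW as_))) (flux_le1 r1 Kr).
have rs := r0 s; have rsn := lt0r_neq0 rs.
have h1 : q s / rho s ^+ 2 <= K / r s ^+ k.*2.+3.
  have -> : K / r s ^+ k.*2.+3 = q s / r s ^+ 2.
    rewrite /flux -[k.*2.+3]addn2.
    have := expf_neq0 k.*2.+1 rsn; rewrite exprD; move: (_ ^+ k.*2.+1) => x xn.
    by field; rewrite xn rsn.
  rewrite ler_wpM2l ?(ltW (flux_gt0 _ tau0 _ _))// lef_pV2 ?posrE ?exprn_gt0//.
  by rewrite lorentz_sqr lerDr.
have h2 : K / r s ^+ k.*2.+3 <= K * (k.*2.+3%:R * r s ^+ k.*2.+2 * p s / (r s ^+ k.*2.+3) ^+ 2).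
  have -> : k.*2.+3%:R * r s ^+ k.*2.+2 * p s / (r s ^+ k.*2.+3) ^+ 2 =
      k.*2.+3%:R * (p s / r s) / r s ^+ k.*2.+3.
    have := expf_neq0 k.*2.+2 rsn; rewrite [r s ^+ k.*2.+3]exprS; move: (_ ^+ k.*2.+2) => x xn.
    by field; rewrite xn rsn.
  rewrite ler_wpM2l// -[leLHS]mul1r ler_wpM2r//; first by rewrite invr_ge0 exprn_ge0// ltW.
  have h : 1 <= p s / r s by rewrite ler_pdivlMr// mul1r.
  by rewrite -[leLHS]mulr1 ler_pM// ler1n.
by rewrite mul0r add0r /=; lra.
Qed.

Lemma v_limit s0 : (forall s, s0 <= s -> 1 <= r s /\ K <= r s) -> 0 <= s0 ->
  exists2 vi, (forall s, vi <= v s)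
    & forall s, s0 <= s -> v s - vi <= K / r s ^+ k.*2.+3.
Proof.
move=> far s00; pose E := [set v s | s in [set s | s0 <= s]].
have Es0 : E (v s0) by exists s0 => /=.
have lbE s : s0 <= s -> lbound E (v s - K / r s ^+ k.*2.+3).
  move=> ss _ [b /= sb <-]; have [bs|bs] := ltP b s.
    have h0 : 0 <= K / r s ^+ k.*2.+3 by rewrite divr_ge0// exprn_ge0// ltW.
    have := v_decr c0 tau0 hK hw bs; lra.
  have := v_gap far s00 ss bs; lra.
have infE : has_inf E by split; [exists (v s0)|exists (v s0 - K / r s0 ^+ k.*2.+3); exact: lbE].
exists (inf E) => [s|s ss].
  have h b : s0 <= b -> inf E <= v b by move=> sb; apply: (ge_inf infE.2); exists b.
  have [ss|ss] := leP s0 s; first exact: h.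
  exact: le_trans (h s0 (lexx _)) (ltW (v_decr c0 tau0 hK hw ss)).
have := lb_le_inf infE.1 (lbE s ss); lra.
Qed.

Lemma cosh_le (a b : R) : 0 <= a -> a <= b -> cosh a <= cosh b.
Proof.
move=> a0; apply: (derive_ge0_le (fun x => der_cosh (is_derive_id x 1))) => x ax _.
by rewrite mul1r ltW// sinh_gt0// (le_lt_trans a0).
Qed.

Let lead := 'X * (P \Po ('X^2 - 1%:P)).

Let leadE (x : R) : lead.[x] = x * P.[x ^+ 2 - 1].
Proof. by rewrite hornerM hornerX horner_comp hornerD hornerN hornerXn hornerC. Qed.

Let size_lead : (size lead <= k.*2.+2)%N.
Proof.
have s2 : size ('X^2 - 1%:P : {poly R}) = 3 by rewrite size_XnsubC.
have h : ((size P).-1 <= k)%N by rewrite -subn1 leq_subLR add1n size_area_poly.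
apply: (leq_trans (size_polyMleq _ _)); rewrite size_polyX /= ltnS.
apply: (leq_trans (size_comp_poly_leq _ _)); rewrite s2 ltnS -muln2.
exact: leq_mul.
Qed.

(* [kappa] is cosh of the limit of v; the truncation height rho cosh v is then
   kappa rho up to an error that does not affect the expansion. *)
Lemma height_expansion : exists kappa D, 0 < kappa /\ (exists2 s0, 0 <= s0 & forall s, s0 <= s ->
  `|P.[r s ^+ 2] * p s - lead.[hei s / kappa]| <= D / hei s).
Proof.
have [s0 s00 far] := eventually_far.
have [vi vi_le vi_gap] := v_limit far s00.
have k0 : 0 < cosh vi by exact: lt_le_trans ltr01 (cosh_ge1 vi).
have [C1 C10 hC1] := horner_bound (size_area_poly R k).
have [C2 C20 hC2] := horner_contraction size_lead.
pose Cst := C1 * K ^+ 2 + C2 * 2 ^+ k.*2.+1 * K.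
have Cst0 : 0 <= Cst by rewrite addr_ge0// mulr_ge0// ?exprn_ge0// mulr_ge0// exprn_ge0.
(* The estimates below give an error Cst / r. The factor 2 cosh vi converts it to the height, since
   hei <= 2 cosh vi * r. *)
exists (cosh vi), (Cst * (2 * cosh vi)); split=> //; exists s0 => // s ss.
have s_ge0 : 0 <= s by exact: le_trans ss.
have [r1 Kr] := far s ss; have q1 := flux_le1 r1 Kr; have rp := radius_le_speed s_ge0 q1.
have rs := r0 s; have hs := rho0 s; have rsn := lt0r_neq0 rs.
have v_le0 : v s <= 0.
  rewrite -(catenoid_v0 k c); move: s_ge0; rewrite le_eqVlt => /predU1P[<-//|].
  by move=> /(v_decr c0 tau0 hK hw)/ltW.
have cv : cosh (v s) <= cosh vi.
  by rewrite -coshN -(coshN vi) cosh_le ?oppr_ge0// lerN2.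
have rho_le : rho s <= 2 * r s.
  apply: ler_of_sqr; first by rewrite mulr_ge0// ltW.
  have : 1 <= r s ^+ 2 by rewrite exprn_ege1.
  by rewrite lorentz_sqr [(2 * _) ^+ 2]exprMn; lra.
have hei_le : hei s <= 2 * cosh vi * r s.
  by rewrite mulrAC; apply: ler_pM => //; [exact: ltW|rewrite (le_trans ler01)// cosh_ge1].
have hei_gt := height_gt0 k c w tau0 s.
suff main : `|P.[r s ^+ 2] * p s - lead.[hei s / cosh vi]| <= Cst / r s.
  apply: (le_trans main); rewrite -mulrA; apply: ler_wpM2l => //.
  rewrite ler_pdivlMr// mulrC ler_pdivrMr//.
rewrite (_ : hei s / cosh vi = rho s * (cosh (v s) / cosh vi)); last by rewrite mulrA.
have lead_rho : lead.[rho s] = rho s * P.[r s ^+ 2].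
  by rewrite leadE lorentz_sqr addrAC subrr add0r.
have rho1 : 1 <= rho s by apply: ler_of_sqr; [exact: ltW|rewrite lorentz_sqr expr1n lerDl sqr_ge0].
have eta : 0 <= cosh (v s) / cosh vi <= 1.
  by rewrite divr_ge0 ?(le_trans ler01 (cosh_ge1 _))//= ler_pdivrMr// mul1r.
have b2 := hC2 _ _ rho1 eta.
have gap := vi_gap s ss.
have eta_gap : 1 - cosh (v s) / cosh vi <= K / r s ^+ k.*2.+3.
  apply: (le_trans (cosh_ratio _ _)); rewrite ler0_norm ?subr_le0// opprB; exact: gap.
(* The gap decays with exponent 2k+3, which beats the degree 2k+1 of [lead]. This is the precise
   sense in which v converges fast enough. *)
have e2 : `|lead.[rho s] - lead.[rho s * (cosh (v s) / cosh vi)]| <= C2 * 2 ^+ k.*2.+1 * K / r s.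
  apply: (le_trans b2).
  apply: (@le_trans _ _ (C2 * (2 * r s) ^+ k.*2.+1 * (K / r s ^+ k.*2.+3))).
    apply: ler_pM => //.
    - by rewrite mulr_ge0// exprn_ge0// ltW.
    - by rewrite subr_ge0; case/andP: eta.
    - apply: ler_wpM2l => //; apply: lerXn2r => //; rewrite nnegrE; first exact: ltW.
      by rewrite mulr_ge0// ltW.
  rewrite [(2 * r s) ^+ _]exprMn -[k.*2.+3]addn2.
  have -> : C2 * (2 ^+ k.*2.+1 * r s ^+ k.*2.+1) * (K / r s ^+ (k.*2.+1 + 2)) =
      C2 * 2 ^+ k.*2.+1 * K / r s ^+ 2.
    rewrite exprD; have := expf_neq0 k.*2.+1 rsn; move: (r s ^+ k.*2.+1) (2 ^+ _) => x y xn.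
    by field; rewrite xn rsn.
  rewrite ler_wpM2l ?mulr_ge0// ?exprn_ge0// lef_pV2 ?posrE ?exprn_gt0// expr2.
  by rewrite ler_peMr// ltW.
(* rho - p = q^2 / (rho + p) <= q^2 / r. Here q^2 decays like r^-(4k+2), whereas P(r^2) grows at
   most like r^(2k). *)
have e1 : `|P.[r s ^+ 2] * p s - lead.[rho s]| <= C1 * K ^+ 2 / r s.
  rewrite lead_rho (mulrC (rho s)) -mulrBr normrM.
  have p0 : 0 <= p s by exact: speed_ge0.
  have pr : p s <= rho s.
    by apply: ler_of_sqr; [exact: ltW|rewrite -(speed_flux k w tau0) lerDl sqr_ge0].
  have d : `|p s - rho s| <= q s ^+ 2 / r s.
    rewrite ler0_norm ?subr_le0// opprB ler_pdivlMr//.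
    have -> : q s ^+ 2 = (rho s - p s) * (rho s + p s).
      by apply: (addrI (p s ^+ 2)); rewrite speed_flux//; ring.
    by rewrite ler_wpM2l ?subr_ge0// (le_trans rp)// lerDr ltW.
  have r2 : 1 <= r s ^+ 2 by rewrite exprn_ege1.
  apply: (le_trans (ler_pM (normr_ge0 _) (normr_ge0 _) (hC1 _ r2) d)).
  rewrite /flux [(K / _) ^+ 2]expr_div_n -!exprM.
  have -> : C1 * r s ^+ (2 * k) * (K ^+ 2 / r s ^+ (k.*2.+1 * 2) / r s) =
      C1 * K ^+ 2 / r s ^+ (k.*2 + 3).
    rewrite (_ : (k.*2.+1 * 2)%N = (k.*2 + k.*2 + 2)%N); last by rewrite mulSn muln2 -addnn addnC.
    rewrite mul2n !exprD; have := expf_neq0 k.*2 rsn; move: (r s ^+ k.*2) => x xn.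
    by field; rewrite xn rsn.
  rewrite ler_wpM2l ?mulr_ge0 ?exprn_ge0// lef_pV2 ?posrE ?exprn_gt0// addnS exprS.
  by rewrite ler_peMr ?(ltW rs)// exprn_ege1.
rewrite -[_ - _](subrKA lead.[rho s]); apply: (le_trans (ler_normD _ _)).
by rewrite /Cst mulrDl lerD.
Qed.

Theorem catenoid_has_renormalized_area :
  has_renormalized_area (catenoid k.+1 c) (- (4 * (pi ^+ k.+1 / k`!%:R) * (1 + tau) * l)).
Proof.
have [kap [D [kap0 [s0 s00 expansion]]]] := height_expansion.
pose C : R := 4 * (pi ^+ k.+1 / k`!%:R).
(* The nonnegative parameter at which the height is 1/e. The default value is taken only when 1/e is
   below the neck, where the truncation is empty and A is set to 0. *)
pose sg (e : R) := xget 0 [set s | 0 <= s /\ hei s = e^-1].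
have sgP e : hei 0 <= e^-1 -> 0 <= sg e /\ hei (sg e) = e^-1.
  move=> /(height_le c0 tau0 hK hw)[s h1 h2].
  exact: (@xgetPex _ 0 [set s | 0 <= s /\ hei s = e^-1] (ex_intro _ s (conj h1 h2))).
have le_min s : hei 0 <= hei s by rewrite -(height_norm s) height_le_norm// normr0.
pose A (e : R) := if hei 0 <= e^-1 then C * half_area (sg e) else 0.
(* The height divided by [kap] replaces rho, and the factor X of [lead] removes the constant
   term. *)
exists A, (C *: (lead \Po (kap^-1 *: 'X))); split.
- move=> e e0; rewrite /A; case: ifPn => [/sgP[sg0 sgE]|].
    by rewrite /truncation -sgE; exact: has_area_catenoid_below.
  move=> h.
  suff -> : truncation (catenoid k.+1 c) e = set0 by exact: has_area_set0.
  apply/seteqP; split=> // x [+ xe]; rewrite -(image_catenoid_map c0 tau0 hK hw) => -[y Uy yx].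
  have [_ _ X] := catenoid_map_coord c tau w y.
  by move/negP: h; apply; apply: le_trans xe; rewrite -yx X.
- by rewrite hornerZ horner_comp hornerZ hornerX mulr0 leadE mul0r mulr0.
have inv_ge (B : R) : \forall e \near 0^'+, 0 < e /\ B <= e^-1.
  near=> e; have e0 : 0 < e by near: e; exact: nbhs_right_gt.
  split=> //; have B1 : 0 < `|B| + 1 by rewrite ltr_wpDl.
  have : e <= (`|B| + 1)^-1 by near: e; apply: nbhs_right_le; rewrite invr_gt0.
  rewrite -[X in X <= _]invrK lef_pV2 ?posrE ?invr_gt0//.
  by apply: le_trans; apply: (le_trans (ler_norm _)); rewrite lerDl.
have [w0 _ _ wsurj] := hw.
have sg_ge a : 0 <= a -> \forall e \near 0^'+, [/\ 0 < e, hei 0 <= e^-1 & a <= sg e].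
  move=> a0; near=> e.
  have [e0 ae] : 0 < e /\ hei a <= e^-1 by near: e; exact: (inv_ge (hei a)).
  have h0 := le_trans (le_min a) ae.
  have [sg0 sgE] := sgP _ h0; split=> //.
  rewrite leNgt; apply/negP => /(height_incr c0 tau0 hK hw sg0).
  by rewrite sgE ltNge ae.
have w_lim : w (sg e) @[e --> 0^'+] --> +oo.
  apply/cvgryPge => B; have [a wa] := wsurj `|B|.
  have a0 : 0 <= a.
    by rewrite leNgt; apply/negP => /(catenary_incr tau0 hw); rewrite w0 wa ltNge normr_ge0.
  near=> e; have [_ _] : [/\ 0 < e, hei 0 <= e^-1 & a <= sg e] by near: e; exact: sg_ge.
  rewrite le_eqVlt => /predU1P[<-|/(catenary_incr tau0 hw)]; rewrite wa.
    exact: ler_norm.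
  by move=> /ltW; apply: le_trans; exact: ler_norm.
have Psi_sg : Psi (w (sg e)) @[e --> 0^'+] --> l := cvg_comp _ _ w_lim Psi_lim.
pose E (s : R) := P.[r s ^+ 2] * p s - lead.[hei s / kap].
have E_sg : E (sg e) @[e --> 0^'+] --> 0.
  apply: norm_cvg0; apply: (@squeeze_cvgr _ _ _ _ (cst 0) (fun e => D * e)); first last.
  - rewrite -[X in _ --> X](mulr0 D); apply: cvgM; first exact: cvg_cst.
    by apply: cvg_within; exact: cvg_id.
  - exact: cvg_cst.
  near=> e; rewrite normr_ge0 /=.
  have [e0 h0 sge] : [/\ 0 < e, hei 0 <= e^-1 & s0 <= sg e] by near: e; exact: sg_ge.
  by apply: (le_trans (expansion _ sge)); rewrite (sgP _ h0).2 invrK.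
have -> : - (4 * (pi ^+ k.+1 / k`!%:R) * (1 + tau) * l) = C * (0 - (1 + tau) * l).
  by rewrite /C; ring.
have : C * (E (sg e) - (1 + tau) * Psi (w (sg e))) @[e --> 0^'+] --> C * (0 - (1 + tau) * l).
  apply: cvgM; first exact: cvg_cst.
  apply: cvgB; first exact: E_sg.
  by apply: cvgM; [exact: cvg_cst|exact: Psi_sg].
apply: cvg_trans; apply: near_eq_cvg; near=> e.
have [e0 h0 _] : [/\ 0 < e, hei 0 <= e^-1 & 0 <= sg e] by near: e; exact: sg_ge.
rewrite /A h0 hornerZ horner_comp hornerZ hornerX /E /half_area.
have -> : hei (sg e) / kap = kap^-1 * e^-1 by rewrite (sgP _ h0).2 mulrC.
by rewrite -!mulrBr; congr (_ * _); ring.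
Unshelve. all: by end_near. Qed.

End catenoid_area.

(** * Dependence of the renormalized area on c *)

Section improper_integral.
Variable R : realType.
Local Notation mu := (@lebesgue_measure R).
Local Notation ray := (`[0, +oo[%classic : set R).

Lemma invr_oneDsqr_gt0 (y : R) : 0 < (1 + y ^+ 2)^-1.
Proof. by rewrite invr_gt0 ltr_pwDl// sqr_ge0. Qed.

Lemma integral_ray (f F : R -> R) (l : R) : (forall y, 0 <= f y) -> continuous f ->
  F 0 = 0 -> (forall y : R, is_derive y 1 F (f y)) -> F y @[y --> +oo] --> l ->
  (\int[mu]_(y in ray) (f y)%:E = l%:E)%E.
Proof.
move=> f0 cf F0 dF Fl.
rewrite (ge0_continuous_FTC2y _ _ Fl) ?F0 ?sube0//.
- by apply: continuous_subspaceT => y; exact: cf.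
- by apply: cvg_at_right_filter; rewrite -{2}F0; exact: is_derive_continuous (dF 0).
- by move=> y _; rewrite derive1E; case: (dF y).
Qed.

Lemma dominated_integrable_ray (f : R -> R) (C : R) : continuous f ->
  (forall y, `|f y| <= C * (1 + y ^+ 2)^-1) -> mu.-integrable ray (EFin \o f).
Proof.
move=> cf fC.
have cg : continuous (fun y : R => (1 + y ^+ 2)^-1) by exact: continuous_oneDsqrV.
have ig : mu.-integrable ray (EFin \o (fun y : R => C * (1 + y ^+ 2)^-1)).
  have -> : EFin \o (fun y : R => C * (1 + y ^+ 2)^-1) = (fun y => C%:E * ((1 + y ^+ 2)^-1)%:E)%E.
    by apply/funext => y; rewrite /= EFinM.
  apply: integrableZl => //; apply/integrableP; split.
    by apply/measurable_EFinP/measurable_funTS; exact: continuous_measurable_fun.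
  under eq_integral do rewrite gee0_abs ?lee_fin ?(ltW (invr_oneDsqr_gt0 _))//.
  by rewrite integral0y_oneDsqr ltry.
apply: le_integrable ig => //.
  by apply/measurable_EFinP/measurable_funTS; exact: continuous_measurable_fun.
by move=> y _; rewrite lee_fin; apply: le_trans (fC y) _; exact: ler_norm.
Qed.

(* A continuous [f] dominated by [C/(1+y^2)] is the difference of two nonnegative
   ones, to which the fundamental theorem on a half-line applies. *)
Lemma dominated_primitive_limit (f F : R -> R) (C : R) : continuous f ->
  (forall y, `|f y| <= C * (1 + y ^+ 2)^-1) -> F 0 = 0 ->
  (forall y : R, is_derive y 1 F (f y)) ->
  F y @[y --> +oo] --> \int[mu]_(y in ray) f y.
Proof.
move=> cf fC F0 dF.
have cg : continuous (fun y : R => (1 + y ^+ 2)^-1) by exact: continuous_oneDsqrV.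
have C0 : 0 <= C.
  by have := le_trans (normr_ge0 _) (fC 0); rewrite expr0n addr0 invr1 mulr1.
have dA (y : R) : is_derive y 1 (fun y => C * atan y) (C * (1 + y ^+ 2)^-1).
  by apply: (is_derive_eq (der_mul (der_cst C) (is_derive1_atan y))); rewrite mul0r add0r.
pose G y := F y + C * atan y.
have dG (y : R) : is_derive y 1 G (f y + C * (1 + y ^+ 2)^-1) := der_add (dF y) (dA y).
have g0 y : 0 <= f y + C * (1 + y ^+ 2)^-1.
  by have := fC y; rewrite ler_norml => /andP[h _]; lra.
have G_nd : nondecreasing_fun G.
  by move=> a b; apply: (derive_ge0_le dG) => y _ _; exact: g0.
have A0 : atan 0 = 0 :> R := atan0 R.
have G_ub : has_ubound (range G).
  exists (C * pi) => _ [y _ <-].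
  have [y0|y0] := leP 0 y; last first.
    apply: (@le_trans _ _ 0); last by rewrite mulr_ge0// pi_ge0.
    by apply: le_trans (G_nd _ _ (ltW y0)) _; rewrite /G F0 A0 mulr0 addr0.
  have : F y <= C * atan y.
    suff : C * atan 0 - F 0 <= C * atan y - F y by rewrite F0 A0 mulr0 subrr subr_ge0.
    apply: (derive_ge0_le (fun z => der_add (dA z) (der_opp (dF z)))) => // z _ _.
    by have := fC z; rewrite ler_norml => /andP[_ h]; lra.
  have : C * atan y <= C * (pi / 2) by rewrite ler_wpM2l// ltW// atan_ltpi2.
  by rewrite /G; lra.
have Gl := nondecreasing_cvgr G_nd G_ub.
set l := sup _ in Gl.
have Al : C * atan y @[y --> +oo] --> C * (pi / 2).
  by apply: cvgM; [exact: cvg_cst|exact: cvgy_atan].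
have cgC : continuous (fun y : R => C * (1 + y ^+ 2)^-1).
  by move=> y; apply: cvgM; [exact: cvg_cst|exact: cg].
have g0' (y : R) : 0 <= C * (1 + y ^+ 2)^-1.
  by rewrite mulr_ge0// ltW// invr_oneDsqr_gt0.
have iG : (\int[mu]_(y in ray) (f y + C * (1 + y ^+ 2)^-1)%:E = l%:E)%E.
  apply: (@integral_ray _ G) => //; last by rewrite /G F0 A0 mulr0 addr0.
  by move=> y; apply: cvgD; [exact: cf|exact: cgC].
have iA : (\int[mu]_(y in ray) (C * (1 + y ^+ 2)^-1)%:E = (C * (pi / 2))%:E)%E.
  by apply: (@integral_ray _ (fun y => C * atan y)) => //; rewrite A0 mulr0.
have -> : \int[mu]_(y in ray) f y = l - C * (pi / 2).
  have If := dominated_integrable_ray cf fC.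
  have Ig : mu.-integrable ray (EFin \o (fun y : R => C * (1 + y ^+ 2)^-1)).
    by apply: (@dominated_integrable_ray _ C) => // y; rewrite ger0_norm.
  have := @RintegralD _ _ _ mu ray _ _ (measurable_itv _) If Ig; rewrite {1 3}/Rintegral iG iA /= => ->.
  by rewrite addrK.
have -> : F = (fun y => G y - C * atan y) by apply/funext => y; rewrite /G addrK.
exact: cvgB.
Qed.

Lemma dominated_primitive_continuous (h : R -> R -> R) (C u v : R) :
  (forall t, continuous (h t)) -> (forall y, continuous (h ^~ y)) ->
  (forall t y, u < t -> t < v -> `|h t y| <= C * (1 + y ^+ 2)^-1) ->
  forall t, u < t -> t < v -> {for t, continuous (fun t => \int[mu]_(y in ray) h t y)}.
Proof.
move=> ch cht hC t ut tv.
apply: (@continuity_under_integral R _ _ mu h ray (measurable_itv _) u v _ _ (fun y => C * (1 + y ^+ 2)^-1)) => //.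
- move=> x; rewrite /= in_itv /= => /andP[ux xv].
  by apply: (@dominated_integrable_ray _ C) => // y; exact: hC.
- by apply: aeW => y _ x _; exact: cht.
- apply: (@dominated_integrable_ray _ C).
    move=> y; apply: cvgM; first exact: cvg_cst.
    exact: continuous_oneDsqrV.
  move=> y; rewrite ger0_norm//; exact: le_trans (normr_ge0 _) (hC _ y ut tv).
- move=> x; rewrite /= in_itv /= => /andP[ux xv].
  by apply: aeW => y _; exact: hC.
- by rewrite inE /= in_itv /= ut tv.
Qed.

End improper_integral.

Section area_defect.
Variables (R : realType) (k : nat).
Local Notation mu := (@lebesgue_measure R).
Local Notation P := (area_poly R k).
Local Notation Q := (defect_poly R k).
Local Notation N := (k.*2.+1%:R : R).
Local Notation psi := (defect_density k).
Local Notation S := (root_profile k).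

(** Defined as an integral rather than as the limit of Psi, so that continuity in tau comes from
    continuity under the integral sign. *)
Definition area_defect (tau : R) : R := \int[mu]_(y in `[0, +oo[) psi tau y.

Let den_gt0 tau (y : R) : 0 <= tau -> 0 < xi y ^+ k.*2.+3 * S tau y.
Proof. by move=> t0; rewrite mulr_gt0 ?exprn_gt0 ?xi_gt0 ?root_profile_gt0. Qed.

Lemma continuous_defect_density (tau : R) : 0 <= tau -> continuous (psi tau).
Proof.
move=> t0 y.
exact: is_derive_continuous (der_mul (der_horner Q (der_mul (der_cst tau) (der_exp 2 (der_xi y))))
  (der_inv (der_mul (der_exp k.*2.+3 (der_xi y)) (der_root_profile k y t0))
    (lt0r_neq0 (den_gt0 y t0)))).
Qed.

Lemma continuous_defect_density_param (y : R) : continuous (fun tau : R => psi `|tau| y).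
Proof.
move=> t; have t0 := normr_ge0 t.
apply: (@continuous_comp _ _ _ (fun t : R => `|t|) (psi ^~ y)); first exact: norm_continuous.
apply: cvgM.
  exact: is_derive_continuous (der_horner Q (der_mul (is_derive_id (`|t|) 1) (der_cst (xi y ^+ 2)))).
apply: cvgV; first exact: lt0r_neq0 (den_gt0 y t0).
apply: cvgM; first exact: cvg_cst.
apply: (@continuous_comp _ _ _ (fun t => (profile_poly k t).[1 + y ^+ 2]) Num.sqrt).
  exact: continuous_profile_poly.
exact: sqrt_continuous.
Qed.

Lemma defect_density_bound (M : R) : 0 <= M -> exists C, forall tau y, 0 <= tau <= M ->
  `|psi tau y| <= C * (1 + y ^+ 2)^-1.
Proof.
move=> /(defect_poly_bound k)[C C0 hC]; exists C => tau y /andP[t0 tM].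
have x1 : 1 <= xi y ^+ 2 by rewrite exprn_ege1// xi_ge1.
have X0 : 0 < xi y ^+ k.*2.+2 by rewrite exprn_gt0// xi_gt0.
rewrite -xi_sqr /defect_density normrM normfV (gtr0_norm (den_gt0 y t0)).
rewrite ler_pdivrMr ?den_gt0//.
have h := hC tau _ (introT andP (conj t0 tM)) x1.
apply: (le_trans h); rewrite -[X in _ <= X]mulrA ler_wpM2l//.
have -> : (xi y ^+ 2)^-1 * (xi y ^+ k.*2.+3 * S tau y) = xi y ^+ 2 ^+ k * (xi y * S tau y).
  rewrite -exprM mul2n -[k.*2.+3]addn3 exprD.
  have := lt0r_neq0 (xi_gt0 y); move: (xi y ^+ k.*2) (xi y) => a b bn.
  by field.
rewrite ler_peMr ?exprn_ge0 ?(ltW (xi_gt0 y))//.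
by rewrite mulr_ege1// ?xi_ge1// root_profile_ge1.
Qed.

Lemma defect_primitive (tau : R) : 0 <= tau -> exists Psi, [/\ Psi 0 = 0,
  forall y : R, is_derive y 1 Psi (psi tau y) & Psi y @[y --> +oo] --> area_defect tau].
Proof.
move=> t0; have cpsi := continuous_defect_density t0.
have [Psi Psi0 dPsi] := exists_primitive cpsi; exists Psi; split=> //.
have [C hC] := defect_density_bound t0.
apply: (@dominated_primitive_limit _ _ _ C) => // y.
by apply: hC; rewrite t0 lexx.
Qed.

(** The absolute value extends the function to negative parameters, so that t = 0, the case of the
    limit c to +oo, is interior to the interval on which the domination holds. *)
Lemma continuous_area_defect (t : R) : {for t, continuous (fun t => area_defect `|t|)}.
Proof.
have M0 : 0 <= `|t| + 1 by rewrite addr_ge0.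
have [C hC] := defect_density_bound M0.
have n1 := ler_norm t; have n2 := ler_norm (- t); rewrite normrN in n2.
apply: (@dominated_primitive_continuous R (fun t => psi `|t|) C (- `|t| - 1) (`|t| + 1)).
- by move=> x; apply: continuous_defect_density.
- exact: continuous_defect_density_param.
- move=> x y h1 h2; apply: hC; rewrite normr_ge0 ler_norml; apply/andP; split; lra.
- lra.
- lra.
Qed.

(** At tau = 0 the profile is that of the Euclidean catenoid with unit neck: the speed s satisfies 1
    - s^2 = xi^-(4k+2). As 0 <= s <= 1, it follows that 1 - s <= 1 - s^2 <= 1 / y for y >= 1. *)
Lemma radial_speed0_lim : radial_speed k 0 y @[y --> +oo] --> (1 : R).
Proof.
have -> : radial_speed k 0 = (fun y : R => 1 - (1 - radial_speed k 0 y)).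
  by apply/funext => y; ring.
rewrite -[X in _ --> X]subr0; apply: cvgB; first exact: cvg_cst.
apply: (@squeeze_cvgr _ _ _ _ (cst 0) (fun y : R => y^-1)); first last.
- by apply/gtr0_cvgV0; [exact: nbhs_pinfty_gt|exact: cvg_id].
- exact: cvg_cst.
near=> y; have y0 : 1 <= y by near: y; apply: nbhs_pinfty_ge; rewrite num_real.
have y_gt0 : 0 < y by exact: lt_le_trans y0.
have X0 := xi_gt0 y; have Xn : xi y ^+ 2 ^+ k.*2.+1 != 0 by rewrite !expf_neq0// lt0r_neq0.
set s := radial_speed k 0 y.
have s0 : 0 <= s.
  apply: divr_ge0; last exact/exprn_ge0/ltW.
  by apply: mulr_ge0; [exact: ltW|exact/ltW/root_profile_gt0].
have s2 : s ^+ 2 = 1 - (xi y ^+ 2 ^+ k.*2.+1)^-1.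
  rewrite /s /radial_speed expr_div_n exprMn root_profile_energy//.
  by rewrite [(xi y ^+ _) ^+ 2]exprAC mul0r !addr0 mulr1 mulrBl divff// div1r.
have i0 : 0 <= (xi y ^+ 2 ^+ k.*2.+1)^-1 by rewrite invr_ge0 !exprn_ge0// ltW.
have s1 : s <= 1 by apply: ler_of_sqr => //; rewrite s2 expr1n; lra.
have y1 : (xi y ^+ 2 ^+ k.*2.+1)^-1 <= y^-1.
  rewrite lef_pV2 ?posrE ?exprn_gt0//; apply: (@le_trans _ _ (xi y ^+ 2)).
    by rewrite xi_sqr; nra.
  by rewrite [leRHS]exprS ler_peMr ?exprn_ge0 ?(ltW X0)// !exprn_ege1// xi_ge1.
apply/andP; split; first by rewrite /=; lra.
nra.
Unshelve. all: by end_near. Qed.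

(** At tau = 0 the argument of Q is constantly 0 and Q(0) = N P(0), so the density is P(0) times the
    derivative of [radial_speed k 0], which goes from 0 to 1. *)
Lemma area_defect0 : area_defect 0 = P.[0].
Proof.
have [Psi [Psi0 dPsi Psil]] := defect_primitive (lexx (0 : R)).
have E y : Psi y = P.[0] * radial_speed k 0 y.
  apply/eqP; rewrite -subr_eq0; apply/eqP.
  have d (z : R) : is_derive z 1 (fun z => Psi z - P.[0] * radial_speed k 0 z) 0.
    apply: (is_derive_eq (der_add (dPsi z) (der_opp (der_mul (der_cst P.[0])
      (der_radial_speed k z (lexx 0)))))).
    rewrite /defect_density /defect_poly hornerD hornerN !hornerZ hornerM hornerX !mul0r.
    have := lt0r_neq0 (den_gt0 z (lexx 0)); move: (_ * S 0 z) => a an.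
    by field.
  by rewrite (derive0_eq y 0 d) Psi0 /radial_speed !mul0r mulr0 subrr.
have : Psi y @[y --> +oo] --> P.[0].
  have -> : Psi = (fun y => P.[0] * radial_speed k 0 y) by exact/funext.
  rewrite -[X in _ --> X]mulr1; apply: cvgM; first exact: cvg_cst.
  exact: radial_speed0_lim.
by move=> h; apply: (etrans (esym (cvg_lim _ Psil)) (cvg_lim _ h)).
Qed.

(** For tau >= T0 the density is nonnegative, since xi^2 >= 1 keeps the argument of Q above T0. Only
    the interval from 0 to 1 is kept, where xi <= 2 and S is at most a constant times sqrt (1 +
    tau). *)
Lemma area_defect_ge : exists T0 kap : R, [/\ 0 < T0, 0 < kap &
  forall tau, T0 <= tau -> kap / Num.sqrt (1 + tau) <= area_defect tau].
Proof.
have [T0 T00 hT0] := defect_poly_pos R k.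
pose D : R := 2 ^+ k.*2.+3 * Num.sqrt (k.*2.+2%:R * 2 ^+ k.*2.+1).
have D0 : 0 < D by rewrite mulr_gt0 ?exprn_gt0// sqrtr_gt0 mulr_gt0// exprn_gt0.
exists T0, (N^-1 / D); split=> //; first by rewrite divr_gt0// invr_gt0.
move=> tau hT; have t0 : 0 <= tau by exact: le_trans (ltW T00) hT.
have [Psi [Psi0 dPsi Psil]] := defect_primitive t0.
have r1 : 0 < Num.sqrt (1 + tau) by rewrite sqrtr_gt0 ltr_pwDl.
have Qpos y : N^-1 <= Q.[tau * xi y ^+ 2].
  by apply: hT0; apply: (le_trans hT); rewrite ler_peMr// exprn_ege1// xi_ge1.
have Ni : 0 < N^-1 by rewrite invr_gt0.
have psi0 y : 0 <= psi tau y.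
  by apply: divr_ge0; [exact: le_trans (ltW Ni) (Qpos y)|exact: ltW (den_gt0 y t0)].
have Psi_nd a b : a <= b -> Psi a <= Psi b.
  by apply: (derive_ge0_le dPsi) => y _ _; exact: psi0.
apply: (@le_trans _ _ (Psi 1)); last first.
  have <- : lim (Psi y @[y --> +oo]) = area_defect tau by apply/cvg_lim.
  apply: limr_ge; first by apply/cvg_ex; exists (area_defect tau).
  by near=> y; apply: Psi_nd; near: y; apply: nbhs_pinfty_ge; rewrite num_real.
set e := N^-1 / D / Num.sqrt (1 + tau).
have psi_ge y : 0 < y -> y < 1 -> e <= psi tau y.
  move=> y0 y1.
  have x2 : xi y <= 2 by apply: ler_of_sqr => //; rewrite xi_sqr; nra.
  have X2 : 1 + y ^+ 2 <= 2 by nra.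
  have X1 : 1 <= 1 + y ^+ 2 by rewrite lerDl sqr_ge0.
  rewrite /e -mulrA -invfM; apply: ler_pM.
  - exact: ltW.
  - by rewrite invr_ge0 mulr_ge0// ltW.
  - exact: Qpos.
  have Ds0 : 0 < D * Num.sqrt (1 + tau) by exact: mulr_gt0.
  suff : xi y ^+ k.*2.+3 * S tau y <= D * Num.sqrt (1 + tau).
    by move=> h; rewrite lef_pV2 // posrE; exact: den_gt0.
  rewrite /D -(mulrA (2 ^+ k.*2.+3)); apply: ler_pM.
  - by apply: exprn_ge0; apply: ltW; exact: xi_gt0.
  - exact: sqrtr_ge0.
  - by apply: lerXn2r => //; rewrite nnegrE ltW// xi_gt0.
  rewrite -sqrtrM; last by rewrite mulr_ge0// exprn_ge0.
  apply: ler_wsqrtr; apply: (le_trans (profile_poly_le k t0 X1)).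
  rewrite [leRHS]mulrC [leRHS]mulrA; apply: ler_wpM2l; first by rewrite mulr_ge0// addr_ge0.
  by apply: lerXn2r => //; rewrite nnegrE ?(le_trans _ X1).
suff : Psi 0 - e * 0 <= Psi 1 - e * 1 by rewrite Psi0 mulr0 mulr1 subrr subr_ge0.
apply: (derive_ge0_le (fun z => der_add (dPsi z)
  (der_opp (der_mul (der_cst e) (is_derive_id z 1))))) => // y y0 y1.
by rewrite mul0r add0r mulr1 subr_ge0 psi_ge.
Unshelve. all: by end_near. Qed.

End area_defect.

Section neck.
Variables (R : realType) (k : nat).
Local Notation N := (k.*2.+1%:R : R).

Definition neck_level (t : R) := t ^+ k.*2.+1 * (1 + t).
Local Notation g := neck_level.

Lemma neck_level_lt a b : 0 <= a -> a < b -> g a < g b.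
Proof.
move=> a0 ab; have b0 : 0 < b by exact: le_lt_trans ab.
apply: ltr_pM; [exact: exprn_ge0|by rewrite addr_ge0| |by rewrite ltrD2l].
by apply: ltrXn2r.
Qed.

Lemma neck_level_surj y : 0 < y -> exists2 t, 0 < t & g t = y.
Proof.
move=> y0; have dg (t : R) : is_derive t 1 g _ :=
  der_mul (der_exp k.*2.+1 (is_derive_id t 1)) (der_add (der_cst 1) (is_derive_id t 1)).
have g0 : g 0 = 0 by rewrite /g exprS !mul0r.
have hy : y <= g (y + 1).
  have y1 : 1 <= (y + 1) ^+ k.*2.+1 by rewrite exprn_ege1// lerDr ltW.
  apply: (@le_trans _ _ (1 + (y + 1))); first lra.
  by rewrite ler_peMl// !addr_ge0// ltW.
have y10 : 0 <= y + 1 by rewrite addr_ge0// ltW.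
have [||t] := @IVT R g 0 (y + 1) y y10.
- exact: is_derive_within dg.
- have h0 : g 0 <= g (y + 1) by rewrite g0 (le_trans (ltW y0)).
  by rewrite (min_idPl h0) (max_idPr h0) g0 (ltW y0).
rewrite in_itv /= => /andP[t0 _] gt; exists t => //.
by rewrite lt_neqAle t0 andbT eq_sym; apply/eqP => t00; move: y0; rewrite -gt t00 g0 ltxx.
Qed.

Definition neck_constant (c : R) : R := (N ^+ 2) ^+ k.*2.+1 * (c^-1) ^+ (2 * k.*2.+2).

Definition neck (c : R) : R := xget 0 [set t | 0 < t /\ g t = neck_constant c].

Lemma neckP c : 0 < c -> 0 < neck c /\ g (neck c) = neck_constant c.
Proof.
move=> c0; have K0 : 0 < neck_constant c by rewrite mulr_gt0// !exprn_gt0// invr_gt0.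
have [t t0 gt] := neck_level_surj K0.
exact: (@xgetPex _ 0 [set t | 0 < t /\ g t = neck_constant c] (ex_intro _ t (conj t0 gt))).
Qed.

Lemma neck_ge0 c : 0 <= neck c.
Proof. by rewrite /neck; case: xgetP => [t _ [/ltW]|]. Qed.

Lemma neck_equation c : 0 < c ->
  neck c ^+ k.*2.+1 * (1 + neck c) * (c ^+ 2) ^+ k.*2.+2 = (N ^+ 2) ^+ k.*2.+1.
Proof.
move=> c0; have [_] := neckP c0; rewrite /g => ->.
by rewrite /neck_constant -mulrA -[(c ^+ 2) ^+ _]exprM -exprMn mulVf ?gt_eqF// expr1n mulr1.
Qed.

(** The inverse of a strictly increasing function is continuous. An arbitrary filter covers both
    continuity at a point and the limit at +oo. Monotonicity holds only on the nonnegative axis, so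
    the lower bound t0 - e is tested only when it is nonnegative. *)
Lemma neck_cvg (F : set_system R) (FF : Filter F) (t0 : R) : 0 <= t0 ->
  (\forall c \near F, 0 < c) -> neck_constant c @[c --> F] --> g t0 ->
  neck c @[c --> F] --> t0.
Proof.
move=> t00 F0 Kl; apply/cvgrPdist_lt => e e0.
have up : \forall c \near F, neck_constant c < g (t0 + e).
  by apply: cvgr_lt Kl _ _; rewrite neck_level_lt// ltrDl.
have low : \forall c \near F, 0 <= t0 - e -> g (t0 - e) < neck_constant c.
  have [h|h] := leP 0 (t0 - e); last by apply: nearW.
  have : \forall c \near F, g (t0 - e) < neck_constant c.
    by apply: cvgr_gt Kl _ _; rewrite neck_level_lt// ltrBlDr ltrDl.
  by apply: filterS => c.
near=> c; have c0 : 0 < c by near: c.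
have [n0 gn] := neckP c0.
have nup : neck c < t0 + e.
  rewrite ltNge le_eqVlt; apply/negP => /predU1P[h|/neck_level_lt h].
    by have : neck_constant c < g (t0 + e) by [near: c]; rewrite h gn ltxx.
  have : neck_constant c < g (t0 + e) by near: c.
  by rewrite -gn ltNge ltW// h// addr_ge0// ltW.
have nlow : t0 - e < neck c.
  have [h|h] := leP 0 (t0 - e); last exact: lt_trans n0.
  have lc : g (t0 - e) < neck_constant c by move: h; near: c.
  rewrite ltNge le_eqVlt; apply/negP => /predU1P[E|E].
    by move: lc; rewrite -gn E ltxx.
  by have := neck_level_lt (ltW n0) E; rewrite gn ltNge (ltW lc).
rewrite ltr_distlC; apply/andP; split; lra.
Unshelve. all: by end_near. Qed.

Lemma neck_cvgy (F : set_system R) (FF : Filter F) :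
  (\forall c \near F, 0 < c) -> neck_constant c @[c --> F] --> +oo ->
  neck c @[c --> F] --> +oo.
Proof.
move=> F0 /cvgryPge Kl; apply/cvgryPge => B.
have F1 := Kl (g `|B|).
near=> c; have c0 : 0 < c by near: c.
have [n0 gn] := neckP c0; apply: (le_trans (ler_norm B)).
rewrite leNgt; apply/negP => /(neck_level_lt (ltW n0)); rewrite gn ltNge.
by move/negP; apply; near: c.
Unshelve. all: by end_near. Qed.

Lemma neck_constant_continuous c : 0 < c -> {for c, continuous neck_constant}.
Proof.
move=> c0; apply: is_derive_continuous (der_mul (der_cst ((N ^+ 2) ^+ k.*2.+1))
  (der_exp (2 * k.*2.+2) (der_inv (is_derive_id c 1) _))).
by rewrite gt_eqF.
Qed.

Lemma neck_constant_cvgy : neck_constant c @[c --> +oo] --> 0.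
Proof.
rewrite -[X in _ --> X](mulr0 ((N ^+ 2) ^+ k.*2.+1)); apply: cvgM; first exact: cvg_cst.
have -> : 0 = 0 ^+ (2 * k.*2.+2) :> R by rewrite mulnS exprS mul0r.
apply: (@cvg_comp _ _ _ (fun c : R => c^-1) (fun x => x ^+ (2 * k.*2.+2)) _ (nbhs (0 : R))).
  by apply/gtr0_cvgV0; [exact: nbhs_pinfty_gt|exact: cvg_id].
exact: exprn_continuous.
Qed.

Lemma neck_constant_cvg0 : neck_constant c @[c --> 0^'+] --> +oo.
Proof.
apply: (@ger_cvgy _ _ _ _ (fun c : R => c^-1)); last first.
  apply/cvgrVy; last by apply: cvg_within; exact: cvg_id.
  exact: nbhs_right_gt.
near=> c; have c0 : 0 < c by near: c; exact: nbhs_right_gt.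
have c1 : 1 <= c^-1 by rewrite invf_ge1//; near: c; exact: nbhs_right_le.
have N1 : 1 <= (N ^+ 2) ^+ k.*2.+1 by rewrite !exprn_ege1// ler1n.
apply: (@le_trans _ _ (c^-1 ^+ (2 * k.*2.+2))); last first.
  by rewrite ler_peMl// exprn_ge0// invr_ge0 ltW.
by rewrite mulnS exprS ler_peMr ?(le_trans ler01 c1)// exprn_ege1.
Unshelve. all: by end_near. Qed.

Definition catenoid_renormalized_area (c : R) : R :=
  - (4 * (pi ^+ k.+1 / k`!%:R) * (1 + neck c) * area_defect k (neck c)).
Local Notation AR := catenoid_renormalized_area.

Lemma catenoid_has_renormalized_area_neck c : 0 < c ->
  has_renormalized_area (catenoid k.+1 c) (AR c).
Proof.
move=> c0; have [t0 _] := neckP c0; have [w hw] := exists_catenary k t0.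
have [Psi [Psi0 dPsi Psil]] := defect_primitive k (ltW t0).
exact: (catenoid_has_renormalized_area c0 t0 (neck_equation c0) hw Psi0 dPsi Psil).
Qed.

Lemma catenoid_renormalized_area_cvg (F : set_system R) (FF : Filter F) (t0 : R) : 0 <= t0 ->
  (\forall c \near F, 0 < c) -> neck_constant c @[c --> F] --> g t0 ->
  AR c @[c --> F] --> - (4 * (pi ^+ k.+1 / k`!%:R) * (1 + t0) * area_defect k t0).
Proof.
move=> t00 F0 Kl; have nl := neck_cvg FF t00 F0 Kl.
apply: cvgN; apply: cvgM.
  apply: cvgM; first exact: cvg_cst.
  by apply: cvgD; [exact: cvg_cst|exact: nl].
have -> : (fun c => area_defect k (neck c)) = (fun c => area_defect k `|neck c|).
  by apply/funext => c; rewrite ger0_norm// neck_ge0.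
rewrite -[X in area_defect k X](ger0_norm t00).
exact: (cvg_comp _ _ nl (@continuous_area_defect R k t0)).
Qed.

Lemma catenoid_renormalized_area_continuous c : 0 < c -> {for c, continuous AR}.
Proof.
move=> c0; have [n0 gn] := neckP c0.
apply: (@catenoid_renormalized_area_cvg _ _ _ (ltW n0)).
  exact: lt_nbhsr.
by rewrite gn; exact: neck_constant_continuous.
Qed.

Lemma catenoid_renormalized_area_cvgy : AR c @[c --> +oo] -->
  2 * ((- (4 * pi)) ^+ k.+1 * k.+1`!%:R / (2 * k.+1)`!%:R : R).
Proof.
have -> : 2 * ((- (4 * pi)) ^+ k.+1 * k.+1`!%:R / (2 * k.+1)`!%:R : R) =
    - (4 * (pi ^+ k.+1 / k`!%:R) * (1 + 0) * area_defect k 0).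
  rewrite area_defect0 area_poly0.
  have -> : (- (4 * pi)) ^+ k.+1 = (-4) ^+ k.+1 * pi ^+ k.+1 :> R.
    by rewrite -exprMn; congr (_ ^+ _); ring.
  have f0 : k`!%:R != 0 :> R by rewrite pnatr_eq0 -lt0n fact_gt0.
  have g0 : (2 * k.+1)`!%:R != 0 :> R by rewrite pnatr_eq0 -lt0n fact_gt0.
  move: (k`!%:R) f0 ((2 * k.+1)`!%:R) g0 (k.+1`!%:R) => f f0 h h0 x.
  by field; rewrite f0 h0.
apply: catenoid_renormalized_area_cvg => //; first exact: nbhs_pinfty_gt.
by rewrite /g exprS !mul0r; exact: neck_constant_cvgy.
Qed.

Lemma catenoid_renormalized_area_cvg0 : AR c @[c --> 0^'+] --> -oo.
Proof.
have [T0 [kap [T00 kap0 hkap]]] := area_defect_ge R k.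
pose C : R := 4 * (pi ^+ k.+1 / k`!%:R).
have C0 : 0 < C by rewrite mulr_gt0// divr_gt0 ?exprn_gt0 ?pi_gt0// ltr0n fact_gt0.
have nl : neck c @[c --> 0^'+] --> +oo.
  by apply: neck_cvgy; [exact: nbhs_right_gt|exact: neck_constant_cvg0].
move/cvgryPge: nl => nl; apply/cvgrNyPle => B.
(* tau >= T0 gives access to the lower bound on the defect, and tau >= M^2 gives sqrt (1 + tau) >=
   M, hence C kap sqrt (1 + tau) >= |B|. *)
have F1 := nl T0; pose M := `|B| / (C * kap); have F2 := nl (M ^+ 2).
near=> c; have nT : T0 <= neck c by near: c.
have nM : M ^+ 2 <= neck c by near: c.
have r1 : 0 < 1 + neck c by rewrite ltr_pwDl// neck_ge0.
have s1 : 0 < Num.sqrt (1 + neck c) by rewrite sqrtr_gt0.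
have s2 : Num.sqrt (1 + neck c) ^+ 2 = 1 + neck c by rewrite sqr_sqrtr// ltW.
have Ms : M <= Num.sqrt (1 + neck c).
  by apply: ler_of_sqr; [exact: ltW|rewrite s2; lra].
have h : C * kap * Num.sqrt (1 + neck c) <= C * (1 + neck c) * area_defect k (neck c).
  have := hkap _ nT; rewrite ler_pdivrMr// => h.
  apply: (@le_trans _ _ (C * (area_defect k (neck c) * Num.sqrt (1 + neck c)) *
    Num.sqrt (1 + neck c))).
    by rewrite ler_wpM2r ?(ltW s1)// ler_wpM2l// ltW.
  by rewrite -[in X in _ <= X]s2 le_eqVlt; apply/orP; left; apply/eqP; ring.
have hB : `|B| <= C * kap * Num.sqrt (1 + neck c).
  by rewrite [X in _ <= X]mulrC -(ler_pdivrMr _ _ (mulr_gt0 C0 kap0)); exact: Ms.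
rewrite /AR -/C lerNl; apply: le_trans h; apply: le_trans hB.
by rewrite -normrN ler_norm.
Unshelve. all: by end_near. Qed.

End neck.

(** * Minimality *)

Section radial_weingarten.
Variables (R : realType) (m : nat) (sigma : 'I_m -> 'I_m.+2).
Hypothesis sigma_inj : injective sigma.
Local Notation emb := (coordinate_embedding sigma).

(** The operator with eigenvalue [lambda] on the line of x and [mu] on its orthogonal complement:
    the form that rotational symmetry imposes on the shape operator. *)
Definition radial_operator (lambda mu : R) (x : 'rV[R]_m) : 'M[R]_m :=
  mu%:M + ((lambda - mu) / sqnorm x) *: (x^T *m x).

Lemma radial_operatorE lambda mu (x : 'rV[R]_m) i j : radial_operator lambda mu x i j =
  mu *+ (i == j) + (lambda - mu) / sqnorm x * (x 0 i * x 0 j).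
Proof. by rewrite !mxE big_ord1 !mxE. Qed.

Lemma radial_operator_trace lambda mu (x : 'rV[R]_m) : sqnorm x != 0 ->
  \tr (radial_operator lambda mu x) = m%:R * mu + (lambda - mu).
Proof.
move=> x0; rewrite mxtraceD mxtrace_scalar mxtraceZ mxtrace_mulC [X in _ + _ * X]trace_mx11.
rewrite mxE (_ : \sum_j _ = sqnorm x); first by rewrite divfK// mulr_natl.
by apply: eq_bigr => i _; rewrite mxE expr2.
Qed.

Lemma radial_operator_sum (V : lmodType R) lambda mu (x : 'rV[R]_m) (v : 'I_m -> V) i :
  \sum_j radial_operator lambda mu x i j *: v j =
  mu *: v i + ((lambda - mu) / sqnorm x * x 0 i) *: \sum_j x 0 j *: v j.
Proof.
under eq_bigr do rewrite radial_operatorE scalerDl.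
rewrite big_split /=; congr (_ + _); last first.
  by rewrite scaler_sumr; apply: eq_bigr => j _; rewrite scalerA mulrA.
rewrite (bigD1 i)//= eqxx mulr1n big1 ?addr0// => j ji.
by rewrite eq_sym (negbTE ji) mulr0n scale0r.
Qed.

(** The first equation is the eigenvalue mu on the spheres. The other two are the eigenvalue lambda
    along the ray, split into the part along x, where 2 t b' + b = lambda (2 t a' + a), and the part
    in the axis plane. *)
Lemma der_radial_weingarten (a b : R -> R) (g h : R -> 'rV[R]_m.+2) (x : 'rV[R]_m) (i : 'I_m)
    (da db lambda mu : R) (dg dh : 'rV[R]_m.+2) :
  sqnorm x != 0 ->
  is_derive (sqnorm x) 1 a da -> is_derive (sqnorm x) 1 b db ->
  (forall k, is_derive (sqnorm x) 1 (fun t => g t 0 k) (dg 0 k)) ->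
  (forall k, is_derive (sqnorm x) 1 (fun t => h t 0 k) (dh 0 k)) ->
  b (sqnorm x) = mu * a (sqnorm x) ->
  2 * sqnorm x * db = lambda * (2 * sqnorm x * da) + (lambda - mu) * a (sqnorm x) ->
  dh = lambda *: dg ->
  is_derive x (delta_mx 0 i) (radial sigma b h)
    (\sum_k radial_operator lambda mu x i k *: partial k (radial sigma a g) x).
Proof.
move=> t0 ha hb hg hh Eb Edb Edh.
apply: (is_derive_eq (der_radial sigma_inj i hb hh)).
have P j : partial j (radial sigma a g) x =
    a (sqnorm x) *: delta_mx 0 (sigma j) + (2 * x 0 j) *: (da *: emb x + dg).
  by have [] := der_radial sigma_inj j ha hg.
under eq_bigr do rewrite P.
rewrite radial_operator_sum.
have -> : \sum_j x 0 j *: (a (sqnorm x) *: delta_mx 0 (sigma j) + (2 * x 0 j) *: (da *: emb x + dg)) =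
    a (sqnorm x) *: emb x + (2 * sqnorm x) *: (da *: emb x + dg).
  under eq_bigr do rewrite scalerDr.
  rewrite big_split /=; congr (_ + _).
    by rewrite scaler_sumr; apply: eq_bigr => j _; rewrite !scalerA mulrC.
  rewrite /sqnorm mulr_sumr scaler_suml; apply: eq_bigr => j _.
  by rewrite scalerA; congr (_ *: _); ring.
rewrite Edh Eb; move: (sqnorm x) (a _) (x 0 i) t0 Edb => t at_ xi t0 Edb.
have -> : db = lambda * da + (lambda - mu) * at_ / (2 * t).
  have t2 : 2 * t != 0 by rewrite mulf_neq0.
  by apply: (mulfI t2); rewrite Edb; field.
apply/rowP => j; rewrite !mxE.
by field.
Qed.

End radial_weingarten.

Section catenoid_minimal.
Variables (R : realType) (k : nat) (c tau : R) (w : R -> R).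
Hypothesis c0 : 0 < c.
Hypothesis tau0 : 0 < tau.
Local Notation N := (k.*2.+1%:R : R).
Hypothesis hK : tau ^+ k.*2.+1 * (1 + tau) * (c ^+ 2) ^+ k.*2.+2 = (N ^+ 2) ^+ k.*2.+1.
Hypothesis hw : is_catenary k tau w.
Local Notation m := (2 * k.+1)%N.
Local Notation r := (radius tau w).
Local Notation p := (speed k tau w).
Local Notation q := (flux k tau w).
Local Notation v := (catenoid_v k.+1 c).
Local Notation U := (punctured (R := R) (m := m)).
Local Notation rho := (lorentz tau w).
Local Notation L := (@log_norm R k).
Local Notation hei := (height k c tau w).
Local Notation M := (@catenoid_map R k c tau w).
Local Notation emb := (coordinate_embedding (@low_index k)).
Local Notation ax := (axis (axis_index k)).

Let r0 s : 0 < r s. Proof. exact: radius_gt0. Qed.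
Let rho0 s : 0 < rho s. Proof. exact: lorentz_gt0. Qed.

(** Take q as the spherical component. In the frame (sinh v, cosh v), (cosh v, sinh v) of the axis
    plane, orthogonality to the position forces the coefficient q r / rho, and unit norm the
    coefficient p / rho up to sign, by p^2 + q^2 = rho^2. *)
Definition normal_depth s := (q s * r s * sinh (v s) + p s * cosh (v s)) / rho s.
Definition normal_height s := (q s * r s * cosh (v s) + p s * sinh (v s)) / rho s.

Definition catenoid_normal : 'rV[R]_m -> 'rV[R]_m.+2 :=
  cylindrical (@low_index k) (axis_index k) (fun t => q (ln t / 2) * expR (- (ln t / 2)))
    (fun t => normal_depth (ln t / 2)) (fun t => normal_height (ln t / 2)).
Local Notation nu := catenoid_normal.

(** The two sides differ by multiples of the two hypotheses, as the intermediate expression shows.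
    With y and z standing for sinh v and cosh v in either order, one identity serves both
    components. *)
Lemma normal_equation (r' p' q' h y z : R) : r' != 0 -> h != 0 ->
  h ^+ 2 = 1 + r' ^+ 2 -> p' ^+ 2 + q' ^+ 2 = h ^+ 2 ->
  ((- N * q' * p' / r' * r' + q' * p') * y + q' * r' * (- (q' / h ^+ 2) * z) +
    ((r' + N * q' ^+ 2 / r') * z + p' * (- (q' / h ^+ 2) * y))) / h +
    (q' * r' * y + p' * z) * - (r' * p' / h / h ^+ 2) =
  - N * q' / r' * ((r' * p' * y - q' * z) / h).
Proof.
move=> rn hn h2 pq.
transitivity (- N * q' / r' * ((r' * p' * y - q' * z) / h) +
  (q' * p' * y * (h ^+ 2 - (1 + r' ^+ 2)) + r' * z * (h ^+ 2 - (p' ^+ 2 + q' ^+ 2))) / h ^+ 3).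
  by field; rewrite rn hn.
by rewrite pq -h2 subrr !mulr0 addr0 mul0r addr0.
Qed.

Let der_numerator (y z : R -> R) (s : R) :
  is_derive s 1 y (- (q s / rho s ^+ 2) * z s) -> is_derive s 1 z (- (q s / rho s ^+ 2) * y s) ->
  is_derive s 1 (fun s => (q s * r s * y s + p s * z s) / rho s)
    (- N * q s / r s * ((r s * p s * y s - q s * z s) / rho s)).
Proof.
move=> dy dz; have dr := der_radius tau0 hw s.
have rn := lt0r_neq0 (r0 s); have hn := lt0r_neq0 (rho0 s).
apply: (is_derive_eq (der_mul (der_add (der_mul (der_mul (der_flux tau0 hw s) dr) dy)
  (der_mul (der_speed tau0 hw s) dz)) (der_inv (der_lorentz tau0 hw s) hn))).
apply: normal_equation => //; first exact: lorentz_sqr.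
exact: speed_flux.
Qed.

Lemma der_normal_depth (s : R) : is_derive s 1 normal_depth
  (- N * q s / r s * ((r s * p s * sinh (v s) - q s * cosh (v s)) / rho s)).
Proof.
have dv := der_v c0 tau0 hK hw s.
exact: (der_numerator (der_sinh dv) (der_cosh dv)).
Qed.

Lemma der_normal_height (s : R) : is_derive s 1 normal_height
  (- N * q s / r s * ((r s * p s * cosh (v s) - q s * sinh (v s)) / rho s)).
Proof.
have dv := der_v c0 tau0 hK hw s.
exact: (der_numerator (der_cosh dv) (der_sinh dv)).
Qed.

(** Up to sign, the principal curvatures are q/r on the spheres and - N q/r along the generating
    curve. The factor - N comes from the first integral: q r^N is constant. *)
Lemma der_catenoid_normal (x : 'rV[R]_m) i : U x ->
  is_derive x (delta_mx 0 i) nu (\sum_j radial_operator (- N * q (L x) / r (L x))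
    (q (L x) / r (L x)) x i j *: partial j M x).
Proof.
move=> Ux; pose s := L x.
have rn := lt0r_neq0 (r0 s); have hn := lt0r_neq0 (rho0 s); have tn := lt0r_neq0 Ux.
have da := der_half_log Ux (der_mul (der_radius tau0 hw s) (der_exp_real (der_opp (is_derive_id s 1)))).
have db := der_half_log Ux (der_depth c0 tau0 hK hw s).
have dz := der_half_log Ux (der_height c0 tau0 hK hw s).
have na := der_half_log Ux (der_mul (der_flux tau0 hw s) (der_exp_real (der_opp (is_derive_id s 1)))).
have nb := der_half_log Ux (der_normal_depth s).
have nz := der_half_log Ux (der_normal_height s).
apply: (der_radial_weingarten (@low_index_inj k) i tn da na (der_axis (axis_index k) db dz)
  (der_axis (axis_index k) nb nz)).
- rewrite -/(L x) -/s; move: (expR _) => e; field.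
  exact: rn.
- rewrite -/(L x) -/s; move: (expR _) => e; field.
  by rewrite rn tn.
- rewrite -/s; move: ((_ - _) / _) ((_ - _) / _) => B Z.
  by apply/rowP => j; rewrite !mxE !mulrDr !mulrA.
Qed.

Lemma partial_catenoid_map (x : 'rV[R]_m) i : U x -> partial i M x =
  (r (L x) * expR (- L x)) *: delta_mx 0 (low_index i) + (x 0 i / sqnorm x) *:
   (((p (L x) - r (L x)) * expR (- L x)) *: emb x +
     ax ((r (L x) * p (L x) * sinh (v (L x)) - q (L x) * cosh (v (L x))) / rho (L x))
        ((r (L x) * p (L x) * cosh (v (L x)) - q (L x) * sinh (v (L x))) / rho (L x))).
Proof.
move=> Ux; pose s := L x; have tn := lt0r_neq0 Ux.
have da := der_half_log Ux (der_mul (der_radius tau0 hw s) (der_exp_real (der_opp (is_derive_id s 1)))).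
have db := der_half_log Ux (der_depth c0 tau0 hK hw s).
have dz := der_half_log Ux (der_height c0 tau0 hK hw s).
have [_] := der_radial (@low_index_inj k) i da (der_axis (axis_index k) db dz).
rewrite /partial => ->; rewrite -/(L x) -/s; congr (_ + _).
move: (rho s) (sqnorm x) tn => h t tn.
apply/rowP => j; rewrite !mxE.
by move: (expR _) (_ / h) (_ / h) => e B Z; field.
Qed.

Let coords (x : 'rV[R]_m) := cylinder_coord (@low_index_inj k) (@low_index_max k) (@low_index_axis k)
  (axis_index_max k) x.

Lemma catenoid_normalE (x : 'rV[R]_m) : nu x = emb ((q (L x) * expR (- L x)) *: x) +
  ax (normal_depth (L x)) (normal_height (L x)).
Proof. exact: cylindricalE. Qed.

Lemma minkowski_cylinder_pair (y y' : 'rV[R]_m) (B Z B' Z' : R) :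
  minkowski (emb y + ax B Z) (emb y' + ax B' Z') = \sum_i y 0 i * y' 0 i + B * B' - Z * Z'.
Proof.
have h1 := minkowski_axis (axis_index_max k) B Z B' Z'.
have h2 := minkowski_emb_axis (@low_index_max k) (@low_index_axis k) y B' Z'.
have h3 := minkowski_emb_axis (@low_index_max k) (@low_index_axis k) y' B Z.
have h4 := minkowski_emb (@low_index_inj k) (@low_index_max k) y y'.
move: (ax B Z) (ax B' Z') (emb y) (emb y') h1 h2 h3 h4 => A A' e e' h1 h2 h3 h4.
by rewrite minkowskiDl !minkowskiDr h1 h2 h4 [minkowski A e']minkowskiC h3; ring.
Qed.

Let sum_scale (a b : R) (x : 'rV[R]_m) :
  \sum_i (a *: x) 0 i * (b *: x) 0 i = a * b * sqnorm x.
Proof.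
rewrite /sqnorm mulr_sumr; apply: eq_bigr => i _.
by rewrite !mxE; ring.
Qed.

Lemma catenoid_normal_tangent (x : 'rV[R]_m) i : U x -> minkowski (partial i M x) (nu x) = 0.
Proof.
move=> Ux; rewrite partial_catenoid_map// minkowskiDl !minkowskiZl.
rewrite (minkowski_deltal _ (low_index_max i)) catenoid_normalE.
have [-> _ _] := coords ((q (L x) * expR (- L x)) *: x) (normal_depth (L x)) (normal_height (L x)).
set E := (p (L x) - r (L x)) * expR (- L x).
have -> : E *: emb x = emb (E *: x).
  rewrite /coordinate_embedding scaler_sumr; apply: eq_bigr => j _.
  by rewrite mxE scalerA.
rewrite minkowski_cylinder_pair sum_scale mxE /E /normal_depth /normal_height.
have E2 : expR (- L x) ^+ 2 = (sqnorm x)^-1 by exact: log_normK.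
have h2 := lorentz_sqr tau w (L x).
have ch := cosh2_sinh2 (v (L x)).
have rn := lt0r_neq0 (r0 (L x)); have hn := lt0r_neq0 (rho0 (L x)); have tn := lt0r_neq0 Ux.
move: (sqnorm x) tn E2 => t tn E2 {E}.
move: (r _) (p _) (q _) (rho _) (cosh _) (sinh _) (expR _) (x 0 i) rn hn E2 h2 ch.
move=> r' p' q' h y z e xi rn hn E2 h2 ch.
transitivity (q' * p' * xi * (e ^+ 2 - (1 + r' ^+ 2) * (y ^+ 2 - z ^+ 2) / h ^+ 2 / t)).
  by field; rewrite hn tn.
by rewrite E2 ch -h2 mulr1 divff ?expf_neq0// mul1r subrr mulr0.
Qed.

Lemma catenoid_unit_normal (x : 'rV[R]_m) : U x -> unit_normal M x (nu x).
Proof.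
move=> Ux; have E2 : expR (- L x) ^+ 2 = (sqnorm x)^-1 by exact: log_normK.
have h2 := lorentz_sqr tau w (L x); have pq := speed_flux k w tau0 (L x).
have ch := cosh2_sinh2 (v (L x)).
have rn := lt0r_neq0 (r0 (L x)); have hn := lt0r_neq0 (rho0 (L x)); have tn := lt0r_neq0 Ux.
split; last by move=> i; rewrite minkowskiC; exact: catenoid_normal_tangent.
- rewrite catenoid_normalE minkowski_cylinder_pair sum_scale /normal_depth /normal_height.
  move: (sqnorm x) tn E2 => t tn E2.
  move: (r _) (p _) (q _) (rho _) (cosh _) (sinh _) (expR _) rn hn E2 h2 pq ch.
  move=> r' p' q' h y z e rn hn E2 h2 pq ch.
  transitivity (q' ^+ 2 * (e ^+ 2 * t) + (p' ^+ 2 - q' ^+ 2 * r' ^+ 2) * (y ^+ 2 - z ^+ 2) / h ^+ 2).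
    by field; exact: hn.
  rewrite E2 mulVf// ch !mulr1.
  have -> : p' ^+ 2 = h ^+ 2 - q' ^+ 2 by rewrite -pq; ring.
  have -> : r' ^+ 2 = h ^+ 2 - 1 by rewrite h2; ring.
  by field; exact: hn.
- rewrite catenoid_normalE catenoid_mapE minkowski_cylinder_pair sum_scale.
  rewrite /normal_depth /normal_height /depth /height.
  move: (sqnorm x) tn E2 => t tn E2.
  move: (r _) (p _) (q _) (rho _) (cosh _) (sinh _) (expR _) rn hn E2 h2 pq ch.
  move=> r' p' q' h y z e rn hn E2 h2 pq ch.
  transitivity (q' * r' * (e ^+ 2 * t - (y ^+ 2 - z ^+ 2))).
    by field; exact: hn.
  by rewrite E2 mulVf// ch subrr mulr0.
Qed.

Lemma catenoid_det_neq0 (x : 'rV[R]_m) : U x -> \det (first_fundamental_form M x) != 0.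
Proof.
move=> Ux; rewrite (catenoid_det c0 tau0 hK hw Ux) expf_neq0// mulf_neq0//.
  by rewrite expf_neq0// lt0r_neq0.
by rewrite invr_neq0// expf_neq0// lt0r_neq0.
Qed.

Lemma catenoid_mean_curvature (x : 'rV[R]_m) : U x -> mean_curvature M x (nu x) = 0.
Proof.
move=> Ux; have tn := lt0r_neq0 Ux; have rn := lt0r_neq0 (r0 (L x)).
apply: (@mean_curvature_eq0 _ _ M nu U _ x (@open_punctured R m) Ux _ _
  (fun i => der_catenoid_normal i Ux)).
- by move=> y Uy j; exact: catenoid_normal_tangent.
- move=> i j; have [_ /(_ j) [_ [_ /(_ i) [+ _]]]] := catenoid_map_smooth c0 tau0 hK hw 2.
  exact.
- exact: catenoid_det_neq0.
(* m = N + 1 and the spherical directions number N, so the trace is N q/r - N q/r. *)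
- rewrite radial_operator_trace// (_ : m%:R = N + 1); last by rewrite natr1; congr _%:R; lia.
  by field; exact: rn.
Qed.

Lemma catenoid_map_proper (B : R) : exists a b, 0 < a /\
  forall x : 'rV[R]_m, U x -> M x 0 ord_max <= B -> a <= sqnorm x <= b.
Proof.
have le_min s : hei 0 <= hei s by rewrite -(height_norm c0 tau0 hK hw s) height_le_norm// normr0.
have X (x : 'rV[R]_m) : M x 0 ord_max = hei (L x) by have [] := catenoid_map_coord c tau w x.
have [hB|hB] := leP (hei 0) B; last first.
  (* No point of the catenoid lies this low, so any annulus will do. *)
  exists 1, 1; split=> // x _; rewrite X => h.
  by have := le_trans (le_min _) h; rewrite leNgt hB.
have [s s0 hs] := height_le c0 tau0 hK hw hB.
exists (expR (- (2 * s))), (expR (2 * s)); split; first exact: expR_gt0.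
move=> x Ux; rewrite X -hs => h; rewrite -log_norm_le//.
by rewrite -(height_le_norm c0 tau0 hK hw).
Qed.

Lemma catenoid_map_continuous : {in U, continuous M}.
Proof. exact: (catenoid_map_smooth c0 tau0 hK hw 0). Qed.

Lemma catenoid_local_parametrization : local_parametrization (catenoid k.+1 c) U M.
Proof.
split.
- exact: open_punctured.
- exact: (catenoid_map_smooth c0 tau0 hK hw).
- exact: (catenoid_map_inj c0 tau0 hK hw).
- by move=> x Ux; apply: gram_row_free; exact: catenoid_det_neq0.
- move=> V VU oV; rewrite -(image_catenoid_map c0 tau0 hK hw).
  apply: (proper_open_image catenoid_map_continuous catenoid_map_proper
    (catenoid_map_inj c0 tau0 hK hw) VU oV).
Qed.

Lemma catenoid_minimal : minimal_hypersurface (catenoid k.+1 c).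
Proof.
have E := image_catenoid_map c0 tau0 hK hw.
have inM x : catenoid k.+1 c x -> (M @` U) x by move=> Cx; exact: (eq_ind_r (fun S => S x) Cx E).
have Chyp : catenoid k.+1 c `<=` hyperbolic_space R m.
  by move=> y /inM[x Ux <-]; exact: catenoid_map_hyperbolic.
have C0 : catenoid k.+1 c !=set0.
  have i0 : 'I_m := Ordinal (isT : (0 < m)%N).
  have Ud : U (delta_mx 0 i0).
    rewrite /punctured /= sqnorm_gt0; apply/eqP => /rowP /(_ i0).
    by rewrite !mxE !eqxx => /eqP; rewrite oner_eq0.
  exists (M (delta_mx 0 i0)); rewrite -E.
  exact: (ex_intro2 _ _ _ Ud erefl).
have Ccl : closed (catenoid k.+1 c).
  rewrite -E; have := proper_closed catenoid_map_continuous catenoid_map_proper (@closedT _).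
  by rewrite setIT.
have Cco : connected (catenoid k.+1 c).
  rewrite -E; apply: connected_continuous_connected; first by apply: connected_punctured; lia.
  apply: continuous_in_subspaceT => x; exact: catenoid_map_continuous.
have param := catenoid_local_parametrization.
split; first by apply: And5 => // x /inM Mx; exists U, M; exact: conj param Mx.
move=> x /inM Mx; exists U, M; apply: And3 => // t Ut.
by apply: ex_intro2 (catenoid_unit_normal Ut) (catenoid_mean_curvature Ut).
Qed.

End catenoid_minimal.

(** * Consequences for boundedness and sign *)

Lemma catenoid_minimal_hypersurface (R : realType) (k : nat) (c : R) : 0 < c ->
  minimal_hypersurface (catenoid k.+1 c).
Proof.
move=> c0; have [t0 _] := neckP k c0; have [w hw] := exists_catenary k t0.
exact: (catenoid_minimal c0 t0 (neck_equation k c0) hw).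
Qed.

Lemma catenoid_area_below (R : realType) (k : nat) (K : R) :
  exists2 c, 0 < c & catenoid_renormalized_area k c < K.
Proof.
have /cvgrNyPlt h := @catenoid_renormalized_area_cvg0 R k.
have hK := h K.
have [c [h1 h2]] : exists c : R, 0 < c /\ catenoid_renormalized_area k c < K.
  apply: (@filter_ex _ (0 : R)^'+); near=> c; split; first by near: c; exact: nbhs_right_gt.
  by near: c.
by exists c.
Unshelve. all: by end_near. Qed.

(** k odd means n = k + 1 even, so (-4 pi)^n > 0: the limit at +oo is positive, and so are the
    values for all large c. *)
Lemma catenoid_area_pos (R : realType) (k : nat) : odd k ->
  exists2 c : R, 0 < c & 0 < catenoid_renormalized_area k c.
Proof.
move=> ok; have l0 : 0 < 2 * ((- (4 * pi)) ^+ k.+1 * k.+1`!%:R / (2 * k.+1)`!%:R : R).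
  apply: mulr_gt0 => //; apply: divr_gt0; last by rewrite ltr0n fact_gt0.
  apply: mulr_gt0; last by rewrite ltr0n fact_gt0.
  by rewrite exprn_even_gt0 /= ?ok// oppr_eq0 mulf_neq0// gt_eqF// pi_gt0.
have hK : \forall c \near +oo, 0 < @catenoid_renormalized_area R k c.
  by have := @catenoid_renormalized_area_cvgy R k => /cvgr_gt /(_ _ l0).
have [c [h1 h2]] : exists c : R, 0 < c /\ 0 < catenoid_renormalized_area k c.
  apply: (@filter_ex _ (pinfty_nbhs R)).
  exact: filterI (nbhs_pinfty_gt (num_real 0)) hK.
by exists c.
Qed.

Unset Implicit Arguments.

Theorem theorem6p6 (R : realType) (n : nat) (hn : (1 <= n)%N) :
  let AH2n : R := (- (4 * pi)) ^+ n * n`!%:R / (2 * n)`!%:R in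
  (exists AR : R -> R,
    [/\ forall c : R, 0 < c -> has_renormalized_area (catenoid n c) (AR c),
        {in `]0, +oo[, continuous AR},
        AR c @[c --> 0^'+] --> -oo,
        has_renormalized_area (totally_geodesic_H2n R n) AH2n
      & AR c @[c --> +oo] --> 2 * AH2n]) /\
  (forall K : R, exists (M : set 'rV[R]_(2 * n).+2) (a : R),
    [/\ hypersurface M, has_renormalized_area M a & a < K]) /\
  (~~ odd n ->
    (exists (M : set 'rV[R]_(2 * n).+2) (a : R),
      [/\ minimal_hypersurface M, has_renormalized_area M a & 0 < a]) /\
    (exists (M : set 'rV[R]_(2 * n).+2) (a : R),
      [/\ minimal_hypersurface M, has_renormalized_area M a & a < 0])).
Proof.
(* Everything is indexed by k = n - 1, which turns 2n - 1 into the successor [k.*2.+1] and avoids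
   truncated subtraction. *)
case: n hn => [//|k] _ AH2n; split; last split.
- exists (catenoid_renormalized_area k); split.
  + exact: catenoid_has_renormalized_area_neck.
  + move=> c; rewrite in_itv /= andbT => c0; exact: catenoid_renormalized_area_continuous.
  + exact: catenoid_renormalized_area_cvg0.
  + exact: totally_geodesic_has_renormalized_area.
  + exact: catenoid_renormalized_area_cvgy.
- move=> K; have [c c0 hc] := catenoid_area_below k K.
  exists (catenoid k.+1 c), (catenoid_renormalized_area k c).
  have [hyp _] := catenoid_minimal_hypersurface k c0.
  exact: And3 hyp (catenoid_has_renormalized_area_neck k c0) hc.
- rewrite /= negbK => ok; split.
    have [c c0 hc] := @catenoid_area_pos R k ok.
    exists (catenoid k.+1 c), (catenoid_renormalized_area k c).
    exact: And3 (catenoid_minimal_hypersurface k c0) (catenoid_has_renormalized_area_neck k c0) hc.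
  have [c c0 hc] := catenoid_area_below k (0 : R).
  exists (catenoid k.+1 c), (catenoid_renormalized_area k c).
  exact: And3 (catenoid_minimal_hypersurface k c0) (catenoid_has_renormalized_area_neck k c0) hc.
Qed.
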